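(* Let $\varphi$ be an entire function. Let $0<p<\infty$ and $\alpha>-1$. Then: (a) $S_\varphi(\mathcal{D})\subset A^p_\alpha$ if and only if $\varphi$ is of order less than $2$, or of order $2$ and finite type. (b) For $0<s<\infty$, $S_\varphi(Q_s)\subset A^p_\alpha$ if and only if $\varphi$ is of order less than one, or of order one and type zero. (c) For $0\le s<\infty$, $S_\varphi(A^p_\alpha)\subset Q_s$ if and only if $\varphi$ is constant.
   Context: $\mathbb{D}=\{z\in\mathbb{C}:|z|<1\}$, $\mathcal{H}ol(\mathbb{D})$ is the space of analytic functions in $\mathbb{D}$, and $dA(z)=\frac1\pi\,dx\,dy$. Superposition operator: for an entire function $\varphi$, $S_\varphi(f)=\varphi\circ f$ for $f\in\mathcal{H}ol(\mathbb{D})$. For $X,Y\subset\mathcal{H}ol(\mathbb{D})$, $S_\varphi(X)\subset Y$ means $\varphi\circ f\in Y$ for every $f\in X$. Spaces: for $0<p<\infty$ and $\alpha>-1$, the weighted Bergman space $A^p_\alpha$ is the set of $f\in\mathcal{H}ol(\mathbb{D})$ with $\int_{\mathbb{D}}(1-|z|^2)^\alpha|f(z)|^p\,dA(z)<\infty$. The classical Dirichlet space $\mathcal{D}$ is the set of $f\in\mathcal{H}ol(\mathbb{D})$ with $\int_{\mathbb{D}}|f'(z)|^2\,dA(z)<\infty$. For $0\le s<\infty$, $Q_s$ is the set of $f\in\mathcal{H}ol(\mathbb{D})$ with $\sup_{a\in\mathbb{D}}\int_{\mathbb{D}}|f'(z)|^2g(z,a)^s\,dA(z)<\infty$, where $g(z,a)=\log\left|\frac{1-\overline{a}z}{z-a}\right|$.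 Order and type: with $M(r,\varphi)=\max_{|z|=r}|\varphi(z)|$, the order of a non-constant entire function $\varphi$ is $\rho=\limsup_{r\to\infty}\frac{\log\log M(r,\varphi)}{\log r}$, and if $0<\rho<\infty$ its type is $\tau=\limsup_{r\to\infty}\frac{\log M(r,\varphi)}{r^\rho}$. Constant functions are regarded as having order $0$. *)

(* Defs.v *)
(* The complex numbers are R[i], over an arbitrary R : realType.  The normed
   module structure of R[i] over itself is carried by the regular module
   R[i]^o; with it, derivability at z in the direction 1 is complex
   differentiability at z. *)
From mathcomp Require Import all_boot all_order all_algebra.
From mathcomp Require Import complex.
From mathcomp Require Import all_classical all_reals all_analysis.

Set Implicit Arguments.
Unset Strict Implicit.
Unset Printing Implicit Defensive.

Import Order.TTheory GRing.Theory Num.Theory.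
Import numFieldTopology.Exports numFieldNormedType.Exports.
Import ComplexField.Normc.

Local Open Scope classical_set_scope.
Local Open Scope ring_scope.
Local Open Scope complex_scope.

Definition unit_disk (R : realType) : set R[i] := [set z | normc z < 1].

Definition C_derivable (R : realType) (f : R[i] -> R[i]) (z : R[i]) : Prop :=
  derivable (f : R[i]^o -> R[i]^o) (z : R[i]^o) (1 : R[i]^o).

Definition C_deriv (R : realType) (f : R[i] -> R[i]) : R[i] -> R[i] :=
  derive1 (f : R[i] -> R[i]^o).

(* Functions on the disk are represented by total functions; the function spaces
   below depend only on the values taken in the disk. *)
Definition Hol_disk (R : realType) : set (R[i] -> R[i]) :=
  [set f | forall z, unit_disk z -> C_derivable f z].

Definition entire (R : realType) (phi : R[i] -> R[i]) : Prop :=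
  forall z, C_derivable phi z.

Definition constant_fun (R : realType) (phi : R[i] -> R[i]) : Prop :=
  exists c : R[i], forall z, phi z = c.

Definition superposition (R : realType) (phi f : R[i] -> R[i]) : R[i] -> R[i] :=
  phi \o f.

(* Integral over the unit disk against dA = dx dy / pi. *)
Definition disk_integral (R : realType) (h : R[i] -> R) : \bar R :=
  ((pi^-1)%:E *
   \int[(@lebesgue_measure R) \x (@lebesgue_measure R)]_(w in
       [set w : R * R | unit_disk (w.1 +i* w.2)])
     (h (w.1 +i* w.2))%:E)%E.

Definition bergman_space (R : realType) (p alpha : R) : set (R[i] -> R[i]) :=
  [set f | @Hol_disk R f /\
    (disk_integral (fun z : R[i] =>
       (1 - normc z ^+ 2) `^ alpha * normc (f z) `^ p)%R < +oo)%E].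

Definition dirichlet_space (R : realType) : set (R[i] -> R[i]) :=
  [set f | @Hol_disk R f /\
    (disk_integral (fun z : R[i] => normc (C_deriv f z) ^+ 2)%R < +oo)%E].

(* The pole z = a, a null set for dA, receives the value 0 here, since
   x / 0 = 0 and ln 0 = 0. *)
Definition green_disk (R : realType) (z a : R[i]) : R :=
  ln (normc ((1 - a^* * z) / (z - a))).

(* x `^ 0 = 1 for every x, so that Q_space 0 is the Dirichlet space. *)
Definition Q_space (R : realType) (s : R) : set (R[i] -> R[i]) :=
  [set f | @Hol_disk R f /\
    (ereal_sup [set disk_integral (fun z : R[i] =>
                  normc (C_deriv f z) ^+ 2 * green_disk z a `^ s)%R
               | a in @unit_disk R] < +oo)%E].

(* For continuous phi and r >= 0 this supremum is a maximum. *)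
Definition max_modulus (R : realType) (r : R) (phi : R[i] -> R[i]) : R :=
  sup [set normc (phi z) | z in [set z | normc z = r]].

(* For phi entire and non-constant, max_modulus r phi tends to +oo with r, so
   the convention ln x = 0 for x <= 0 does not affect the upper limits. *)
Definition entire_order (R : realType) (phi : R[i] -> R[i]) : \bar R :=
  if `[< constant_fun phi >] then 0%E
  else limf_esup (fun r : R => (ln (ln (max_modulus r phi)) / ln r)%:E)
                 (pinfty_nbhs R).

(* Meaningful only when the order is positive and finite. *)
Definition entire_type (R : realType) (phi : R[i] -> R[i]) : \bar R :=
  limf_esup
    (fun r : R => (ln (max_modulus r phi) / r `^ fine (entire_order phi))%:E)
    (pinfty_nbhs R).

(* Main.v *)
(* Sufficiency.  A function of the Dirichlet space is o((log 1/(1-|z|))^(1/2)), and a function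
   of Q_s, which is contained in the Bloch space, is O(log 1/(1-|z|)).  Under the growth condition
   on phi, |phi o f| is then O((1-|z|)^-e) for every e > 0, hence phi o f is in every weighted
   Bergman space.

   Necessity.  Put f_c(z) = sum_k c_k 2^-k / (1 + 2^-k - z).  This function is in the Dirichlet
   space when c is square summable, in every Q_s with s > 0 when c is bounded, and in every
   weighted Bergman space when c grows polynomially, while its value at 1 - 2^-m is roughly
   c_0 + ... + c_m.  If phi o f_c is in the target space for all such c, then its values at the
   points 1 - 2^-m are O(T_m), with T_m = 2^(N m) for a Bergman space and T_m = m + 1 for Q_s,
   and a gliding hump argument makes this uniform in c.  Spreading a given value w over a block
   of coefficients whose last index m is as small as the constraint on c permits (m ~ |w|^2,
   m ~ e|w| for every e > 0, m ~ |w|^(1/2), respectively) turns it into a bound on |phi(w)|; in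
   the last case the bound is o(|w|) and phi is constant by Liouville's theorem.

   The pointwise bounds come from mean values over squares, obtained by averaging Cauchy's
   formula over rectangles. *)
Require Import Defs.
From mathcomp Require Import all_boot all_order all_algebra.
From mathcomp Require Import complex.
From mathcomp Require Import all_classical all_reals all_analysis.
From mathcomp Require Import measurable_realfun.
From mathcomp Require Import ring lra.

Set Implicit Arguments.
Unset Strict Implicit.
Unset Printing Implicit Defensive.

Import Order.TTheory GRing.Theory Num.Theory.
Import numFieldTopology.Exports numFieldNormedType.Exports.
Import ComplexField.Normc.

Local Open Scope classical_set_scope.
Local Open Scope ring_scope.
Local Open Scope complex_scope.

Local Notation Re := complex.Re.
Local Notation Im := complex.Im.

(** The premise of each necessity statement is qualitative: every [c] comes with its own constant.
    As [phi] acts nonlinearly, no linear uniform boundedness principle applies. The gliding hump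
    supplies uniformity, but only near one unknown finitely supported [c0]; hence the shift by [A]
    in [hump_reach] and the blocks placed beyond [n0]. The test family works because its kernels are
    positive at the points 1 - 2^-m, and lie between 1/2 and 1 there when k <= m: a constant block
    cannot cancel, and since the value is linear in the coefficients every [w] is attained exactly.

    Dyadic radii replace logarithms: |z| = 1 - 2^-m means log 1/(1-|z|) = m log 2. Rectangles
    replace circles because Fubini for the product measure delivers integrals over horizontal and
    vertical segments directly. Cauchy's formula is kept only as an inequality, with 4 in place of 2
    pi. For p < 1 the linear mean value inequality does not suffice for Bergman functions; a
    bootstrap on a weighted supremum takes the place of subharmonicity of |F|^p. *)

Lemma normcE (R : realType) (z : R[i]) : `|z| = (normc z)%:C.
Proof. by case: z. Qed.

Lemma normc_ge0 (R : realType) (z : R[i]) : 0 <= normc z.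
Proof. by case: z => x y /=; exact: sqrtr_ge0. Qed.

Lemma normcB (R : realType) (x y : R[i]) : normc (x - y) = normc (y - x).
Proof. by rewrite -normcN opprB. Qed.

Lemma normc_real (R : realType) (x : R) : normc (x%:C) = `|x|.
Proof. by rewrite /= expr0n /= addr0 sqrtr_sqr. Qed.

Lemma normc_eq0 (R : realType) (z : R[i]) : (normc z == 0) = (z == 0).
Proof.
by apply/eqP/eqP => [/eq0_normc//|->]; rewrite normc0.
Qed.

Lemma normc_gt0 (R : realType) (z : R[i]) : (0 < normc z) = (z != 0).
Proof. by rewrite lt_def normc_ge0 andbT normc_eq0. Qed.

(** Division-free, so that [h = 0] needs no exclusion, and with real tolerances: the norm carried by
    [R[i]] is itself [R[i]]-valued, which would make every epsilon and delta a complex number. *)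
Definition is_cd (R : realType) (f : R[i] -> R[i]) (z L : R[i]) : Prop :=
  forall e : R, 0 < e -> exists2 d : R, 0 < d &
    forall h, normc h < d -> normc (f (z + h) - f z - L * h) <= e * normc h.

(** A positive element of [R[i]] is real, so a complex tolerance equals its own real part and can be
    exchanged for an element of [R]. *)
Lemma dnbhs_cvgcP (R : realType) (g : R[i]^o -> R[i]^o) (L : R[i]^o) :
  g @ (0 : R[i]^o)^' --> L <->
  forall e : R, 0 < e -> exists2 d : R, 0 < d &
    forall h : R[i], normc h < d -> h != 0 -> normc (L - g h) <= e.
Proof.
rewrite cvgrPdist_le; split=> H.
  move=> e e0; have := H e%:C; rewrite ltcR => /(_ e0)[d /= d0 Hd].
  have dE' : d = (Re d)%:C by rewrite RRe_real // gtr0_real.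
  exists (Re d); first by rewrite -ltcR -dE'.
  move=> h hd h0; have := Hd h.
  by rewrite /ball_ /= sub0r normrN normcE dE' ltcR normcE lecR => /(_ hd h0).
move=> e e0.
have eE' : e = (Re e)%:C by rewrite RRe_real // gtr0_real.
have e0' : 0 < Re e by rewrite -ltcR -eE'.
have [d d0 Hd] := H _ e0'.
exists d%:C => /=; first by rewrite ltcR.
move=> h; rewrite /ball_ /= sub0r normrN normcE ltcR => hd h0.
by rewrite normcE eE' lecR; exact: Hd.
Qed.

Lemma is_cd_deriveP (R : realType) (f : R[i]^o -> R[i]^o) (z L : R[i]^o) :
  is_cd f z L <-> is_derive z 1 f L.
Proof.
have E (h : R[i]) : h != 0 ->
    normc (L - h^-1 *: (f (h *: (1 : R[i]^o) + z) - f z)) * normc h =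
    normc (f (z + h) - f z - L * h).
  move=> h0; rewrite scaler1 [h + z]addrC -normcM normcB; congr normc.
  by rewrite /GRing.scale/=; field.
split=> [H|[df dL] e e0].
  suff cvf : (fun h : R[i]^o => h^-1 *: (f (h *: (1 : R[i]^o) + z) - f z)) @ (0 : R[i]^o)^' --> L.
    split; first by apply/cvg_ex; exists L.
    exact: (cvg_lim _ cvf).
  apply/dnbhs_cvgcP => e e0; have [d d0 Hd] := H _ e0.
  exists d => // h hd h0.
  by rewrite -(@ler_pM2r _ (normc h)) ?normc_gt0// E //; exact: Hd.
have /dnbhs_cvgcP/(_ e e0)[d d0 Hd] :
    (fun h : R[i]^o => h^-1 *: (f (h *: (1 : R[i]^o) + z) - f z)) @ (0 : R[i]^o)^' --> L.
  by rewrite -dL; exact: df.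
exists d => // h hd; have [->|h0] := eqVneq h 0.
  by rewrite addr0 subrr mulr0 subr0 normc0 mulr0.
by rewrite -E // ler_pM2r ?normc_gt0//; exact: Hd.
Qed.

Lemma C_derivE (R : realType) (f : R[i]^o -> R[i]^o) (z : R[i]^o) :
  C_deriv f z = 'D_1 f z.
Proof. exact: (@derive1E R[i] (R[i]^o) f z). Qed.

Lemma C_derivableP (R : realType) (f : R[i]^o -> R[i]^o) (z : R[i]^o) :
  C_derivable f z <-> is_cd f z (C_deriv f z).
Proof.
split=> [H|/is_cd_deriveP[]//].
have [_] := @is_cd_deriveP R f z (C_deriv f z).
apply; exact: (DeriveDef H (esym (C_derivE f z))).
Qed.

Lemma is_cd_C_deriv (R : realType) (f : R[i]^o -> R[i]^o) (z L : R[i]^o) :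
  is_cd f z L -> C_deriv f z = L.
Proof. by move/is_cd_deriveP => [_ <-]; exact: C_derivE. Qed.

Lemma is_cd_C_derivable (R : realType) (f : R[i] -> R[i]) (z L : R[i]) :
  is_cd f z L -> C_derivable f z.
Proof. by move=> H; rewrite C_derivableP (is_cd_C_deriv H). Qed.

Lemma is_cd_eq (R : realType) (f : R[i] -> R[i]) (z L L' : R[i]) :
  is_cd f z L -> L = L' -> is_cd f z L'.
Proof. by move=> ? <-. Qed.

Lemma is_cd_cst (R : realType) (c z : R[i]) : is_cd (fun=> c) z 0.
Proof. by rewrite is_cd_deriveP; exact: is_derive_cst. Qed.

Lemma is_cd_id (R : realType) (z : R[i]) : is_cd id z 1.
Proof. by rewrite is_cd_deriveP; exact: is_derive_id. Qed.

Lemma is_cdD (R : realType) (f g : R[i] -> R[i]) (z L M : R[i]) :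
  is_cd f z L -> is_cd g z M -> is_cd (fun w => f w + g w) z (L + M).
Proof. by rewrite !is_cd_deriveP => ? ?; exact: is_deriveD. Qed.

Lemma is_cdN (R : realType) (f : R[i] -> R[i]) (z L : R[i]) :
  is_cd f z L -> is_cd (fun w => - f w) z (- L).
Proof. by rewrite !is_cd_deriveP => ?; exact: is_deriveN. Qed.

Lemma is_cdB (R : realType) (f g : R[i] -> R[i]) (z L M : R[i]) :
  is_cd f z L -> is_cd g z M -> is_cd (fun w => f w - g w) z (L - M).
Proof. by move=> ? /is_cdN; exact: is_cdD. Qed.

Lemma is_cdM (R : realType) (f g : R[i] -> R[i]) (z L M : R[i]) :
  is_cd f z L -> is_cd g z M -> is_cd (fun w => f w * g w) z (f z * M + g z * L).
Proof.
rewrite !is_cd_deriveP => ? ?.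
exact: (@is_deriveM _ (R[i]^o) (f : R[i]^o -> R[i]^o) (g : R[i]^o -> R[i]^o)).
Qed.

Lemma is_cdV (R : realType) (f : R[i] -> R[i]) (z L : R[i]) :
  f z != 0 -> is_cd f z L -> is_cd (fun w => (f w)^-1) z (- (f z) ^- 2 * L).
Proof.
rewrite !is_cd_deriveP => fz [df <-]; split.
  exact: (@derivableV _ (R[i]^o) (f : R[i]^o -> R[i]^o)).
exact: (@deriveV _ (R[i]^o) (f : R[i]^o -> R[i]^o)).
Qed.

Lemma is_cd_comp (R : realType) (f g : R[i] -> R[i]) (z L M : R[i]) :
  is_cd f z L -> is_cd g (f z) M -> is_cd (fun w => g (f w)) z (M * L).
Proof.
move=> Hf Hg e e0.
pose K := normc L + 1.
have K0 : 0 < K by rewrite ltr_wpDl ?normc_ge0.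
pose M1 := normc M + 1.
have M10 : 0 < M1 by rewrite ltr_wpDl ?normc_ge0.
have e1 : 0 < e / (2 * K) by rewrite divr_gt0 // mulr_gt0.
have e2 : 0 < e / (2 * M1) by rewrite divr_gt0 // mulr_gt0.
have [d1 d10 H1] := Hg _ e1.
have [d2 d20 H2] := Hf _ e2.
(* Tolerance 1 bounds the increment of [f] by [K] times that of the variable. The total error then
   splits into that of [g] and [M] times that of [f], each receiving half of [e]. *)
have [d3 d30 H3] := Hf _ ltr01.
exists (Num.min (d1 / K) (Num.min d2 d3)); first by rewrite !lt_min divr_gt0 // d20 d30.
move=> h; rewrite !lt_min => /and3P[h1 h2 h3].
have Q : normc (f (z + h) - f z) <= K * normc h.
  have -> : f (z + h) - f z = (f (z + h) - f z - L * h) + L * h by ring.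
  apply: le_trans (le_normcD _ _) _; rewrite normcM /K mulrDl mul1r addrC lerD2l.
  by apply: le_trans (H3 _ h3) _; rewrite mul1r.
have Q1 : normc (f (z + h) - f z) < d1.
  by apply: le_lt_trans Q _; rewrite mulrC -ltr_pdivlMr.
have := H1 _ Q1; rewrite [f z + _]addrC subrK => A.
have -> : g (f (z + h)) - g (f z) - M * L * h =
  (g (f (z + h)) - g (f z) - M * (f (z + h) - f z)) + M * (f (z + h) - f z - L * h) by ring.
apply: le_trans (le_normcD _ _) _; rewrite normcM.
have B1 : normc (g (f (z + h)) - g (f z) - M * (f (z + h) - f z)) <= e / 2 * normc h.
  apply: le_trans A _.
  apply: le_trans (ler_wpM2l (ltW e1) Q) _.
  rewrite le_eqVlt; apply/orP; left; apply/eqP; field; exact: lt0r_neq0.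
have B2 : normc M * normc (f (z + h) - f z - L * h) <= e / 2 * normc h.
  apply: (@le_trans _ _ (M1 * (e / (2 * M1) * normc h))).
    apply: ler_pM; rewrite ?normc_ge0 //; first by rewrite /M1 lerDl.
    exact: H2.
  rewrite le_eqVlt; apply/orP; left; apply/eqP; field; exact: lt0r_neq0.
lra.
Qed.

Lemma is_cd_affine (R : realType) (a b z : R[i]) : is_cd (fun w => a + b * w) z b.
Proof.
apply: (is_cd_eq (is_cdD (is_cd_cst _ _) (is_cdM (is_cd_cst _ _) (is_cd_id _)))).
by rewrite mulr0 addr0 mulr1 add0r.
Qed.

(** * Integrals of complex-valued functions along segments *)

Lemma normc_Re (R : realType) (z : R[i]) : `|Re z| <= normc z.
Proof.
case: z => x y /=; rewrite -sqrtr_sqr; apply: ler_wsqrtr.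
by rewrite lerDl sqr_ge0.
Qed.

Lemma normc_Im (R : realType) (z : R[i]) : `|Im z| <= normc z.
Proof.
case: z => x y /=; rewrite -sqrtr_sqr; apply: ler_wsqrtr.
by rewrite lerDr sqr_ge0.
Qed.

Lemma normc_le_ReIm (R : realType) (z : R[i]) : normc z <= `|Re z| + `|Im z|.
Proof.
case: z => x y /=.
rewrite -[leRHS]ger0_norm ?addr_ge0// -sqrtr_sqr; apply: ler_wsqrtr.
rewrite sqrrD !real_normK ?num_real// lerD2r lerDl.
by rewrite mulrn_wge0// mulr_ge0.
Qed.

Lemma ler_dist_normc (R : realType) (z w : R[i]) : `|normc z - normc w| <= normc (z - w).
Proof.
have H (a b : R[i]) : normc a - normc b <= normc (a - b).
  by rewrite lerBlDr -{1}(subrK b a); exact: le_normcD.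
rewrite ler_norml H andbT.
by have := H w z; rewrite normcB; lra.
Qed.

(** The point [y] may leave [[a, b]]: this two-sided form passes to subintervals without separate
    treatment of endpoints. *)
Definition ccts (R : realType) (g : R -> R[i]) (a b : R) : Prop :=
  forall x, a <= x <= b -> forall e : R, 0 < e -> exists2 d : R, 0 < d &
    forall y, `|y - x| < d -> normc (g y - g x) <= e.

Lemma within_cts (R : realType) (u : R -> R) (a b : R) :
  (forall x, a <= x <= b -> forall e : R, 0 < e -> exists2 d : R, 0 < d &
    forall y, `|y - x| < d -> `|u y - u x| <= e) ->
  {within `[a, b], continuous u}.
Proof.
move=> H; apply/continuous_in_subspaceT => x; rewrite inE /= in_itv /= => xab.
apply/cvgrPdist_le => /= e e0; have [d d0 Hd] := H _ xab _ e0.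
exists d => //= y; rewrite /ball_ /= distrC => /Hd.
by rewrite distrC.
Qed.

Lemma ccts_Re (R : realType) (g : R -> R[i]) (a b : R) : ccts g a b ->
  {within `[a, b], continuous (fun x => Re (g x))}.
Proof.
move=> H; apply: within_cts => x /H{}H e /H[d d0 Hd]; exists d => // y /Hd.
by apply: le_trans; rewrite -[X in `|X|]raddfB; exact: normc_Re.
Qed.

Lemma ccts_Im (R : realType) (g : R -> R[i]) (a b : R) : ccts g a b ->
  {within `[a, b], continuous (fun x => Im (g x))}.
Proof.
move=> H; apply: within_cts => x /H{}H e /H[d d0 Hd]; exists d => // y /Hd.
by apply: le_trans; rewrite -[X in `|X|]raddfB; exact: normc_Im.
Qed.

Lemma ccts_norm (R : realType) (g : R -> R[i]) (a b : R) : ccts g a b ->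
  {within `[a, b], continuous (fun x => normc (g x))}.
Proof.
move=> H; apply: within_cts => x /H{}H e /H[d d0 Hd]; exists d => // y /Hd.
by apply: le_trans; exact: ler_dist_normc.
Qed.

Section cint.
Context (R : realType).
Implicit Types (g h : R -> R[i]) (a b : R).
Let leb := @lebesgue_measure R.

Definition cint g a b : R[i] :=
  (\int[leb]_(x in `[a, b]) Re (g x)) +i* (\int[leb]_(x in `[a, b]) Im (g x)).

Lemma within_integrable (u : R -> R) a b : {within `[a, b], continuous u} ->
  leb.-integrable `[a, b] (EFin \o u).
Proof. by move=> H; apply: continuous_compact_integrable => //; exact: segment_compact. Qed.

Lemma cintB g h a b : ccts g a b -> ccts h a b ->
  cint (fun x => g x - h x) a b = cint g a b - cint h a b.
Proof.
move=> cg ch; apply/eqP; rewrite eq_complex /=; apply/andP; split; apply/eqP.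
  under eq_Rintegral do rewrite raddfB.
  by rewrite RintegralB //; apply: within_integrable; exact: ccts_Re.
under eq_Rintegral do rewrite raddfB.
by rewrite RintegralB //; apply: within_integrable; exact: ccts_Im.
Qed.

Lemma Rintegral_split (u : R -> R) a b c : a <= b -> b <= c ->
  {within `[a, c], continuous u} ->
  \int[leb]_(x in `[a, c]) u x = \int[leb]_(x in `[a, b]) u x + \int[leb]_(x in `[b, c]) u x.
Proof.
move=> ab bc /within_integrable iu.
have := @Rintegral_itvB _ u (BLeft a) (BRight c) b iu.
rewrite !bnd_simp => /(_ ab bc).
rewrite Rintegral_itv_obnd_cbnd; last first.
  apply: integrableS iu => //.
  by apply: subset_itvr; rewrite bnd_simp.
by move=> <-; rewrite addrC subrK.
Qed.

Lemma cint_split g a b c : a <= b -> b <= c -> ccts g a c ->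
  cint g a c = cint g a b + cint g b c.
Proof.
move=> ab bc cg; apply/eqP; rewrite eq_complex /=; apply/andP; split; apply/eqP.
  by apply: Rintegral_split => //; exact: ccts_Re.
by apply: Rintegral_split => //; exact: ccts_Im.
Qed.

(** Real and imaginary parts are bounded separately, which costs the factor 2 and spares a rotation
    argument; the loss is carried through all later constants. *)
Lemma cint_norm g a b : ccts g a b ->
  normc (cint g a b) <= 2 * \int[leb]_(x in `[a, b]) normc (g x).
Proof.
move=> cg; apply: le_trans (normc_le_ReIm _) _ => /=.
rewrite mulr_natl mulr2n; apply: lerD.
  apply: le_trans (le_normr_Rintegral _ _) _ => //.
    exact/within_integrable/ccts_Re.
  apply: le_Rintegral => //.
  - exact/integrable_norm/within_integrable/ccts_Re.
  - exact/within_integrable/ccts_norm.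
  - by move=> x _; exact: normc_Re.
apply: le_trans (le_normr_Rintegral _ _) _ => //.
  exact/within_integrable/ccts_Im.
apply: le_Rintegral => //.
- exact/integrable_norm/within_integrable/ccts_Im.
- exact/within_integrable/ccts_norm.
- by move=> x _; exact: normc_Im.
Qed.

Lemma Rintegral_cst_itv a b (c : R) : a <= b -> \int[leb]_(x in `[a, b]) c = c * (b - a).
Proof.
move=> ab; rewrite Rintegral_cst //= lebesgue_measure_itv /= lte_fin.
move: ab; rewrite le_eqVlt => /predU1P[->|->//]; by rewrite ltxx subrr.
Qed.

Lemma le_Rintegral_cst (u : R -> R) a b (M : R) : a <= b ->
  {within `[a, b], continuous u} ->
  (forall x, a <= x <= b -> u x <= M) -> \int[leb]_(x in `[a, b]) u x <= M * (b - a).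
Proof.
move=> ab cu uM; rewrite -Rintegral_cst_itv //; apply: le_Rintegral => //.
- exact: within_integrable.
- by apply: within_integrable => x; exact: cst_continuous.
Qed.

Lemma ge_Rintegral_cst (u : R -> R) a b (M : R) : a <= b ->
  {within `[a, b], continuous u} ->
  (forall x, a <= x <= b -> M <= u x) -> M * (b - a) <= \int[leb]_(x in `[a, b]) u x.
Proof.
move=> ab cu uM; rewrite -Rintegral_cst_itv //; apply: le_Rintegral => //.
- by apply: within_integrable => x; exact: cst_continuous.
- exact: within_integrable.
Qed.

Lemma cintZ (c : R[i]) g a b : ccts g a b -> cint (fun x => c * g x) a b = c * cint g a b.
Proof.
move=> cg; have iR := within_integrable (ccts_Re cg); have iI := within_integrable (ccts_Im cg).
have mI (k : R) (u : R -> R) : leb.-integrable `[a, b] (EFin \o u) ->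
    leb.-integrable `[a, b] (EFin \o (fun x => k * u x)).
  move=> iu; rewrite (_ : _ \o _ = (fun x => k%:E * (EFin \o u) x)%E); first exact: integrableZl.
  by apply/funext => x /=; rewrite EFinM.
case: c => p q; apply/eqP; rewrite eq_complex /=; apply/andP; split; apply/eqP.
  rewrite -!RintegralZl // -RintegralB //; [|exact: mI..].
  by apply: eq_Rintegral => x _; case: (g x).
rewrite -!RintegralZl // -RintegralD //; [|exact: mI..].
by apply: eq_Rintegral => x _; case: (g x).
Qed.

Lemma cint_le g a b M : a <= b -> ccts g a b ->
  (forall x, a <= x <= b -> normc (g x) <= M) ->
  normc (cint g a b) <= 2 * (M * (b - a)).
Proof.
move=> ab cg gM; apply: le_trans (cint_norm cg) _; rewrite ler_pM2l //.
by apply: le_Rintegral_cst => //; exact: ccts_norm.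
Qed.

Lemma Rintegral_FTC (u U : R -> R) a b : a <= b ->
  {within `[a, b], continuous u} ->
  (forall x : R, a <= x <= b -> is_derive x 1 U (u x)) ->
  \int[leb]_(x in `[a, b]) u x = U b - U a.
Proof.
rewrite le_eqVlt => /predU1P[->|ab] cu dU.
  by rewrite set_itv1 Rintegral_set1 subrr.
have cU x : a <= x <= b -> {for x, continuous U}.
  move=> xab; apply: differentiable_continuous; apply/derivable1_diffP.
  by have [] := dU _ xab.
rewrite /Rintegral (@continuous_FTC2 _ u U) //.
- split.
  + move=> x; rewrite in_itv /= => /andP[ax xb].
    by have [] := dU x (introT andP (conj (ltW ax) (ltW xb))).
  + by apply: cvg_at_right_filter; apply: cU; rewrite lexx ltW.
  + by apply: cvg_at_left_filter; apply: cU; rewrite lexx ltW.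
- move=> x; rewrite in_itv /= => /andP[ax xb].
  by rewrite derive1E; have /dU[_ ->] : a <= x <= b by rewrite !ltW.
Qed.

Lemma is_derive_real (U : R -> R) (x L : R) :
  (forall e : R, 0 < e -> exists2 d : R, 0 < d & forall h : R, `|h| < d ->
     `|U (x + h) - U x - L * h| <= e * `|h|) -> is_derive x 1 U L.
Proof.
move=> H.
have cvf : (fun h : R => h^-1 *: (U (h *: (1 : R) + x) - U x)) @ (0 : R)^' --> L.
  apply/cvgrPdist_le => e e0; have [d d0 Hd] := H _ e0.
  exists d => //= h; rewrite /ball_ /= sub0r normrN => hd h0.
  rewrite -(@ler_pM2r _ `|h|) ?normr_gt0 // -normrM.
  rewrite /GRing.scale /= mulr1 [h + x]addrC.
  suff -> : (L - h^-1 * (U (x + h) - U x)) * h = - (U (x + h) - U x - L * h).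
    by rewrite normrN; exact: Hd.
  by field.
split; first by apply/cvg_ex; exists L.
exact: (cvg_lim _ cvf).
Qed.

(** On the line [z + x u] the real and imaginary parts of [F] are functions of one real variable
    with derivatives the parts of [u f]; the real fundamental theorem applies to each. *)
Lemma cint_FTC (F f : R[i] -> R[i]) (z u : R[i]) a b : a <= b ->
  (forall x, a <= x <= b -> is_cd F (z + x%:C * u) (f (z + x%:C * u))) ->
  ccts (fun x => f (z + x%:C * u)) a b ->
  cint (fun x => u * f (z + x%:C * u)) a b = F (z + b%:C * u) - F (z + a%:C * u).
Proof.
move=> ab dF cf.
have cuf : ccts (fun x => u * f (z + x%:C * u)) a b.
  move=> x /cf{}cf e e0.
  have K0 : 0 < normc u + 1 by rewrite ltr_wpDl ?normc_ge0.
  have [|d d0 Hd] := cf (e / (normc u + 1)); first by rewrite divr_gt0.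
  exists d => // y /Hd; rewrite -mulrBr normcM ler_pdivlMr // mulrC => /(fun H => le_trans _ H); apply.
  by rewrite ler_wpM2r ?normc_ge0// lerDl.
have key x : a <= x <= b -> forall e : R, 0 < e -> exists2 d : R, 0 < d & forall h : R, `|h| < d ->
   normc (F (z + (x + h)%:C * u) - F (z + x%:C * u) - (u * f (z + x%:C * u)) * h%:C) <= e * `|h|.
  move=> /dF{}dF e e0.
  have K0 : 0 < normc u + 1 by rewrite ltr_wpDl ?normc_ge0.
  have [|d d0 Hd] := dF (e / (normc u + 1)); first by rewrite divr_gt0.
  exists (d / (normc u + 1)); first by rewrite divr_gt0.
  move=> h hd.
  have E : z + (x + h)%:C * u = z + x%:C * u + h%:C * u by rewrite rmorphD; ring.
  have hu : normc (h%:C * u) <= `|h| * (normc u + 1).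
    by rewrite normcM normc_real ler_wpM2l// lerDl.
  have hu1 : normc (h%:C * u) < d.
    by apply: le_lt_trans hu _; rewrite -ltr_pdivlMr.
  have := Hd _ hu1; rewrite -E.
  have -> : f (z + x%:C * u) * (h%:C * u) = u * f (z + x%:C * u) * h%:C by ring.
  move=> /le_trans; apply.
  apply: (@le_trans _ _ (e / (normc u + 1) * (`|h| * (normc u + 1)))).
    by rewrite ler_wpM2l// ltW // divr_gt0.
  rewrite le_eqVlt; apply/orP; left; apply/eqP; field; exact: lt0r_neq0.
have ReM (w : R[i]) (h : R) : Re (w * h%:C) = Re w * h.
  by case: w => p q /=; rewrite mulr0 subr0.
have ImM (w : R[i]) (h : R) : Im (w * h%:C) = Im w * h.
  by case: w => p q /=; rewrite mulr0 add0r.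
apply/eqP; rewrite eq_complex /=; apply/andP; split; apply/eqP.
  rewrite raddfB; apply: (@Rintegral_FTC _ (fun x => Re (F (z + x%:C * u)))) => //.
  - exact: ccts_Re.
  - move=> x /key{}key; apply: is_derive_real => e /key[d d0 Hd]; exists d => // h /Hd.
    by apply: le_trans; rewrite -ReM -!raddfB; exact: normc_Re.
rewrite raddfB; apply: (@Rintegral_FTC _ (fun x => Im (F (z + x%:C * u)))) => //.
- exact: ccts_Im.
- move=> x /key{}key; apply: is_derive_real => e /key[d d0 Hd]; exists d => // h /Hd.
  by apply: le_trans; rewrite -ImM -!raddfB; exact: normc_Im.
Qed.

End cint.

(** * Contour integrals over rectangles *)

Definition cca (R : realType) (f : R[i] -> R[i]) (z : R[i]) : Prop :=
  forall e : R, 0 < e -> exists2 d : R, 0 < d &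
    forall h, normc h < d -> normc (f (z + h) - f z) <= e.

Lemma is_cd_cca (R : realType) (f : R[i] -> R[i]) (z L : R[i]) : is_cd f z L -> cca f z.
Proof.
move=> H e e0; have [d d0 Hd] := H _ ltr01.
have K0 : 0 < normc L + 1 by rewrite ltr_wpDl ?normc_ge0.
exists (Num.min d (e / (normc L + 1))); first by rewrite lt_min d0 divr_gt0.
move=> h; rewrite lt_min => /andP[hd].
rewrite ltr_pdivlMr // => he.
have -> : f (z + h) - f z = (f (z + h) - f z - L * h) + L * h by ring.
apply: le_trans (le_normcD _ _) _; rewrite normcM.
have := Hd _ hd; rewrite mul1r; nra.
Qed.

Section rint.
Context (R : realType).
Implicit Types (f g : R[i] -> R[i]) (x y : R).

Definition in_rect x0 x1 y0 y1 (z : R[i]) : bool :=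
  (x0 <= Re z <= x1) && (y0 <= Im z <= y1).

(** The contour integral, counterclockwise; the vertical sides carry ['i] because dw = i dy
    there. *)
Definition rint f x0 x1 y0 y1 : R[i] :=
  cint (fun x => f (x +i* y0)) x0 x1 + 'i * cint (fun y => f (x1 +i* y)) y0 y1
  - cint (fun x => f (x +i* y1)) x0 x1 - 'i * cint (fun y => f (x0 +i* y)) y0 y1.

Lemma ccts_h f x0 x1 y : (forall x, x0 <= x <= x1 -> cca f (x +i* y)) ->
  ccts (fun x => f (x +i* y)) x0 x1.
Proof.
move=> H x /H{}H e /H[d d0 Hd]; exists d => // x' hx'.
have -> : (x' +i* y) = (x +i* y) + (x' - x)%:C by apply/eqP; rewrite eq_complex /= addr0 addrC subrK !eqxx.
by apply: Hd; rewrite normc_real.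
Qed.

Lemma normc_iM (t : R) : normc (0 +i* t) = `|t|.
Proof. by rewrite /= expr0n /= add0r sqrtr_sqr. Qed.

Lemma ccts_v f x y0 y1 : (forall y, y0 <= y <= y1 -> cca f (x +i* y)) ->
  ccts (fun y => f (x +i* y)) y0 y1.
Proof.
move=> H y /H{}H e /H[d d0 Hd]; exists d => // y' hy'.
have -> : (x +i* y') = (x +i* y) + (0 +i* (y' - y)).
  by apply/eqP; rewrite eq_complex /= addr0 [y + _]addrC subrK !eqxx.
by apply: Hd; rewrite normc_iM.
Qed.

Definition cca_rect f x0 x1 y0 y1 := forall z, in_rect x0 x1 y0 y1 z -> cca f z.

Definition on_bd x0 x1 y0 y1 (z : R[i]) : bool := in_rect x0 x1 y0 y1 z &&
  [|| Re z == x0, Re z == x1, Im z == y0 | Im z == y1].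

Definition cca_bd f x0 x1 y0 y1 := forall z, on_bd x0 x1 y0 y1 z -> cca f z.

Lemma cca_rect_bd f x0 x1 y0 y1 : cca_rect f x0 x1 y0 y1 -> cca_bd f x0 x1 y0 y1.
Proof. by move=> H z /andP[/H]. Qed.

Lemma on_bd_h x0 x1 y0 y1 x y : y0 <= y1 -> x0 <= x <= x1 -> (y == y0) || (y == y1) ->
  on_bd x0 x1 y0 y1 (x +i* y).
Proof.
move=> yy xx /orP[]/eqP->; by rewrite /on_bd /in_rect /= xx lexx yy eqxx !orbT.
Qed.

Lemma on_bd_v x0 x1 y0 y1 x y : x0 <= x1 -> y0 <= y <= y1 -> (x == x0) || (x == x1) ->
  on_bd x0 x1 y0 y1 (x +i* y).
Proof.
move=> xx yy /orP[]/eqP->; by rewrite /on_bd /in_rect /= xx lexx yy eqxx ?orbT.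
Qed.

Lemma cca_bd_h f x0 x1 y0 y1 y : y0 <= y1 -> cca_bd f x0 x1 y0 y1 ->
  (y == y0) || (y == y1) -> ccts (fun x => f (x +i* y)) x0 x1.
Proof. by move=> h H yy; apply: ccts_h => x xx; apply: H; exact: on_bd_h. Qed.

Lemma cca_bd_v f x0 x1 y0 y1 x : x0 <= x1 -> cca_bd f x0 x1 y0 y1 ->
  (x == x0) || (x == x1) -> ccts (fun y => f (x +i* y)) y0 y1.
Proof. by move=> h H yy; apply: ccts_v => y xx; apply: H; exact: on_bd_v. Qed.

Lemma rint_splitx f x0 x x1 y0 y1 : x0 <= x -> x <= x1 -> y0 <= y1 ->
  cca_bd f x0 x1 y0 y1 ->
  rint f x0 x1 y0 y1 = rint f x0 x y0 y1 + rint f x x1 y0 y1.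
Proof.
move=> h1 h2 h3 H; rewrite /rint.
rewrite (@cint_split _ (fun x => f (x +i* y0)) x0 x x1) //; last first.
  by apply: (cca_bd_h h3 H); rewrite eqxx.
rewrite (@cint_split _ (fun x => f (x +i* y1)) x0 x x1) //; last first.
  by apply: (cca_bd_h h3 H); rewrite eqxx orbT.
ring.
Qed.

Lemma rint_splity f x0 x1 y0 y y1 : x0 <= x1 -> y0 <= y -> y <= y1 ->
  cca_bd f x0 x1 y0 y1 ->
  rint f x0 x1 y0 y1 = rint f x0 x1 y0 y + rint f x0 x1 y y1.
Proof.
move=> h1 h2 h3 H; rewrite /rint.
rewrite (@cint_split _ (fun y => f (x0 +i* y)) y0 y y1) //; last first.
  by apply: (cca_bd_v h1 H); rewrite eqxx.
rewrite (@cint_split _ (fun y => f (x1 +i* y)) y0 y y1) //; last first.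
  by apply: (cca_bd_v h1 H); rewrite eqxx orbT.
ring.
Qed.

Lemma in_rect_sub x0 x1 y0 y1 a0 a1 b0 b1 z :
  x0 <= a0 -> a1 <= x1 -> y0 <= b0 -> b1 <= y1 ->
  in_rect a0 a1 b0 b1 z -> in_rect x0 x1 y0 y1 z.
Proof.
move=> h1 h2 h3 h4 /andP[/andP[k1 k2] /andP[k3 k4]].
by rewrite /in_rect (le_trans h1 k1) (le_trans k2 h2) (le_trans h3 k3) (le_trans k4 h4).
Qed.

Lemma rintB f g x0 x1 y0 y1 : x0 <= x1 -> y0 <= y1 ->
  cca_bd f x0 x1 y0 y1 -> cca_bd g x0 x1 y0 y1 ->
  rint (fun z => f z - g z) x0 x1 y0 y1 = rint f x0 x1 y0 y1 - rint g x0 x1 y0 y1.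
Proof.
move=> h1 h2 Hf Hg; rewrite /rint.
have X0 : (x0 == x0) || (x0 == x1) by rewrite eqxx.
have X1 : (x1 == x0) || (x1 == x1) by rewrite eqxx orbT.
have Y0 : (y0 == y0) || (y0 == y1) by rewrite eqxx.
have Y1 : (y1 == y0) || (y1 == y1) by rewrite eqxx orbT.
rewrite (cintB (cca_bd_h h2 Hf Y0) (cca_bd_h h2 Hg Y0)).
rewrite (cintB (cca_bd_h h2 Hf Y1) (cca_bd_h h2 Hg Y1)).
rewrite (cintB (cca_bd_v h1 Hf X0) (cca_bd_v h1 Hg X0)).
rewrite (cintB (cca_bd_v h1 Hf X1) (cca_bd_v h1 Hg X1)).
ring.
Qed.

Lemma rintZ (c : R[i]) f x0 x1 y0 y1 : x0 <= x1 -> y0 <= y1 -> cca_bd f x0 x1 y0 y1 ->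
  rint (fun z => c * f z) x0 x1 y0 y1 = c * rint f x0 x1 y0 y1.
Proof.
move=> h1 h2 Hf; rewrite /rint.
have X0 : (x0 == x0) || (x0 == x1) by rewrite eqxx.
have X1 : (x1 == x0) || (x1 == x1) by rewrite eqxx orbT.
have Y0 : (y0 == y0) || (y0 == y1) by rewrite eqxx.
have Y1 : (y1 == y0) || (y1 == y1) by rewrite eqxx orbT.
rewrite (cintZ _ (cca_bd_h h2 Hf Y0)) (cintZ _ (cca_bd_h h2 Hf Y1)).
rewrite (cintZ _ (cca_bd_v h1 Hf X0)) (cintZ _ (cca_bd_v h1 Hf X1)).
ring.
Qed.

Lemma normc_i (w : R[i]) : normc ('i * w) = normc w.
Proof. by rewrite normcM /= expr0n /= add0r expr1n sqrtr1 mul1r. Qed.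

#[local] Arguments normc : simpl never.

Lemma rint_sides f x0 x1 y0 y1 : normc (rint f x0 x1 y0 y1) <=
  normc (cint (fun x => f (x +i* y0)) x0 x1) + normc (cint (fun y => f (x1 +i* y)) y0 y1)
  + normc (cint (fun x => f (x +i* y1)) x0 x1) + normc (cint (fun y => f (x0 +i* y)) y0 y1).
Proof.
rewrite /rint; do 3 (apply: le_trans (le_normcD _ _) _; rewrite ?normcN ?normc_i lerD2r).
by rewrite lexx.
Qed.

Lemma rint_le f x0 x1 y0 y1 M : x0 <= x1 -> y0 <= y1 ->
  cca_bd f x0 x1 y0 y1 ->
  (forall z, on_bd x0 x1 y0 y1 z -> normc (f z) <= M) ->
  normc (rint f x0 x1 y0 y1) <= 4 * M * ((x1 - x0) + (y1 - y0)).
Proof.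
move=> h1 h2 H fM; apply: le_trans (rint_sides _ _ _ _ _) _.
have X0 : (x0 == x0) || (x0 == x1) by rewrite eqxx.
have X1 : (x1 == x0) || (x1 == x1) by rewrite eqxx orbT.
have Y0 : (y0 == y0) || (y0 == y1) by rewrite eqxx.
have Y1 : (y1 == y0) || (y1 == y1) by rewrite eqxx orbT.
have := @cint_le _ _ _ _ M h1 (cca_bd_h h2 H Y0) (fun x xx => fM _ (on_bd_h h2 xx Y0)).
have := @cint_le _ _ _ _ M h1 (cca_bd_h h2 H Y1) (fun x xx => fM _ (on_bd_h h2 xx Y1)).
have := @cint_le _ _ _ _ M h2 (cca_bd_v h1 H X0) (fun x xx => fM _ (on_bd_v h1 xx X0)).
have := @cint_le _ _ _ _ M h2 (cca_bd_v h1 H X1) (fun x xx => fM _ (on_bd_v h1 xx X1)).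
lra.
Qed.

Lemma cint_eq (g h : R -> R[i]) a b : (forall x, g x = h x) -> cint g a b = cint h a b.
Proof. by move=> E; congr cint; apply/funext. Qed.

Lemma hpt (x y : R) : (0 +i* y) + x%:C * 1 = x +i* y.
Proof. by rewrite mulr1; apply/eqP; rewrite eq_complex /= add0r addr0 !eqxx. Qed.

Lemma vpt (x y : R) : x%:C + y%:C * 'i = x +i* y.
Proof.
by apply/eqP; rewrite eq_complex /= !mulr0 !mul0r mulr1 subr0 addr0 !add0r addr0 !eqxx.
Qed.

(** Each side contributes the difference of [F] between its endpoints, and the corner values cancel.
    Asking for the primitive on the boundary only lets the rectangle enclose a pole, as happens in
    [deriv_pole]. *)
Lemma rint_prim F f x0 x1 y0 y1 : x0 <= x1 -> y0 <= y1 ->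
  (forall z, on_bd x0 x1 y0 y1 z -> is_cd F z (f z)) ->
  cca_bd f x0 x1 y0 y1 -> rint f x0 x1 y0 y1 = 0.
Proof.
move=> h1 h2 HF Hf.
have HH y : (y == y0) || (y == y1) ->
    cint (fun x => f (x +i* y)) x0 x1 = F (x1 +i* y) - F (x0 +i* y).
  move=> yy; rewrite -(hpt x1 y) -(hpt x0 y) -(@cint_FTC _ F f) //.
  - by apply: cint_eq => x; rewrite hpt mul1r.
  - by move=> x xx; apply: HF; rewrite hpt; exact: on_bd_h.
  - rewrite (_ : (fun x => _) = (fun x => f (x +i* y))); first exact: (cca_bd_h h2 Hf).
    by apply/funext => x; rewrite hpt.
have VV x : (x == x0) || (x == x1) ->
    'i * cint (fun y => f (x +i* y)) y0 y1 = F (x +i* y1) - F (x +i* y0).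
  move=> xx; rewrite -cintZ; last exact: (cca_bd_v h1 Hf).
  rewrite -(vpt x y1) -(vpt x y0) -(@cint_FTC _ F f) //.
  - by apply: cint_eq => y; rewrite vpt.
  - by move=> y yy; apply: HF; rewrite vpt; exact: on_bd_v.
  - rewrite (_ : (fun y => _) = (fun y => f (x +i* y))); first exact: (cca_bd_v h1 Hf).
    by apply/funext => y; rewrite vpt.
rewrite /rint !HH ?VV ?eqxx ?orbT //; ring.
Qed.

Lemma rint_affine (a b : R[i]) x0 x1 y0 y1 : x0 <= x1 -> y0 <= y1 ->
  rint (fun z => a + b * z) x0 x1 y0 y1 = 0.
Proof.
move=> h1 h2; apply: (@rint_prim (fun z => a * z + b / 2 * (z * z))) => //.
  move=> z _; apply: is_cd_eq.
    apply: is_cdD; first exact: (is_cdM (is_cd_cst _ _) (is_cd_id _)).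
    apply: (is_cdM (is_cd_cst _ _)); exact: (is_cdM (is_cd_id _) (is_cd_id _)).
  by rewrite /=; field.
move=> z _; exact: (is_cd_cca (is_cd_affine a b z)).
Qed.

Lemma cca_affine (a b z : R[i]) : cca (fun z => a + b * z) z.
Proof. exact: (is_cd_cca (is_cd_affine a b z)). Qed.

Lemma ccaB f g z : cca f z -> cca g z -> cca (fun z => f z - g z) z.
Proof.
move=> Hf Hg e e0.
have [|d d0 Hd] := Hf (e / 2); first by rewrite divr_gt0.
have [|d' d'0 Hd'] := Hg (e / 2); first by rewrite divr_gt0.
exists (Num.min d d'); first by rewrite lt_min d0.
move=> h; rewrite lt_min => /andP[/Hd h1 /Hd' h2].
have -> : f (z + h) - g (z + h) - (f z - g z) = (f (z + h) - f z) - (g (z + h) - g z) by ring.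
apply: le_trans (le_normcD _ _) _; rewrite normcN; lra.
Qed.

(** The contour integral is the sum of those over the four quarters, since inner sides cancel; by
    the triangle inequality one quarter carries more than a fourth of the bound. *)
Lemma rint_quarter f (x y w h E : R) : 0 <= w -> 0 <= h ->
  cca_rect f x (x + w) y (y + h) ->
  E < normc (rint f x (x + w) y (y + h)) ->
  exists q : R * R, [/\ x <= q.1, q.1 + w / 2 <= x + w, y <= q.2, q.2 + h / 2 <= y + h
   & E / 4 < normc (rint f q.1 (q.1 + w / 2) q.2 (q.2 + h / 2))].
Proof.
move=> w0 h0 H.
have e1 : x + w / 2 + w / 2 = x + w by field.
have e2 : y + h / 2 + h / 2 = y + h by field.
rewrite (@rint_splitx _ _ (x + w / 2)) //; [|lra|lra|lra|exact: cca_rect_bd].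
rewrite (@rint_splity _ x _ _ (y + h / 2)) //; [|lra|lra|lra|].
2: by move=> z /andP[/in_rect_sub hz _]; apply: H; apply: hz; lra.
rewrite (@rint_splity _ (x + w / 2) _ _ (y + h / 2)) //; [|lra|lra|lra|].
2: by move=> z /andP[/in_rect_sub hz _]; apply: H; apply: hz; lra.
move=> HE; apply: contrapT => /forallNP N.
have K p q : x <= p -> p + w / 2 <= x + w -> y <= q -> q + h / 2 <= y + h ->
    normc (rint f p (p + w / 2) q (q + h / 2)) <= E / 4.
  move=> k1 k2 k3 k4; rewrite leNgt; apply/negP => k5; exact: (N (p, q)).
have K1 := K x y ltac:(lra) ltac:(lra) ltac:(lra) ltac:(lra).
have K2 := K (x + w / 2) y ltac:(lra) ltac:(lra) ltac:(lra) ltac:(lra).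
have K3 := K x (y + h / 2) ltac:(lra) ltac:(lra) ltac:(lra) ltac:(lra).
have K4 := K (x + w / 2) (y + h / 2) ltac:(lra) ltac:(lra) ltac:(lra) ltac:(lra).
rewrite ?e1 ?e2 in K1 K2 K3 K4.
have := le_normcD (rint f x (x + w / 2) y (y + h / 2) + rint f x (x + w / 2) (y + h / 2) (y + h))
  (rint f (x + w / 2) (x + w) y (y + h / 2) + rint f (x + w / 2) (x + w) (y + h / 2) (y + h)).
have := le_normcD (rint f x (x + w / 2) y (y + h / 2)) (rint f x (x + w / 2) (y + h / 2) (y + h)).
have := le_normcD (rint f (x + w / 2) (x + w) y (y + h / 2)) (rint f (x + w / 2) (x + w) (y + h / 2) (y + h)).
lra.
Qed.


End rint.

#[local] Arguments normc : simpl never.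

(** * Goursat's theorem *)

Section goursat.
Context (R : realType).
Implicit Types (f g : R[i] -> R[i]) (x y : R).

(* Bisection: rectangles shrinking to a point at which [f] is approximated by an
   affine function, whose own contour integral vanishes. *)
Lemma goursat f x0 x1 y0 y1 : x0 <= x1 -> y0 <= y1 ->
  (forall z, in_rect x0 x1 y0 y1 z -> exists L, is_cd f z L) ->
  rint f x0 x1 y0 y1 = 0.
Proof.
move=> h1 h2 Hf; apply/eqP; rewrite -normc_eq0; apply/negPn/negP => N0.
have {N0} N0 : 0 < normc (rint f x0 x1 y0 y1) by rewrite lt_def N0 normc_ge0.
set N := normc _ in N0.
have cf : cca_rect f x0 x1 y0 y1 by move=> z /Hf[L]; exact: is_cd_cca.
pose w n := (x1 - x0) / 2 ^+ n; pose h n := (y1 - y0) / 2 ^+ n.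
have w0 n : 0 <= w n by rewrite divr_ge0 ?subr_ge0.
have h0 n : 0 <= h n by rewrite divr_ge0 ?subr_ge0.
have wS n : w n.+1 = w n / 2 by rewrite /w exprSr invfM mulrA.
have hS n : h n.+1 = h n / 2 by rewrite /h exprSr invfM mulrA.
pose ins n (p : R * R) := [&& x0 <= p.1, p.1 + w n <= x1, y0 <= p.2 & p.2 + h n <= y1].
(* The factor 1/2 in [N / 2] makes the inequality strict at stage 0, as [rint_quarter] demands. *)
pose bad n (p : R * R) := ins n p /\ N / 2 / 4 ^+ n < normc (rint f p.1 (p.1 + w n) p.2 (p.2 + h n)).
pose next n (p q : R * R) := [/\ p.1 <= q.1, q.1 + w n.+1 <= p.1 + w n, p.2 <= q.2, q.2 + h n.+1 <= p.2 + h n & bad n.+1 q].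
have /choice[s Hs] (np : nat * (R * R)) : exists q, bad np.1 np.2 -> next np.1 np.2 q.
  case: np => n p /=.
  have [B|] := pselect (bad n p); last by exists p.
  have [/and4P[i1 i2 i3 i4] Hb] := B.
  have cp : cca_rect f p.1 (p.1 + w n) p.2 (p.2 + h n).
    by move=> z hz; apply: cf; exact: in_rect_sub hz.
  have [q [q1 q2 q3 q4 q5]] := rint_quarter (w0 n) (h0 n) cp Hb.
  exists q => _; rewrite /next /bad /ins wS hS exprSr invfM mulrA; split => //; split => //.
  by rewrite (le_trans i1 q1) (le_trans q2 i2) (le_trans i3 q3) (le_trans q4 i4).
pose u := fix u n := if n is m.+1 then s (m, u m) else (x0, y0).
have uB n : bad n (u n).
  elim: n => [|n IH]; last by have [] := Hs (n, u n) IH.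
  have wE : x0 + w 0 = x1 by rewrite /w expr0 divr1 addrC subrK.
  have hE : y0 + h 0 = y1 by rewrite /h expr0 divr1 addrC subrK.
  split; first by rewrite /ins /= wE hE !lexx.
  by rewrite /= wE hE expr0 divr1 -/N ltr_pdivrMr // ltr_pMr // ltr1n.
have uS n : next n (u n) (u n.+1) by exact: (Hs (n, u n) (uB n)).
have mono n k : (u n).1 <= (u (n + k)%N).1 /\ (u (n + k)%N).1 + w (n + k)%N <= (u n).1 + w n
   /\ (u n).2 <= (u (n + k)%N).2 /\ (u (n + k)%N).2 + h (n + k)%N <= (u n).2 + h n.
  elim: k => [|k [i1 [i2 [i3 i4]]]]; first by rewrite addn0 !lexx.
  rewrite addnS; have [j1 j2 j3 j4 _] := uS (n + k)%N.
  by rewrite (le_trans i1 j1) (le_trans j2 i2) (le_trans i3 j3) (le_trans j4 i4).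
(* Every left or lower end lies below every right or upper end, so the suprema of the lower left
   coordinates give a point common to all the rectangles. *)
have cross n m : (u m).1 <= (u n).1 + w n /\ (u m).2 <= (u n).2 + h n.
  have [nm|/ltnW mn] := leqP n m.
    have [_ [i2 [_ i4]]] := mono n (m - n)%N; rewrite subnKC // in i2 i4.
    by have := w0 m; have := h0 m; split; lra.
  have [i1 [_ [i3 _]]] := mono m (n - m)%N; rewrite subnKC // in i1 i3.
  by have := w0 n; have := h0 n; split; lra.
pose A := [set (u n).1 | n in [set: nat]]; pose B := [set (u n).2 | n in [set: nat]].
have hA n : (u n).1 <= sup A <= (u n).1 + w n.
  apply/andP; split.
    apply: ub_le_sup; last by exists n.
    by exists ((u 0).1 + w 0) => _ [m _ <-]; have [] := cross 0%N m.
  by apply: ge_sup; [exists (u 0).1; exists 0%N|move=> _ [m _ <-]; have [] := cross n m].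
have hB n : (u n).2 <= sup B <= (u n).2 + h n.
  apply/andP; split.
    apply: ub_le_sup; last by exists n.
    by exists ((u 0).2 + h 0) => _ [m _ <-]; have [] := cross 0%N m.
  by apply: ge_sup; [exists (u 0).2; exists 0%N|move=> _ [m _ <-]; have [] := cross n m].
pose c := sup A +i* sup B.
have cin n : in_rect (u n).1 ((u n).1 + w n) (u n).2 ((u n).2 + h n) c by rewrite /in_rect /= hA hB.
have insub n z : in_rect (u n).1 ((u n).1 + w n) (u n).2 ((u n).2 + h n) z -> in_rect x0 x1 y0 y1 z.
  by have [/and4P[? ? ? ?] _] := uB n; apply: in_rect_sub.
have [L HL] := Hf c (insub 0%N c (cin 0%N)).
pose S := (x1 - x0) + (y1 - y0).
have S0 : 0 <= S by rewrite addr_ge0 ?subr_ge0.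
have whS n : w n + h n = S / 2 ^+ n by rewrite /w /h /S -mulrDl.
(* The final comparison is N/2 < 4 e S^2, up to the common factor 4^-n; this [e] refutes it. [S + 1]
   instead of [S] keeps the denominator positive for a degenerate rectangle. *)
pose e := N / (8 * (S + 1) ^+ 2).
have e0 : 0 < e by rewrite divr_gt0 // mulr_gt0 // exprn_gt0 // ltr_wpDl.
have [d d0 Hd] := HL e e0.
have [n Hn] : exists n, S / 2 ^+ n < d.
  have [n _ Hn] := near_infty_natSinv_expn_lt (PosNum (divr_gt0 d0 (ltr_wpDl S0 ltr01))).
  exists n; move: (Hn n (leqnn n)); rewrite /= div1r ltr_pdivlMr ?ltr_wpDl // mulrC.
  by apply: le_lt_trans; rewrite ler_wpM2r // ?invr_ge0 // lerDl.
have [_ B1] := uB n.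
pose g z := (f c - L * c) + L * z.
have dist z : in_rect (u n).1 ((u n).1 + w n) (u n).2 ((u n).2 + h n) z -> normc (z - c) <= S / 2 ^+ n.
  move=> /andP[/andP[k1 k2] /andP[k3 k4]].
  have /andP[l1 l2] := hA n; have /andP[l3 l4] := hB n.
  apply: le_trans (normc_le_ReIm _) _; rewrite -whS !raddfB /=.
  by apply: lerD; rewrite ler_norml; apply/andP; split; lra.
have approx z : on_bd (u n).1 ((u n).1 + w n) (u n).2 ((u n).2 + h n) z ->
    normc (f z - g z) <= e * (S / 2 ^+ n).
  move=> /andP[hz _]; have hd := dist _ hz.
  have := Hd (z - c) (le_lt_trans hd Hn); rewrite [c + _]addrC subrK.
  have -> : f z - f c - L * (z - c) = f z - g z by rewrite /g; ring.
  by move=> /le_trans; apply; rewrite ler_pM2l.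
have wl : (u n).1 <= (u n).1 + w n by rewrite lerDl.
have hl : (u n).2 <= (u n).2 + h n by rewrite lerDl.
have cfn : cca_bd f (u n).1 ((u n).1 + w n) (u n).2 ((u n).2 + h n) by move=> z /andP[/insub /cf].
have cgn : cca_bd g (u n).1 ((u n).1 + w n) (u n).2 ((u n).2 + h n) by move=> z _; exact: cca_affine.
have cfg : cca_bd (fun z => f z - g z) (u n).1 ((u n).1 + w n) (u n).2 ((u n).2 + h n).
  by move=> z hz; apply: ccaB; [exact: cfn|exact: cgn].
have := rint_le wl hl cfg approx.
rewrite (rintB wl hl cfn cgn) rint_affine // subr0.
have -> : (u n).1 + w n - (u n).1 + ((u n).2 + h n - (u n).2) = S / 2 ^+ n by rewrite -whS; ring.
move=> B2; have := lt_le_trans B1 B2.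
have p2 : (0 : R) < 2 ^+ n by exact: exprn_gt0.
have -> : (4 : R) ^+ n = 2 ^+ n * 2 ^+ n by rewrite -exprMn; congr (_ ^+ _); lra.
have -> : N / 2 / (2 ^+ n * 2 ^+ n) = N / 2 * ((2 ^+ n)^-1) ^+ 2.
  by field; exact: lt0r_neq0.
have -> : 4 * (e * (S / 2 ^+ n)) * (S / 2 ^+ n) = 4 * e * S ^+ 2 * ((2 ^+ n)^-1) ^+ 2.
  by field; exact: lt0r_neq0.
rewrite ltr_pM2r ?exprn_gt0 ?invr_gt0 //.
rewrite ltNge => /negP; apply; rewrite /e.
have S1 : 0 < (S + 1) ^+ 2 by rewrite exprn_gt0 // ltr_wpDl.
have -> : 4 * (N / (8 * (S + 1) ^+ 2)) * S ^+ 2 = N / 2 * (S ^+ 2 / (S + 1) ^+ 2).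
  by field; apply: lt0r_neq0; rewrite ltr_wpDl.
rewrite -[leRHS]mulr1 ler_wpM2l //; first by rewrite divr_ge0 // ltW.
by rewrite ler_pdivrMr // mul1r; nra.
Qed.

End goursat.


(** * Cauchy's formula for a rectangle around a simple pole *)

Section pole.
Context (R : realType).
Implicit Types (f g : R[i] -> R[i]) (x y : R).

Definition holo_rect f x0 x1 y0 y1 := forall z, in_rect x0 x1 y0 y1 z -> exists L, is_cd f z L.

Lemma subc_neq0 (w a : R[i]) : w != a -> w - a != 0.
Proof. by rewrite subr_eq0. Qed.

Lemma is_cd_div_sub f (a w L : R[i]) : w != a -> is_cd f w L ->
  is_cd (fun z => f z / (z - a)) w (L / (w - a) - f w / (w - a) ^+ 2).
Proof.
move=> wa Hf; have wa0 := subc_neq0 wa.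
apply: is_cd_eq.
  apply: is_cdM; first exact: Hf.
  apply: is_cdV; first exact: wa0.
  by apply: is_cdB; [exact: is_cd_id|exact: is_cd_cst].
by rewrite /=; field.
Qed.

(** The frame between the two rectangles is cut into a left strip, a right strip, and the pieces of
    the middle strip below and above the hole. None of them meets the open hole, so Goursat's
    theorem annihilates all four contours. *)
Lemma goursat_frame f x0 x1 y0 y1 p q r s :
  x0 <= p -> p <= q -> q <= x1 -> y0 <= r -> r <= s -> s <= y1 ->
  (forall z, in_rect x0 x1 y0 y1 z -> ~~ ((p < Re z < q) && (r < Im z < s)) ->
     exists L, is_cd f z L) ->
  rint f x0 x1 y0 y1 = rint f p q r s.
Proof.
move=> h1 h2 h3 h4 h5 h6 H.
have sub a0 a1 b0 b1 : x0 <= a0 -> a1 <= x1 -> y0 <= b0 -> b1 <= y1 ->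
  (forall z, in_rect a0 a1 b0 b1 z -> ~~ ((p < Re z < q) && (r < Im z < s))) ->
  holo_rect f a0 a1 b0 b1.
  by move=> k1 k2 k3 k4 N z hz; apply: H; [exact: in_rect_sub hz|exact: N].
have cbd a0 a1 b0 b1 : x0 <= a0 -> a1 <= x1 -> y0 <= b0 -> b1 <= y1 ->
  (forall z, on_bd a0 a1 b0 b1 z -> ~~ ((p < Re z < q) && (r < Im z < s))) ->
  cca_bd f a0 a1 b0 b1.
  move=> k1 k2 k3 k4 N z hz; have /andP[hz' _] := hz.
  have [L HL] := H _ (in_rect_sub k1 k2 k3 k4 hz') (N _ hz); exact: is_cd_cca HL.
rewrite (@rint_splitx _ _ x0 p) //; [|lra|lra|].
  rewrite (@rint_splitx _ _ p q) //; [|lra|].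
    rewrite (@goursat _ _ x0 p) //; [|lra|].
      rewrite (@goursat _ _ q x1) //; [|lra|].
        rewrite (@rint_splity _ _ p q y0 r) //; [|lra|].
          rewrite (@rint_splity _ _ p q r s) //; [|].
            rewrite (@goursat _ _ p q y0 r) //; [|].
              rewrite (@goursat _ _ p q s y1) //; [by rewrite add0r !addr0 add0r|].
              by apply: sub; [lra..|move=> z /andP[_ /andP[? ?]]; apply/negP => /andP[_ /andP[? ?]]; lra].
            by apply: sub; [lra..|move=> z /andP[_ /andP[? ?]]; apply/negP => /andP[_ /andP[? ?]]; lra].
          apply: cbd; [lra..|move=> z /andP[/andP[/andP[? ?] /andP[? ?]]]].
          by move=> /or4P[]/eqP?; apply/negP => /andP[/andP[? ?] /andP[? ?]]; lra.
        apply: cbd; [lra..|move=> z /andP[/andP[/andP[? ?] /andP[? ?]]]].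
        by move=> /or4P[]/eqP?; apply/negP => /andP[/andP[? ?] /andP[? ?]]; lra.
      by apply: sub; [lra..|move=> z /andP[/andP[? ?] _]; apply/negP => /andP[/andP[? ?] _]; lra].
    by apply: sub; [lra..|move=> z /andP[/andP[? ?] _]; apply/negP => /andP[/andP[? ?] _]; lra].
  apply: cbd; [lra..|move=> z /andP[/andP[/andP[? ?] /andP[? ?]]]].
  by move=> /or4P[]/eqP?; apply/negP => /andP[/andP[? ?] /andP[? ?]]; lra.
apply: cbd; [lra..|move=> z /andP[/andP[/andP[? ?] /andP[? ?]]]].
by move=> /or4P[]/eqP?; apply/negP => /andP[/andP[? ?] /andP[? ?]]; lra.
Qed.

Lemma invc_sub_Re (p q r s : R) :
  Re (((p +i* q) - (r +i* s))^-1) = (p - r) / ((p - r) ^+ 2 + (q - s) ^+ 2).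
Proof. by []. Qed.

Lemma invc_sub_Im (p q r s : R) :
  Im (((p +i* q) - (r +i* s))^-1) = - ((q - s) / ((p - r) ^+ 2 + (q - s) ^+ 2)).
Proof. by []. Qed.

Lemma cca_inv_sub (a z : R[i]) : z != a -> cca (fun w => (w - a)^-1) z.
Proof.
move=> za; apply: (@is_cd_cca _ _ _ (- (z - a) ^- 2 * (1 - 0))).
apply: is_cdV; first exact: subc_neq0.
by apply: is_cdB; [exact: is_cd_id|exact: is_cd_cst].
Qed.

(** The exact value is 2 pi i, but a lower bound for the imaginary part is enough. On each side the
    relevant part of the integrand is e / (u^2 + e^2) with |u| <= e, hence at least 1 / (2 e) over a
    length 2 e: every side contributes at least 1. *)
Lemma kernel_square (a1 a2 e : R) : 0 < e ->
  4 <= normc (rint (fun w => (w - (a1 +i* a2))^-1) (a1 - e) (a1 + e) (a2 - e) (a2 + e)).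
Proof.
move=> e0; apply: le_trans (normc_Im _); apply: le_trans (ler_norm _).
set a := a1 +i* a2; pose f (w : R[i]) := (w - a)^-1.
have hx : a1 - e <= a1 + e by lra.
have hy : a2 - e <= a2 + e by lra.
have cf : cca_bd f (a1 - e) (a1 + e) (a2 - e) (a2 + e).
  move=> z /andP[_ hz]; apply: cca_inv_sub; apply/eqP => za; move: hz; rewrite za /=.
  by move=> /or4P[]/eqP; lra.
have key (u : R) : - e <= u <= e -> (2 * e)^-1 <= e / (u ^+ 2 + e ^+ 2).
  move=> /andP[u1 u2]; rewrite ler_pdivlMr; last by rewrite ltr_wpDl ?sqr_ge0 ?exprn_gt0.
  rewrite mulrC ler_pdivrMr ?mulr_gt0 //; nra.
have L2 : (2 * e)^-1 * (e + e) = 1 by field; exact: lt0r_neq0.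
have X0 x y : (x == x) || (x == y) by rewrite eqxx.
have X1 x y : (y == x) || (y == y) by rewrite eqxx orbT.
have B1 := @ge_Rintegral_cst _ _ _ _ (2 * e)^-1 hx (ccts_Im (cca_bd_h hy cf (X0 _ _))).
have B2 := @ge_Rintegral_cst _ _ _ _ (2 * e)^-1 hy (ccts_Re (cca_bd_v hx cf (X1 _ _))).
have B3 := @le_Rintegral_cst _ _ _ _ (- (2 * e)^-1) hx (ccts_Im (cca_bd_h hy cf (X1 _ _))).
have B4 := @le_Rintegral_cst _ _ _ _ (- (2 * e)^-1) hy (ccts_Re (cca_bd_v hx cf (X0 _ _))).
have {}B1 := B1 _; have {}B2 := B2 _; have {}B3 := B3 _; have {}B4 := B4 _.
have E1 : a1 + e - (a1 - e) = e + e by ring.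
have E2 : a2 + e - (a2 - e) = e + e by ring.
rewrite E1 in B1 B3; rewrite E2 in B2 B4; rewrite ?mulNr ?L2 in B1 B2 B3 B4.
have {}B1 : 1 <= \int[lebesgue_measure]_(x in `[a1 - e, a1 + e]) Im (f (x +i* (a2 - e))).
  apply: B1 => x xx; rewrite /f invc_sub_Im.
  have -> : a2 - e - a2 = - e by ring.
  by rewrite mulNr opprK sqrrN; apply: key; lra.
have {}B2 : 1 <= \int[lebesgue_measure]_(y in `[a2 - e, a2 + e]) Re (f ((a1 + e) +i* y)).
  apply: B2 => y yy; rewrite /f invc_sub_Re.
  have -> : a1 + e - a1 = e by ring.
  by rewrite addrC; apply: key; lra.
have {}B3 : \int[lebesgue_measure]_(x in `[a1 - e, a1 + e]) Im (f (x +i* (a2 + e))) <= -1.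
  apply: B3 => x xx; rewrite /f invc_sub_Im.
  have -> : a2 + e - a2 = e by ring.
  by rewrite lerN2; apply: key; lra.
have {}B4 : \int[lebesgue_measure]_(y in `[a2 - e, a2 + e]) Re (f ((a1 - e) +i* y)) <= -1.
  apply: B4 => y yy; rewrite /f invc_sub_Re.
  have -> : a1 - e - a1 = - e by ring.
  by rewrite mulNr lerN2 sqrrN addrC; apply: key; lra.
move: B1 B2 B3 B4; rewrite /rint /cint /=.
set I1 := Rintegral _ _ _; set I2 := Rintegral _ _ _; set I3 := Rintegral _ _ _; set I4 := Rintegral _ _ _.
rewrite -/f -/I1 -/I2 -/I3 -/I4 !mul0r !mul1r !add0r; lra.
Qed.

(* Cauchy's integral formula, as a lower bound for the contour integral; [g] need only have
   a limit at [a], which covers difference quotients. *)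
Lemma pole_lower (g : R[i] -> R[i]) (G : R[i]) x0 x1 y0 y1 (a1 a2 : R) :
  x0 < a1 < x1 -> y0 < a2 < y1 ->
  (forall z, in_rect x0 x1 y0 y1 z -> z != a1 +i* a2 -> exists L, is_cd g z L) ->
  (forall e : R, 0 < e -> exists2 d : R, 0 < d &
     forall h, h != 0 -> normc h < d -> normc (g ((a1 +i* a2) + h) - G) <= e) ->
  4 * normc G <= normc (rint (fun w => g w / (w - (a1 +i* a2))) x0 x1 y0 y1).
Proof.
move=> /andP[hx0 hx1] /andP[hy0 hy1]; set a := a1 +i* a2 => Hg HG.
apply/ler_addgt0Pr => e e0.
(* On the square of half-side [r] the error is at most (e/16)/r, and [rint_le] multiplies it by 4
   times 4 r, which gives exactly [e]. *)
have [|d d0 Hd] := HG (e / 16); first by rewrite divr_gt0.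
pose m := Num.min (Num.min (a1 - x0) (x1 - a1)) (Num.min (a2 - y0) (y1 - a2)).
have m0 : 0 < m by rewrite !lt_min !subr_gt0 hx0 hx1 hy0.
pose r := Num.min m (d / 3).
have r0 : 0 < r by rewrite lt_min m0 divr_gt0.
have rd : r <= d / 3 by rewrite ge_min lexx orbT.
have : r <= m by rewrite ge_min lexx.
rewrite !le_min => /andP[/andP[r1 r2] /andP[r3 r4]].
pose k w := g w / (w - a).
have holk z : in_rect x0 x1 y0 y1 z -> z != a -> exists L, is_cd k z L.
  by move=> hz za; have [L HL] := Hg _ hz za; eexists; exact: is_cd_div_sub HL.
have aE z : ~~ ((a1 - r < Re z < a1 + r) && (a2 - r < Im z < a2 + r)) -> z != a.
  by apply: contraNneq => -> /=; lra.
rewrite (@goursat_frame k _ _ _ _ (a1 - r) (a1 + r) (a2 - r) (a2 + r)); [|lra..|].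
  2: by move=> z hz /aE; exact: holk.
have bdE z : on_bd (a1 - r) (a1 + r) (a2 - r) (a2 + r) z -> z != a.
  by move=> /andP[_ hz]; apply: contraTneq hz => -> /=; lra.
have hx : a1 - r <= a1 + r by lra.
have hy : a2 - r <= a2 + r by lra.
have bdin z : on_bd (a1 - r) (a1 + r) (a2 - r) (a2 + r) z -> in_rect x0 x1 y0 y1 z.
  by move=> /andP[hz _]; apply: in_rect_sub hz; lra.
have ck : cca_bd k (a1 - r) (a1 + r) (a2 - r) (a2 + r).
  by move=> z hz; have [L] := holk _ (bdin _ hz) (bdE _ hz); exact: is_cd_cca.
have ci : cca_bd (fun w => (w - a)^-1) (a1 - r) (a1 + r) (a2 - r) (a2 + r).
  by move=> z /bdE; exact: cca_inv_sub.
have cGi : cca_bd (fun w => G * (w - a)^-1) (a1 - r) (a1 + r) (a2 - r) (a2 + r).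
  move=> z /bdE za; apply: (@is_cd_cca _ _ _ (0 / (z - a) - G / (z - a) ^+ 2)).
  by apply: is_cd_div_sub => //; exact: is_cd_cst.
have A1 : 4 * normc G <= normc (rint (fun w => G * (w - a)^-1) (a1 - r) (a1 + r) (a2 - r) (a2 + r)).
  by rewrite rintZ // normcM mulrC ler_wpM2l ?normc_ge0 //; exact: kernel_square.
have A2 : normc (rint (fun w => k w - G * (w - a)^-1) (a1 - r) (a1 + r) (a2 - r) (a2 + r)) <= e.
  apply: (@le_trans _ _ (4 * (e / 16 / r) * ((a1 + r - (a1 - r)) + (a2 + r - (a2 - r))))); last first.
    rewrite le_eqVlt; apply/orP; left; apply/eqP; field; exact: lt0r_neq0.
  apply: rint_le => //.
    by move=> z hz; apply: ccaB; [exact: ck|exact: cGi].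
  move=> z hz; have za := bdE _ hz; have za0 := subc_neq0 za.
  rewrite /k -mulrBl normcM normcV.
  have /andP[/andP[/andP[z1 z2] /andP[z3 z4]] z5] := hz.
  have low : r <= normc (z - a).
    move: z5 => /or4P[]/eqP zz.
    - by apply: le_trans (normc_Re _); rewrite raddfB /= zz ler_normr; lra.
    - by apply: le_trans (normc_Re _); rewrite raddfB /= zz ler_normr; lra.
    - by apply: le_trans (normc_Im _); rewrite raddfB /= zz ler_normr; lra.
    - by apply: le_trans (normc_Im _); rewrite raddfB /= zz ler_normr; lra.
  have up : normc (z - a) < d.
    apply: le_lt_trans (normc_le_ReIm _) _; rewrite !raddfB /=.
    apply: (@le_lt_trans _ _ (r + r)); last by lra.
    by apply: lerD; rewrite ler_norml; lra.
  have := Hd _ za0 up; rewrite [a + _]addrC subrK => U.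
  apply: ler_pM => //; rewrite ?normc_ge0 ?invr_ge0 ?normc_ge0 //.
  by rewrite lef_pV2 // posrE // (lt_le_trans r0).
move: A2; rewrite rintB // => A2.
have := le_normcD (rint k (a1 - r) (a1 + r) (a2 - r) (a2 + r)) (- (rint k (a1 - r) (a1 + r) (a2 - r) (a2 + r) -
  rint (fun w : R[i] => G * (w - a)^-1) (a1 - r) (a1 + r) (a2 - r) (a2 + r))).
rewrite normcN opprB addrC subrK => A3.
by apply: le_trans A1 _; apply: le_trans A3 _; rewrite lerD2l.
Qed.

End pole.


(** * Measurability of continuous functions on the plane *)

Section plane_measurable.
Context (R : realType).
Local Notation mR := (measurableTypeR R).

Definition box (p q r : R) : set (mR * mR) :=
  `]p - r, p + r[ `*` `]q - r, q + r[.

Lemma boxP p q r (z : mR * mR) :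
  box p q r z <-> `|z.1 - p| < r /\ `|z.2 - q| < r.
Proof.
rewrite /box /=; split=> -[].
  by rewrite !in_itv /= => h1 h2; rewrite !ltr_norml; split; lra.
by rewrite !ltr_norml !in_itv /= => h1 h2; split; lra.
Qed.

Lemma measurable_box p q n : measurable (box p q n).
Proof. by apply: measurableX; exact: measurable_itv. Qed.

Definition plane_cts (D : set (mR * mR)) (u : mR * mR -> R) :=
  forall z, D z -> forall e : R, 0 < e -> exists2 d : R, 0 < d &
    forall w, D w -> `|w.1 - z.1| < d -> `|w.2 - z.2| < d -> `|u w - u z| < e.

(** The set where u > c is, inside [D], the union of those boxes with rational centre and half-side
    1/(n+1) on which u > c throughout: a countable union of measurable sets. *)
Lemma plane_cts_measurable (D : set (mR * mR)) (u : mR * mR -> R) :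
  measurable D -> plane_cts D u -> measurable_fun D u.
Proof.
move=> mD cu; apply: (measurability _ (measurable_realfun.RGenOInfty.measurableE R)) => //.
move=> _ [_ [c ->] <-].
pose good p q n := forall w, D w -> box p q n w -> c < u w.
suff -> : D `&` u @^-1` `]c, +oo[ = D `&`
    \bigcup_(p in [set: rat]) \bigcup_(q in [set: rat]) \bigcup_n
      (if `[< good (ratr p) (ratr q) n.+1%:R^-1 >] then box (ratr p) (ratr q) n.+1%:R^-1 else set0).
  apply: measurableI => //; apply: bigcupT_measurable_rat => p.
  apply: bigcupT_measurable_rat => q; apply: bigcupT_measurable => n.
  by case: ifP => _; [exact: measurable_box|exact: measurable0].
apply/seteqP; split => z [Dz] /=.
  rewrite in_itv /= andbT => cz; split=> //.
  have [|d d0 Hd] := cu z Dz (u z - c); first by rewrite subr_gt0.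
  (* Half of [d], because the rational centre is within 1/(n+1) of [z] and the box extends by the
     same amount again. *)
  have [n _ Hn] := near_infty_natSinv_lt (PosNum (divr_gt0 d0 (@ltr0Sn R 1))).
  have {Hn} /= Hn := Hn n (leqnn n).
  have n0 : (0 : R) < n.+1%:R^-1 by rewrite invr_gt0.
  have [p hp] := rat_in_itvoo (ltr_pwDr n0 (lexx z.1)).
  have [q hq] := rat_in_itvoo (ltr_pwDr n0 (lexx z.2)).
  exists p => //; exists q => //; exists n => //.
  move: n0 Hn hp hq; set r : R := n.+1%:R^-1 => n0 Hn hp hq.
  rewrite ifT; last first.
    apply/asboolP => w Dw /boxP[].
    rewrite !ltr_norml => w1 w2.
    move: hp hq; rewrite !in_itv /= => hp hq.
    have : `|u w - u z| < u z - c by apply: Hd => //; rewrite ltr_norml; lra.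
    by rewrite ltr_norml; lra.
  apply/boxP; move: hp hq; rewrite !in_itv /= => hp hq.
  by rewrite !ltr_norml; lra.
move=> [p _ [q _ [n _]]]; case: ifP => // /asboolP G Bz.
by split => //; rewrite in_itv /= andbT; exact: G.
Qed.

Definition ptC (w : mR * mR) : R[i] := w.1 +i* w.2.

Lemma cca_box (g : R[i] -> R[i]) (z : mR * mR) : cca g (ptC z) ->
  forall e : R, 0 < e -> exists2 d : R, 0 < d &
    forall w : mR * mR, `|w.1 - z.1| < d -> `|w.2 - z.2| < d -> `|normc (g (ptC w)) - normc (g (ptC z))| <= e.
Proof.
move=> H e /H[d d0 Hd]; exists (d / 2) => [|w w1 w2]; first by rewrite divr_gt0.
have E : ptC w = ptC z + ((w.1 - z.1) +i* (w.2 - z.2)).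
  by apply/eqP; rewrite eq_complex /= [_ + (_ - _)]addrC subrK [_ + (_ - _)]addrC subrK !eqxx.
apply: le_trans (ler_dist_normc _ _) _; rewrite E; apply: Hd.
apply: le_lt_trans (normc_le_ReIm _) _ => /=.
by rewrite (splitr d); exact: ltrD.
Qed.

Lemma cca_plane_cts (D : set (mR * mR)) (g : R[i] -> R[i]) :
  (forall w, D w -> cca g (ptC w)) -> plane_cts D (fun w => normc (g (ptC w))).
Proof.
move=> H z Dz e e0; have [|d d0 Hd] := cca_box (H z Dz) (e := e / 2); first by rewrite divr_gt0.
exists d => // w Dw w1 w2; apply: le_lt_trans (Hd _ w1 w2) _; lra.
Qed.

Lemma cca_measurable (D : set (mR * mR)) (g : R[i] -> R[i]) : measurable D ->
  (forall w, D w -> cca g (ptC w)) -> measurable_fun D (fun w => normc (g (ptC w))).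
Proof. by move=> mD H; apply: plane_cts_measurable => //; exact: cca_plane_cts. Qed.

Lemma cca_id (z : R[i]) : cca id z.
Proof. exact: (is_cd_cca (is_cd_id z)). Qed.

Lemma measurable_normc : measurable_fun [set: mR * mR] (fun w => normc (ptC w)).
Proof. by apply: (@cca_measurable _ id) => // w _; exact: cca_id. Qed.

Lemma measurable_disk : measurable [set w : mR * mR | unit_disk (ptC w)].
Proof.
rewrite [X in measurable X](_ : _ = [set: mR * mR] `&` (fun w => normc (ptC w)) @^-1` `]-oo, 1[).
  by apply: measurable_normc => //; exact: measurable_itv.
by rewrite setTI; apply/seteqP; split=> w; rewrite /= in_itv.
Qed.

Definition sqr (a : R[i]) (r : R) : set (mR * mR) :=
  `[Re a - r, Re a + r] `*` `[Im a - r, Im a + r].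

Lemma measurable_sqr a r : measurable (sqr a r).
Proof. by apply: measurableX; exact: measurable_itv. Qed.

Lemma sqrP a r (w : mR * mR) :
  sqr a r w <-> in_rect (Re a - r) (Re a + r) (Im a - r) (Im a + r) (ptC w).
Proof. by rewrite /sqr /= !in_itv; split=> [[? ?]|/andP[? ?]//]; apply/andP. Qed.

Definition area (D : set (mR * mR)) (u : mR * mR -> \bar R) : \bar R :=
  (\int[(@lebesgue_measure R) \x (@lebesgue_measure R)]_(w in D) u w)%E.

End plane_measurable.


(** * Mean value inequality, Cauchy's estimate, continuity of the derivative *)

Section estimates.
Context (R : realType).
Implicit Types (f g : R[i] -> R[i]).

Definition csq (a : R[i]) (r : R) (z : R[i]) : bool :=
  in_rect (Re a - r) (Re a + r) (Im a - r) (Im a + r) z.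

Lemma csqP a r z : csq a r z = (`|Re (z - a)| <= r) && (`|Im (z - a)| <= r).
Proof.
rewrite /csq /in_rect !raddfB /= !ler_norml.
by congr (_ && _); apply/idP/idP => ?; lra.
Qed.

Lemma csq_center a r : 0 <= r -> csq a r a.
Proof. by move=> r0; rewrite csqP subrr /= normr0 r0. Qed.

Lemma csq_trans a r b s z : csq a r b -> csq b s z -> csq a (r + s) z.
Proof.
rewrite !csqP => /andP[h1 h2] /andP[h3 h4].
have -> : z - a = (b - a) + (z - b) by ring.
move: (b - a) (z - b) h1 h2 h3 h4 => p q h1 h2 h3 h4; rewrite !raddfD; apply/andP; split.
  by apply: le_trans (ler_normD _ _) _; rewrite lerD.
by apply: le_trans (ler_normD _ _) _; rewrite lerD.
Qed.

Lemma csqW a r s z : r <= s -> csq a r z -> csq a s z.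
Proof. by move=> rs; rewrite !csqP => /andP[h1 h2]; rewrite (le_trans h1 rs) (le_trans h2 rs). Qed.

Lemma normc_csq a r z : normc (z - a) <= r -> csq a r z.
Proof.
by move=> h; rewrite csqP (le_trans (normc_Re _) h) (le_trans (normc_Im _) h).
Qed.

Lemma csq_normc a r z : csq a r z -> normc (z - a) <= 2 * r.
Proof.
rewrite csqP => /andP[h1 h2]; apply: le_trans (normc_le_ReIm _) _.
by rewrite mulr_natl mulr2n lerD.
Qed.

Lemma is_cd_line f (z u L : R[i]) (x : R) : is_cd f (z + x%:C * u) L ->
  is_derive x 1 (fun x => Re (f (z + x%:C * u))) (Re (u * L)) /\
  is_derive x 1 (fun x => Im (f (z + x%:C * u))) (Im (u * L)).
Proof.
move=> dF.
have key : forall e : R, 0 < e -> exists2 d : R, 0 < d & forall h : R, `|h| < d ->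
   normc (f (z + (x + h)%:C * u) - f (z + x%:C * u) - (u * L) * h%:C) <= e * `|h|.
  move=> e e0.
  have K0 : 0 < normc u + 1 by rewrite ltr_wpDl ?normc_ge0.
  have [|d d0 Hd] := dF (e / (normc u + 1)); first by rewrite divr_gt0.
  exists (d / (normc u + 1)); first by rewrite divr_gt0.
  move=> h hd.
  have E : z + (x + h)%:C * u = z + x%:C * u + h%:C * u by rewrite rmorphD; ring.
  have hu : normc (h%:C * u) <= `|h| * (normc u + 1).
    by rewrite normcM normc_real ler_wpM2l// lerDl.
  have hu1 : normc (h%:C * u) < d.
    by apply: le_lt_trans hu _; rewrite -ltr_pdivlMr.
  have := Hd _ hu1; rewrite -E.
  have -> : L * (h%:C * u) = u * L * h%:C by ring.
  move=> /le_trans; apply.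
  apply: (@le_trans _ _ (e / (normc u + 1) * (`|h| * (normc u + 1)))).
    by rewrite ler_wpM2l// ltW // divr_gt0.
  rewrite le_eqVlt; apply/orP; left; apply/eqP; field; exact: lt0r_neq0.
have ReM (w : R[i]) (h : R) : Re (w * h%:C) = Re w * h.
  by case: w => p q /=; rewrite mulr0 subr0.
have ImM (w : R[i]) (h : R) : Im (w * h%:C) = Im w * h.
  by case: w => p q /=; rewrite mulr0 add0r.
split; apply: is_derive_real => e /key[d d0 Hd]; exists d => // h /Hd.
  by apply: le_trans; rewrite -ReM -!raddfB; exact: normc_Re.
by apply: le_trans; rewrite -ImM -!raddfB; exact: normc_Im.
Qed.

(** The real mean value theorem is applied to the real and imaginary parts along the segment, at
    possibly different intermediate points; hence the factor 2. *)
Lemma mvi f (f' : R[i] -> R[i]) (a u : R[i]) (K : R) :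
  (forall t, 0 <= t <= 1 -> is_cd f (a + t%:C * u) (f' (a + t%:C * u))) ->
  (forall t, 0 <= t <= 1 -> normc (f' (a + t%:C * u)) <= K) ->
  normc (f (a + u) - f a) <= 2 * K * normc u.
Proof.
move=> H HK.
have comp (U dU : R -> R) : (forall t : R, 0 <= t <= 1 -> is_derive t 1 U (dU t)) ->
    (forall t, 0 <= t <= 1 -> `|dU t| <= normc u * K) -> `|U 1 - U 0| <= normc u * K.
  move=> dUt bU.
  have [|||t] := @MVT R U dU 0 1 => //.
  - by move=> t; rewrite in_itv /= => tt; apply: dUt; lra.
  - apply: derivable_within_continuous => t; rewrite in_itv /= => tt.
    by have [] := dUt t tt.
  - rewrite in_itv /= => tt ->; rewrite subr0 mulr1; apply: bU; lra.
have bd t : 0 <= t <= 1 -> normc (u * f' (a + t%:C * u)) <= normc u * K.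
  by move=> tt; rewrite normcM ler_wpM2l ?normc_ge0 // HK.
apply: le_trans (normc_le_ReIm _) _; rewrite !raddfB.
have h1 := comp (fun t => Re (f (a + t%:C * u))) (fun t => Re (u * f' (a + t%:C * u)))
  (fun t tt => (is_cd_line (H t tt)).1) (fun t tt => le_trans (normc_Re _) (bd t tt)).
have h2 := comp (fun t => Im (f (a + t%:C * u))) (fun t => Im (u * f' (a + t%:C * u)))
  (fun t tt => (is_cd_line (H t tt)).2) (fun t tt => le_trans (normc_Im _) (bd t tt)).
rewrite /= mul1r mul0r addr0 in h1 h2.
by move: h1 h2; lra.
Qed.

Lemma is_cd_quot f (a L : R[i]) : is_cd f a L ->
  forall e : R, 0 < e -> exists2 d : R, 0 < d &
    forall h, h != 0 -> normc h < d -> normc ((f (a + h) - f a) / (a + h - a) - L) <= e.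
Proof.
move=> H e /H[d d0 Hd]; exists d => // h h0 /Hd.
have -> : f (a + h) - f a - L * h = ((f (a + h) - f a) / (a + h - a) - L) * h.
  have -> : a + h - a = h by ring.
  by field.
by rewrite normcM ler_pM2r // normc_gt0.
Qed.

Lemma quot_cd f (a z L : R[i]) : z != a -> is_cd f z L ->
  is_cd (fun w => (f w - f a) / (w - a)) z (L / (z - a) - (f z - f a) / (z - a) ^+ 2).
Proof.
move=> za H; apply: (@is_cd_div_sub _ (fun w => f w - f a)) => //.
by rewrite -[L]subr0; apply: is_cdB => //; exact: is_cd_cst.
Qed.

(** [pole_lower] is applied to the difference quotient, whose limit at [a] is [L]. On the boundary
    that quotient over w - a is at most 2 M / r^2, and [rint_le] turns this into 4 |L| <= 32 M /
    r. *)
Lemma cauchy_estimate f (a L : R[i]) (r M : R) : 0 < r ->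
  (forall z, csq a r z -> exists L, is_cd f z L) ->
  (forall z, csq a r z -> normc (f z) <= M) ->
  is_cd f a L -> normc L <= 8 * M / r.
Proof.
case: a => a1 a2 r0 H HM HL; set a := a1 +i* a2.
have hx : a1 - r < a1 < a1 + r by lra.
have hy : a2 - r < a2 < a2 + r by lra.
have h1 : a1 - r <= a1 + r by lra.
have h2 : a2 - r <= a2 + r by lra.
have := @pole_lower R (fun w => (f w - f a) / (w - a)) L _ _ _ _ a1 a2 hx hy.
move=> /(_ _ (is_cd_quot HL)) A.
have {}A := A _; move: A; set I := rint _ _ _ _ _ => A.
suff B : normc I <= 4 * (2 * M / r ^+ 2) * ((a1 + r - (a1 - r)) + (a2 + r - (a2 - r))).
  have {}A : 4 * normc L <= normc I.
    by apply: A => z hz za; have [Lz HLz] := H z hz; eexists; exact: (quot_cd za HLz).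
  have E : 4 * (2 * M / r ^+ 2) * ((a1 + r - (a1 - r)) + (a2 + r - (a2 - r))) = 4 * (8 * M / r).
    by field; exact: lt0r_neq0.
  by rewrite E in B; rewrite -(@ler_pM2l _ 4) //; exact: le_trans A B.
have far z : on_bd (a1 - r) (a1 + r) (a2 - r) (a2 + r) z -> r <= normc (z - a).
  move=> /andP[_ z5]; move: z5 => /or4P[]/eqP zz.
  - by apply: le_trans (normc_Re _); rewrite raddfB /= zz ler_normr; lra.
  - by apply: le_trans (normc_Re _); rewrite raddfB /= zz ler_normr; lra.
  - by apply: le_trans (normc_Im _); rewrite raddfB /= zz ler_normr; lra.
  - by apply: le_trans (normc_Im _); rewrite raddfB /= zz ler_normr; lra.
have ne z : on_bd (a1 - r) (a1 + r) (a2 - r) (a2 + r) z -> z != a.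
  by move=> /far; apply: contraTneq => ->; rewrite subrr normc0 -ltNge.
apply: rint_le => //.
  move=> z hz; have /andP[hz' _] := hz; have [Lz HLz] := H z hz'.
  by have /is_cd_cca := is_cd_div_sub (ne _ hz) (quot_cd (ne _ hz) HLz).
move=> z hz; rewrite !normcM !normcV -mulrA -invfM -expr2.
have hf := far _ hz; have /andP[hz' _] := hz.
apply: ler_pM; rewrite ?normc_ge0 ?invr_ge0 ?exprn_ge0 ?normc_ge0 //.
  apply: le_trans (le_normcD _ _) _; rewrite normcN.
  have := HM z hz'; have := HM a (csq_center _ (ltW r0)); lra.
rewrite lef_pV2 ?posrE ?exprn_gt0 ?(lt_le_trans r0) //.
by apply: lerXn2r => //; rewrite nnegrE ?normc_ge0 // ltW.
Qed.

Lemma ccaM f g z : cca f z -> cca g z -> cca (fun z => f z * g z) z.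
Proof.
move=> Hf Hg e e0.
pose K := normc (f z) + normc (g z) + 1.
have K0 : 0 < K by rewrite ltr_wpDl // addr_ge0 ?normc_ge0.
pose e' := Num.min 1 (e / K).
have e'0 : 0 < e' by rewrite lt_min ltr01 divr_gt0.
have e'1 : e' <= 1 by rewrite ge_min lexx.
have e'K : e' * K <= e by rewrite -ler_pdivlMr // ge_min lexx orbT.
have [d d0 Hd] := Hf _ e'0; have [d' d'0 Hd'] := Hg _ e'0.
exists (Num.min d d'); first by rewrite lt_min d0.
move=> h; rewrite lt_min => /andP[/Hd h1 /Hd' h2].
have -> : f (z + h) * g (z + h) - f z * g z =
  (f (z + h) - f z) * (g (z + h) - g z) + (f z * (g (z + h) - g z) + (f (z + h) - f z) * g z) by ring.
apply: le_trans (le_normcD _ _) _; apply: le_trans (lerD (lexx _) (le_normcD _ _)) _.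
rewrite !normcM; apply: le_trans e'K.
have -> : e' * K = e' * 1 + (normc (f z) * e' + e' * normc (g z)) by rewrite /K; ring.
apply: lerD; last by apply: lerD; rewrite ?ler_wpM2l ?ler_wpM2r ?normc_ge0.
by apply: ler_pM; rewrite ?normc_ge0 // (le_trans h2).
Qed.

Lemma is_cd_shift f (a h L : R[i]) : is_cd f (a + h) L -> is_cd (fun z => f (z + h)) a L.
Proof. by move=> H e /H[d d0 Hd]; exists d => // k /Hd; rewrite (addrAC a). Qed.

(* Cauchy's estimate applied to [z |-> f (z + h) - f z]. *)
Lemma cca_deriv f (f' : R[i] -> R[i]) (a : R[i]) (r : R) : 0 < r ->
  (forall z, csq a r z -> is_cd f z (f' z)) -> cca f' a.
Proof.
move=> r0 H.
have [d d0 Hd] := is_cd_cca (H a (csq_center _ (ltW r0))) ltr01.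
pose s := Num.min r (d / 3).
have s0 : 0 < s by rewrite lt_min r0 divr_gt0.
have sr : s <= r by rewrite ge_min lexx.
have sd : s <= d / 3 by rewrite ge_min lexx orbT.
pose M := normc (f a) + 1.
have M0 : 0 < M by rewrite ltr_wpDl ?normc_ge0.
have fM z : csq a s z -> normc (f z) <= M.
  move=> hz; have -> : f z = (f (a + (z - a)) - f a) + f a by rewrite [a + _]addrC !subrK.
  apply: le_trans (le_normcD _ _) _; rewrite addrC lerD2l; apply: Hd.
  by have := csq_normc hz; lra.
pose K := 8 * M / (s / 2).
have K0 : 0 < K by rewrite divr_gt0 ?mulr_gt0 // divr_gt0.
have f'K z : csq a (s / 2) z -> normc (f' z) <= K.
  move=> hz; have sub w : csq z (s / 2) w -> csq a s w.
    by move=> hw; rewrite (splitr s); exact: csq_trans hz hw.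
  apply: (@cauchy_estimate f z); rewrite ?divr_gt0 //.
  - by move=> w /sub /(csqW sr) /H ?; exists (f' w).
  - by move=> w /sub /fM.
  - by apply/H/(csqW sr)/sub/csq_center; rewrite divr_ge0 // ltW.
(* [mvi] bounds f(z+h) - f(z) by 2 K |h| on the square of half-side s/4, so Cauchy's estimate bounds
   the increment of [f'] by 64 K |h| / s; the second entry of the minimum makes this at most [e]. *)
move=> e e0; exists (Num.min (s / 4) (e * s / (64 * K))).
  by rewrite lt_min (divr_gt0 s0) // divr_gt0 // mulr_gt0.
move=> h; rewrite lt_min => /andP[hs he].
have inc z t : csq a (s / 4) z -> 0 <= t <= 1 -> csq a (s / 2) (z + t%:C * h).
  move=> hz /andP[t0 t1]; have -> : s / 2 = s / 4 + s / 4 by field.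
  apply: csq_trans hz _; apply: normc_csq; rewrite addrC addKr normcM normc_real ger0_norm //.
  have := normc_ge0 h; nra.
have s2r : s / 2 <= r by lra.
have := @cauchy_estimate (fun z => f (z + h) - f z) a (f' (a + h) - f' a) (s / 4) (2 * K * normc h).
move=> E; apply: le_trans (E _ _ _ _) _ => {E}; rewrite ?divr_gt0 //.
- move=> z hz; exists (f' (z + h) - f' z); apply: is_cdB; last first.
    by apply/H/(csqW _ hz); lra.
  by apply/is_cd_shift/H/(csqW s2r); rewrite -[h]mul1r; apply: inc; rewrite ?lexx ?ler01.
- move=> z hz; apply: (@mvi f f').
  + by move=> t tt; apply/H/(csqW s2r)/inc.
  + by move=> t tt; apply/f'K/inc.
- apply: is_cdB; last by apply/H/csq_center/ltW.
  apply/is_cd_shift/H/(csqW s2r); rewrite -[h]mul1r; apply: inc; rewrite ?lexx ?ler01 //.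
  by apply: csq_center; rewrite divr_ge0 // ltW.
have -> : 8 * (2 * K * normc h) / (s / 4) = normc h * (64 * K / s) by field; exact: lt0r_neq0.
apply: le_trans (ler_wpM2r _ (ltW he)) _.
  by apply: divr_ge0; [apply: mulr_ge0|]; rewrite ?ltW.
rewrite le_eqVlt; apply/orP; left; apply/eqP; field.
by rewrite (lt0r_neq0 s0) (lt0r_neq0 K0).
Qed.

(* Integrating [((f - f a) / (w - a))'] around the rectangle turns Cauchy's formula for the
   derivative into a mean value property of [f'] itself. *)
Lemma deriv_pole f (f' : R[i] -> R[i]) (a1 a2 : R) x0 x1 y0 y1 :
  x0 < a1 < x1 -> y0 < a2 < y1 ->
  (forall z, in_rect x0 x1 y0 y1 z -> is_cd f z (f' z)) ->
  (forall z, in_rect x0 x1 y0 y1 z -> cca f' z) ->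
  4 * normc (f' (a1 +i* a2)) <= normc (rint (fun w => f' w / (w - (a1 +i* a2))) x0 x1 y0 y1).
Proof.
move=> hx hy H Hc; set a := a1 +i* a2.
have h1 : x0 <= x1 by lra.
have h2 : y0 <= y1 by lra.
have ina : in_rect x0 x1 y0 y1 a by rewrite /in_rect /=; lra.
have ne z : on_bd x0 x1 y0 y1 z -> z != a.
  by move=> /andP[_]; apply: contraTneq => -> /=; lra.
have bdin z : on_bd x0 x1 y0 y1 z -> in_rect x0 x1 y0 y1 z by move=> /andP[].
have A := @pole_lower R (fun w => (f w - f a) / (w - a)) (f' a) _ _ _ _ a1 a2 hx hy _
  (is_cd_quot (H a ina)).
apply: le_trans (A _) _.
  by move=> z hz za; eexists; exact: (quot_cd za (H z hz)).
have c1 : cca_bd (fun w => f' w / (w - a)) x0 x1 y0 y1.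
  move=> z hz; apply: ccaM; first exact: (Hc _ (bdin _ hz)).
  exact: cca_inv_sub (ne _ hz).
have c2 : cca_bd (fun w => (f w - f a) / (w - a) / (w - a)) x0 x1 y0 y1.
  move=> z hz; have za := ne _ hz.
  exact: is_cd_cca (is_cd_div_sub za (quot_cd za (H z (bdin _ hz)))).
have P : rint (fun w => f' w / (w - a) - (f w - f a) / (w - a) / (w - a)) x0 x1 y0 y1 = 0.
  apply: (@rint_prim R (fun w => (f w - f a) / (w - a))) => //.
    move=> z hz; have za := ne _ hz.
    apply: (is_cd_eq (quot_cd za (H z (bdin _ hz)))).
    by rewrite expr2 invfM mulrA.
  by move=> z hz; apply: ccaB; [exact: c1|exact: c2].
by move/eqP: P; rewrite rintB // subr_eq0 => /eqP ->.
Qed.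

End estimates.


(** * Mean value inequalities over squares *)

Section area_mean.
Context (R : realType).
Implicit Types (f g : R[i] -> R[i]).
Local Notation mR := (measurableTypeR R).
Local Notation leb := (@lebesgue_measure R).

(** If [F] were at least I / r on the whole interval of length [r], its integral would already reach
    [I]. *)
Lemma select_slice (F : mR -> \bar R) (p r I : R) : 0 < r ->
  measurable_fun [set: mR] F -> (forall x, (0 <= F x)%E) ->
  (\int[leb]_x F x < I%:E)%E ->
  exists2 x, p <= x <= p + r & (F x < (I / r)%:E)%E.
Proof.
move=> r0 mF F0 FI; apply: contrapT => /forall2NP N.
have {}N x : p <= x <= p + r -> ((I / r)%:E <= F x)%E.
  by move=> xx; rewrite leNgt; apply/negP => h; have [] := N x.
have I0 : 0 <= I.
  by rewrite -lee_fin; apply: le_trans (ltW FI); exact: integral_ge0.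
have s1 : (\int[leb]_(x in `[p, (p + r)%R]) F x <= \int[leb]_x F x)%E.
  exact: ge0_subset_integral.
have s2 : (\int[leb]_(x in `[p, (p + r)%R]) (I / r)%:E <= \int[leb]_(x in `[p, (p + r)%R]) F x)%E.
  apply: ge0_le_integral => //.
  - by move=> x _; rewrite lee_fin divr_ge0 // ltW.
  - exact: measurable_funTS.
have s3 : (\int[leb]_(x in `[p, (p + r)%R]) (I / r)%:E = I%:E)%E.
  rewrite integral_cst //= lebesgue_measure_itv /= lte_fin ltrDl r0 -EFinB -EFinM.
  by rewrite addrAC subrr add0r mulfVK ?gt_eqF.
by have := le_lt_trans (le_trans s2 s1) FI; rewrite s3 ltxx.
Qed.

(** The only consequence of holomorphy that the averaging uses. It holds for a holomorphic function
    by [pole_lower] and for a derivative by [deriv_pole], so one averaging argument serves both. *)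
Definition kernel_lower g (a1 a2 r : R) := forall x0 x1 y0 y1,
  a1 - r <= x0 < a1 -> a1 < x1 <= a1 + r -> a2 - r <= y0 < a2 -> a2 < y1 <= a2 + r ->
  4 * normc (g (a1 +i* a2)) <= normc (rint (fun w => g w / (w - (a1 +i* a2))) x0 x1 y0 y1).

(* The sides of the rectangle are chosen among those carrying at most the average mass. *)
Lemma area_mean_lt g (a1 a2 r I : R) : 0 < r ->
  (forall z, csq (a1 +i* a2) r z -> cca g z) -> kernel_lower g a1 a2 r ->
  (area (sqr (a1 +i* a2) r) (fun w => (normc (g (ptC w)))%:E) < I%:E)%E ->
  normc (g (a1 +i* a2)) * r ^+ 2 <= 8 * I.
Proof.
move=> r0; set a := a1 +i* a2 => cg KL; rewrite /area integral_mkcond.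
set k := (_ \_ _) => AI.
have k0 w : (0 <= k w)%E by rewrite /k patchE; case: ifP => // _; rewrite lee_fin normc_ge0.
have mk : measurable_fun [set: mR * mR] k.
  apply/(@measurable_restrictT _ _ _ _ (sqr a r) _ (measurable_sqr a r)).
  apply/measurable_EFinP; apply: cca_measurable; first exact: (measurable_sqr a r).
  by move=> w /sqrP; exact: cg.
have kE x y : a1 - r <= x <= a1 + r -> a2 - r <= y <= a2 + r -> k (x, y) = (normc (g (x +i* y)))%:E.
  by move=> xx yy; rewrite /k patchE ifT // inE; apply/sqrP; rewrite /in_rect /= xx yy.
have r2 : 0 < r / 2 by rewrite divr_gt0.
pose V x := (\int[leb]_y k (x, y))%E; pose H y := (\int[leb]_x k (x, y))%E.
have VI : (\int[leb]_x V x < I%:E)%E by rewrite -fubini_tonelli1.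
have HI : (\int[leb]_y H y < I%:E)%E by rewrite -fubini_tonelli2.
have mV : measurable_fun [set: mR] V by exact: measurable_fun_fubini_tonelli_F.
have mH : measurable_fun [set: mR] H by exact: measurable_fun_fubini_tonelli_G.
have V0 x : (0 <= V x)%E by apply: integral_ge0.
have H0 y : (0 <= H y)%E by apply: integral_ge0.
(* Each side is taken in an outer strip of width r/2, so the whole contour stays at distance at
   least r/2 from the centre and the kernel is at most 2/r on it. *)
have [x0 hx0 Vx0] := @select_slice V (a1 - r) _ _ r2 mV V0 VI.
have [x1 hx1 Vx1] := @select_slice V (a1 + r / 2) _ _ r2 mV V0 VI.
have [y0 hy0 Hy0] := @select_slice H (a2 - r) _ _ r2 mH H0 HI.
have [y1 hy1 Hy1] := @select_slice H (a2 + r / 2) _ _ r2 mH H0 HI.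
have A := KL x0 x1 y0 y1 ltac:(lra) ltac:(lra) ltac:(lra) ltac:(lra).
have hx : x0 <= x1 by lra.
have hy : y0 <= y1 by lra.
pose q (w : R[i]) := g w / (w - a).
have insq z : in_rect x0 x1 y0 y1 z -> csq a r z.
  by move=> hz; apply: in_rect_sub hz; rewrite /=; lra.
have far z : on_bd x0 x1 y0 y1 z -> r / 2 <= normc (z - a).
  move=> /andP[_ z5]; move: z5 => /or4P[]/eqP zz.
  - by apply: le_trans (normc_Re _); rewrite raddfB /= zz ler_normr; lra.
  - by apply: le_trans (normc_Re _); rewrite raddfB /= zz ler_normr; lra.
  - by apply: le_trans (normc_Im _); rewrite raddfB /= zz ler_normr; lra.
  - by apply: le_trans (normc_Im _); rewrite raddfB /= zz ler_normr; lra.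
have ne z : on_bd x0 x1 y0 y1 z -> z != a.
  by move=> /far; apply: contraTneq => ->; rewrite subrr normc0 -ltNge.
have cbg : cca_bd g x0 x1 y0 y1 by move=> z /andP[/insq /cg].
have cbq : cca_bd q x0 x1 y0 y1.
  by move=> z hz; apply: ccaM; [exact: cbg|exact: cca_inv_sub (ne _ hz)].
have qg z : on_bd x0 x1 y0 y1 z -> normc (q z) <= (2 / r) * normc (g z).
  move=> hz; rewrite normcM normcV mulrC ler_wpM2r ?normc_ge0 //.
  rewrite -[2 / r]invrK lef_pV2 ?posrE ?invr_gt0 ?divr_gt0 //.
    by rewrite invf_div; exact: far.
  by rewrite (lt_le_trans r2) // far.
have side (u v : R -> R[i]) (s t m : R) : s <= t -> ccts u s t -> ccts v s t ->
    (forall x, s <= x <= t -> normc (u x) <= (2 / r) * normc (v x)) ->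
    (\int[leb]_(x in `[s, t]) (normc (v x))%:E <= m%:E)%E ->
    normc (cint u s t) <= 4 / r * m.
  move=> st cu cv uv vm; apply: le_trans (cint_norm cu) _.
  have iv := within_integrable (ccts_norm cv).
  apply: (@le_trans _ _ (2 * \int[leb]_(x in `[s, t]) ((2 / r) * normc (v x)))).
    rewrite ler_pM2l //; apply: le_Rintegral => //.
    - exact: within_integrable (ccts_norm cu).
    - rewrite (_ : _ \o _ = (fun x => (2 / r)%:E * (EFin \o (fun x => normc (v x))) x)%E).
        exact: integrableZl.
      by apply/funext => x /=; rewrite EFinM.
  rewrite RintegralZl //.
  have -> : 4 / r * m = 2 * (2 / r * m) by field; exact: lt0r_neq0.
  rewrite ler_pM2l // ler_pM2l ?divr_gt0 // -lee_fin.
  by rewrite /Rintegral fineK //; exact: integrable_fin_num.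
have X0 : (x0 == x0) || (x0 == x1) by rewrite eqxx.
have X1 : (x1 == x0) || (x1 == x1) by rewrite eqxx orbT.
have Y0 : (y0 == y0) || (y0 == y1) by rewrite eqxx.
have Y1 : (y1 == y0) || (y1 == y1) by rewrite eqxx orbT.
have hor y : (y == y0) || (y == y1) -> (H y < (I / (r / 2))%:E)%E ->
    normc (cint (fun x => q (x +i* y)) x0 x1) <= 4 / r * (I / (r / 2)).
  move=> yy hH; apply: side hx (cca_bd_h hy cbq yy) (cca_bd_h hy cbg yy) _ _.
    by move=> x xx; apply: qg; exact: on_bd_h.
  apply: le_trans (ltW hH); rewrite /H.
  have -> : (\int[leb]_(x in `[x0, x1]) (normc (g (x +i* y)))%:E = \int[leb]_(x in `[x0, x1]) k (x, y))%E.
    apply: eq_integral => x; rewrite inE /= in_itv /= => xx; rewrite kE //; first by lra.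
    by move: yy => /orP[]/eqP->; lra.
  apply: ge0_subset_integral => //.
  exact: (measurableT_comp mk (pair2_measurable y)).
have ver x : (x == x0) || (x == x1) -> (V x < (I / (r / 2))%:E)%E ->
    normc (cint (fun y => q (x +i* y)) y0 y1) <= 4 / r * (I / (r / 2)).
  move=> xx hV; apply: side hy (cca_bd_v hx cbq xx) (cca_bd_v hx cbg xx) _ _.
    by move=> y yy; apply: qg; exact: on_bd_v.
  apply: le_trans (ltW hV); rewrite /V.
  have -> : (\int[leb]_(y in `[y0, y1]) (normc (g (x +i* y)))%:E = \int[leb]_(y in `[y0, y1]) k (x, y))%E.
    apply: eq_integral => y; rewrite inE /= in_itv /= => yy; rewrite kE //; last by lra.
    by move: xx => /orP[]/eqP->; lra.
  apply: ge0_subset_integral => //.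
  exact: (measurableT_comp mk (pair1_measurable x)).
have B := rint_sides q x0 x1 y0 y1.
have := hor _ Y0 Hy0; have := hor _ Y1 Hy1; have := ver _ X0 Vx0; have := ver _ X1 Vx1.
move=> b1 b2 b3 b4.
have {}A : 4 * normc (g a) <= 4 * (4 / r * (I / (r / 2))).
  apply: le_trans A _; apply: le_trans B _.
  have -> : 4 * (4 / r * (I / (r / 2))) = 4 / r * (I / (r / 2)) + 4 / r * (I / (r / 2)) +
    4 / r * (I / (r / 2)) + 4 / r * (I / (r / 2)) by ring.
  exact: lerD (lerD (lerD b4 b1) b3) b2.
have E : 4 * (4 / r * (I / (r / 2))) = 32 * I / r ^+ 2 by field; exact: lt0r_neq0.
rewrite E ler_pdivlMr ?exprn_gt0 // in A.
by move: A; move: (normc (g a)) (r ^+ 2) => x y; clear; lra.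
Qed.

Lemma area_mean g (a : R[i]) (r : R) : 0 < r ->
  (forall z, csq a r z -> cca g z) -> kernel_lower g (Re a) (Im a) r ->
  ((normc (g a) * r ^+ 2)%:E <= 8%:E * area (sqr a r) (fun w => (normc (g (ptC w)))%:E))%E.
Proof.
case: a => a1 a2 r0 cg KL.
set A := area _ _.
have A0 : (0 <= A)%E by apply: integral_ge0 => w _; rewrite lee_fin normc_ge0.
have [->|Afin] := eqVneq A +oo%E; first by rewrite gt0_muley ?leey // lte_fin.
have Ar : A = (fine A)%:E.
  by rewrite fineK // ge0_fin_numE // lt_neqAle Afin leey.
rewrite Ar -EFinM lee_fin; apply/ler_addgt0Pr => e e0.
have -> : 8 * fine A + e = 8 * (fine A + e / 8) by field.
by apply: area_mean_lt => //; rewrite -/A Ar lte_fin ltrDl divr_gt0.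
Qed.

Lemma holo_area_mean f (a : R[i]) (r : R) : 0 < r ->
  (forall z, csq a r z -> exists L, is_cd f z L) ->
  ((normc (f a) * r ^+ 2)%:E <= 8%:E * area (sqr a r) (fun w => (normc (f (ptC w)))%:E))%E.
Proof.
move=> r0 H; apply: area_mean => //.
  by move=> z /H[L]; exact: is_cd_cca.
case: a H => a1 a2 H x0 x1 y0 y1 /= h1 h2 h3 h4; apply: pole_lower; [lra|lra|..].
  by move=> z hz _; apply: H; apply: in_rect_sub hz => /=; lra.
move=> e e0; have [L HL] := H (a1 +i* a2) (csq_center _ (ltW r0)).
by have [d d0 Hd] := is_cd_cca HL e0; exists d => // h _; exact: Hd.
Qed.

(** [f'] enters only through its continuity and the kernel bound of [deriv_pole]. The margin between
    [r] and [s] leaves room for [cca_deriv] at points on the boundary of the smaller square. *)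
Lemma deriv_area_mean f (f' : R[i] -> R[i]) (a : R[i]) (r s : R) : 0 < r -> r < s ->
  (forall z, csq a s z -> is_cd f z (f' z)) ->
  ((normc (f' a) * r ^+ 2)%:E <= 8%:E * area (sqr a r) (fun w => (normc (f' (ptC w)))%:E))%E.
Proof.
move=> r0 rs H.
have cf z : csq a r z -> cca f' z.
  move=> hz; apply: (@cca_deriv _ f f' z (s - r)); first by rewrite subr_gt0.
  move=> w hw; apply: H; have -> : s = r + (s - r) by ring.
  exact: csq_trans hz hw.
apply: area_mean => //.
case: a H cf => a1 a2 H cf x0 x1 y0 y1 /= h1 h2 h3 h4.
apply: (@deriv_pole R f f'); [lra|lra|..].
  by move=> z hz; apply: H; apply: in_rect_sub hz => /=; lra.
by move=> z hz; apply: cf; apply: in_rect_sub hz => /=; lra.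
Qed.

End area_mean.


(** * Compactness, areas, and the square mean value inequality *)

Section disk_bounds.
Context (R : realType).
Implicit Types (f g : R[i] -> R[i]).
Local Notation mR := (measurableTypeR R).
Local Notation leb := (@lebesgue_measure R).

Lemma plane_continuous_at (u : R * R -> R) (z : R * R) :
  (forall e : R, 0 < e -> exists2 d : R, 0 < d &
    forall w : R * R, `|w.1 - z.1| < d -> `|w.2 - z.2| < d -> `|u w - u z| <= e) ->
  {for z, continuous u}.
Proof.
move=> H; apply/cvgrPdist_le => e e0; have [d d0 Hd] := H e e0.
exists (ball z.1 d, ball z.2 d) => /=; first by split; exact: nbhsx_ballx.
move=> w [/= w1 w2]; rewrite distrC; apply: Hd; rewrite distrC.
  exact: w1.
exact: w2.
Qed.

Lemma bounded_disk f (r : R) : (forall z, normc z <= r -> cca f z) ->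
  exists M : R, forall z, normc z <= r -> normc (f z) <= M.
Proof.
move=> H; have [r0|r0] := ltP r 0.
  by exists 0 => z zr; have := normc_ge0 z; rewrite leNgt (le_lt_trans zr r0).
pose K : set (R * R) := [set w | normc (w.1 +i* w.2) <= r].
have cu g (z : R * R) : cca g (z.1 +i* z.2) ->
    {for z, continuous (fun w : R * R => normc (g (w.1 +i* w.2)))}.
  by move=> /cca_box cg; apply: plane_continuous_at.
have cK : compact K.
  apply: (@subclosed_compact _ _ (`[- r, r] `*` `[- r, r])).
  - apply: (@preimage_closed _ _ (fun w : R * R => normc (w.1 +i* w.2)) [set x | x <= r]).
      by move=> z *; apply: (cu id); exact: cca_id.
    exact: closed_le.
  - by apply: compact_setX; exact: segment_compact.
  - move=> w Kw; split; rewrite /= in_itv /= -ler_norml.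
      exact: le_trans (normc_Re (w.1 +i* w.2)) Kw.
    exact: le_trans (normc_Im (w.1 +i* w.2)) Kw.
have [||c _ Hc] := @compact_EVT_max _ R (fun w : R * R => normc (f (w.1 +i* w.2))) K _ cK.
- by exists (0, 0); rewrite /K /= normc0.
- apply/continuous_in_subspaceT => z; rewrite inE => Kz.
  by apply: cu; apply: H.
exists (normc (f (c.1 +i* c.2))) => -[x y] zr.
by apply: (Hc (x, y)); rewrite inE.
Qed.

Lemma area_le (D E : set (mR * mR)) (u v : mR * mR -> \bar R) :
  measurable D -> measurable E -> D `<=` E ->
  measurable_fun D u -> measurable_fun E v ->
  (forall w, D w -> (0 <= u w <= v w)%E) -> (forall w, E w -> (0 <= v w)%E) ->
  (area D u <= area E v)%E.
Proof.
move=> mD mE DE mu mv uv v0; rewrite /area.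
apply: (@le_trans _ _ (area D v)).
  apply: ge0_le_integral => //.
  - by move=> w /uv/andP[].
  - exact: measurable_funS mv.
  - by move=> w /uv/andP[].
exact: ge0_subset_integral.
Qed.

Lemma areaZl (D : set (mR * mR)) (u : mR * mR -> \bar R) (k : R) :
  measurable D -> measurable_fun D u -> (forall w, D w -> (0 <= u w)%E) -> 0 <= k ->
  area D (fun w => k%:E * u w)%E = (k%:E * area D u)%E.
Proof. by move=> mD mu u0 k0; exact: ge0_integralZl_EFin. Qed.

Lemma areaD (D : set (mR * mR)) (u v : mR * mR -> \bar R) :
  measurable D -> measurable_fun D u -> measurable_fun D v ->
  (forall w, D w -> (0 <= u w)%E) -> (forall w, D w -> (0 <= v w)%E) ->
  area D (fun w => u w + v w)%E = (area D u + area D v)%E.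
Proof. by move=> mD mu mv u0 v0; exact: ge0_integralD. Qed.

Lemma area_sqr (a : R[i]) (r : R) (c : \bar R) : 0 < r ->
  area (sqr a r) (fun=> c) = (c * (4 * r ^+ 2)%:E)%E.
Proof.
move=> r0; rewrite /area integral_cst; last exact: (measurable_sqr a r).
congr (_ * _)%E; rewrite /sqr; apply: etrans.
  by apply: product_measure1E; exact: measurable_itv.
have h (x : R) : x - r < x + r by lra.
rewrite /= !lebesgue_measure_itv /= !lte_fin !h -!EFinB -EFinM; congr EFin; ring.
Qed.

Lemma disk_integral_lty (h : R[i] -> R) :
  (forall z, unit_disk z -> 0 <= h z) ->
  ((disk_integral h < +oo)%E <->
   (area [set w | unit_disk (ptC w)] (fun w => (h (ptC w))%:E) < +oo)%E).
Proof.
move=> h0; rewrite /disk_integral -/(area _ _).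
set A := area _ _.
have A0 : (0 <= A)%E by apply: integral_ge0 => w Dw; rewrite lee_fin; exact: h0.
have p0 : 0 < (pi : R)^-1 by rewrite invr_gt0 pi_gt0.
split; last by move=> Aoo; rewrite lte_mul_pinfty // lee_fin ltW.
move=> H; rewrite ltey; apply/eqP => AE.
by move: H; rewrite [X in (_ * X)%E]AE gt0_muley // lte_fin.
Qed.

Lemma Hol_is_cd f (z : R[i]) : Hol_disk f -> unit_disk z -> is_cd f z (C_deriv f z).
Proof. by move=> H Dz; apply/C_derivableP; exact: H. Qed.

Lemma csq_disk (a : R[i]) (r t : R) (z : R[i]) : normc a + 2 * r <= t -> csq a r z -> normc z <= t.
Proof.
move=> h /csq_normc hz; apply: le_trans h; rewrite -[z](subrK a) addrC.
by apply: le_trans (le_normcD _ _) _; rewrite lerD2l.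
Qed.

(** The inequality for |f'|^2 comes from the linear one by Cauchy-Schwarz in additive form: |f'| is
    split against the value [L] at the centre, and the part linear in [L] is absorbed on the
    left. *)
Lemma sq_mean f (f' : R[i] -> R[i]) (a : R[i]) (r : R) :
  (forall z, unit_disk z -> is_cd f z (f' z)) -> 0 < r -> normc a + 2 * r < 1 ->
  ((normc (f' a) ^+ 2 * r ^+ 2)%:E <=
   256%:E * area (sqr a r) (fun w => (normc (f' (ptC w)) ^+ 2)%:E))%E.
Proof.
move=> Hf r0 ar.
pose s := r + (1 - (normc a + 2 * r)) / 4.
have rs : r < s by rewrite /s; lra.
have sD z : csq a s z -> unit_disk z.
  move=> hz; apply: le_lt_trans (_ : normc a + 2 * s < 1); last by rewrite /s; lra.
  exact: csq_disk hz.
have dm := deriv_area_mean r0 rs (fun z hz => Hf z (sD z hz)).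
have cf z : csq a r z -> cca f' z.
  move=> hz; apply: (@cca_deriv _ f _ z (s - r)); first by rewrite subr_gt0.
  move=> w hw; apply: Hf; apply: sD; have -> : s = r + (s - r) by ring.
  exact: csq_trans hz hw.
have mf : measurable_fun (sqr a r) (fun w => normc (f' (ptC w))).
  by apply: cca_measurable; [exact: (measurable_sqr a r)|move=> w /sqrP; exact: cf].
set L := normc (f' a) in dm *.
have [->|L0] := eqVneq L 0.
  rewrite expr0n mul0r; apply: mule_ge0; first by rewrite lee_fin ler0n.
  by apply: integral_ge0 => w _; rewrite lee_fin sqr_ge0.
have {}L0 : 0 < L by rewrite lt_def L0 normc_ge0.
set A := area _ _.
have mf2 : measurable_fun (sqr a r) (fun w => (normc (f' (ptC w)) ^+ 2)%:E).
  by apply/measurable_EFinP; exact: measurable_funX.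
(* AM-GM: [t <= L / 64 + 16 t^2 / L] *)
have st : (area (sqr a r) (fun w => (normc (f' (ptC w)))%:E) <=
   (L / 64)%:E * (4 * r ^+ 2)%:E + (16 / L)%:E * A)%E.
  have mS := measurable_sqr a r.
  have k0 : 0 <= 16 / L by rewrite divr_ge0 // ltW.
  have u0 (w : mR * mR) : sqr a r w -> (0 <= (normc (f' (ptC w)) ^+ 2)%:E)%E.
    by move=> _; rewrite lee_fin sqr_ge0.
  rewrite -(@area_sqr a r (L / 64)%:E r0) /A -(areaZl mS mf2 u0 k0) -areaD //; last 3 first.
  - exact: measurable_funeM.
  - by move=> w _; rewrite lee_fin divr_ge0 // ltW.
  - by move=> w /u0 h; rewrite mule_ge0.
  apply: ge0_le_integral => //.
  - by move=> w _; rewrite lee_fin normc_ge0.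
  - exact/measurable_EFinP.
  - by apply: emeasurable_funD => //; apply: measurable_funeM.
  - move=> w _; rewrite -EFinM -EFinD lee_fin; set t := normc _.
    rewrite -subr_ge0.
    have -> : L / 64 + 16 / L * t ^+ 2 - t = (L - 32 * t) ^+ 2 / (64 * L).
      by field; exact: lt0r_neq0.
    by rewrite divr_ge0 ?sqr_ge0 // mulr_ge0 // ltW.
have [AE|Afin] := eqVneq A +oo%E; first by rewrite AE gt0_muley; [exact: leey|rewrite lte_fin ltr0n].
have A0 : (0 <= A)%E by apply: integral_ge0 => w _; rewrite lee_fin sqr_ge0.
have Ar : A = (fine A)%:E.
  by rewrite fineK // ge0_fin_numE // lt_neqAle Afin leey.
have h8 : (0 <= 8%:E :> \bar R)%E by rewrite lee_fin.
have B := le_trans dm (lee_wpmul2l h8 st).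
rewrite Ar in B *.
have {}B : L * r ^+ 2 <= 8 * (L / 64 * (4 * r ^+ 2) + 16 / L * fine A) by rewrite -lee_fin.
suff : L ^+ 2 * r ^+ 2 <= 256 * fine A by rewrite -lee_fin.
(* The weight 1/64 was chosen for this: the constant part becomes L r^2 / 2, exactly half of the
   left side. *)
have E : 8 * (L / 64 * (4 * r ^+ 2) + 16 / L * fine A) = L * r ^+ 2 / 2 + 128 * fine A / L.
  by field; exact: lt0r_neq0.
rewrite E in B.
have {}B : L * r ^+ 2 / 2 <= 128 * fine A / L by lra.
rewrite ler_pdivlMr // in B; lra.
Qed.

End disk_bounds.


(** * Pointwise growth from weighted integrability *)

Section bergman_growth.
Context (R : realType).
Implicit Types (F : R[i] -> R[i]).
Local Notation mR := (measurableTypeR R).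
Local Notation DD := [set w : mR * mR | unit_disk (ptC w)].

Lemma measurable_powR_comp (D : set (mR * mR)) (u : mR * mR -> R) (p : R) :
  measurable_fun D u -> measurable_fun D (fun w => u w `^ p).
Proof. by move=> mu; apply: (measurableT_comp (@measurable_powR R p) mu). Qed.

Lemma Hol_cca F (w : mR * mR) : Hol_disk F -> DD w -> cca F (ptC w).
Proof. by move=> HF Dw; exact: is_cd_cca (Hol_is_cd HF Dw). Qed.

Lemma measurable_Hol F : Hol_disk F -> measurable_fun DD (fun w : mR * mR => normc (F (ptC w))).
Proof.
move=> HF; apply: cca_measurable; first exact: measurable_disk.
by move=> w; exact: Hol_cca.
Qed.

Lemma sqr_disk (a : R[i]) (r : R) : normc a + 2 * r < 1 -> sqr a r `<=` DD.
Proof. by move=> h w /sqrP hw; apply: le_lt_trans h; exact: csq_disk hw. Qed.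

Lemma area_disk_cst (c : R) : 0 <= c -> (area DD (fun=> c%:E) <= (4 * c)%:E)%E.
Proof.
move=> c0.
have -> : (4 * c)%:E = area (sqr (0 : R[i]) 1) (fun=> c%:E) :> \bar R.
  by rewrite area_sqr // -EFinM; congr EFin; ring.
apply: area_le => //; [exact: measurable_disk|exact: (measurable_sqr 0 1)|..].
- move=> w Dw; apply/sqrP; have /= h := normc_Re (ptC w); have /= h' := normc_Im (ptC w).
  have Dw' : normc (ptC w) < 1 by [].
  by move: h h'; rewrite /in_rect /= !ler_norml; lra.
- by move=> w _; rewrite lexx lee_fin c0.
Qed.

(** The mean value inequality is linear in |F|, whereas the hypothesis controls |F|^q with q <= 1.
    Writing |F| = |F|^(1-q) |F|^q and bounding the first factor by a weighted supremum [A] of |F|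
    itself leads to A <= K A^(1-q), that is A <= K^(1/q). *)
Lemma subharmonic_growth F (q : R) (m N : nat) (J : R) : Hol_disk F -> 0 < q <= 1 ->
  (2 + m)%N%:R <= N%:R * q -> 0 <= J ->
  (area DD (fun w => ((1 - normc (ptC w)) ^+ m * normc (F (ptC w)) `^ q)%:E) <= J%:E)%E ->
  forall z, unit_disk z -> normc (F z) * (1 - normc z) ^+ N <= 2 ^+ N * (2 ^+ N * (32 * J)) `^ q^-1.
Proof.
move=> HF /andP[q0 q1] Nq J0 HJ.
pose K := 2 ^+ N * (32 * J).
have K0 : 0 <= K by rewrite /K mulr_ge0 // mulr_ge0.
(* Dividing by A^(1-q) requires a finite [A]: [F] is bounded on the closed disk of radius r < 1.
   Taking r = (1+|z|)/2 at the end costs the outer factor 2^N. *)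
suff main (r : R) : 0 < r -> r < 1 -> forall z, normc z < r -> normc (F z) * (r - normc z) ^+ N <= K `^ q^-1.
  move=> z Dz; have Dz' : normc z < 1 by [].
  have z0 := normc_ge0 z.
  have := main ((1 + normc z) / 2) ltac:(lra) ltac:(lra) z ltac:(lra).
  have -> : (1 + normc z) / 2 - normc z = (1 - normc z) / 2 by field.
  have -> : normc (F z) * ((1 - normc z) / 2) ^+ N = normc (F z) * (1 - normc z) ^+ N / 2 ^+ N.
    by rewrite expr_div_n mulrA.
  by rewrite ler_pdivrMr ?exprn_gt0 // [_ * 2 ^+ N]mulrC.
move=> r0 r1.
have [M HM] := @bounded_disk R F r (fun z zr => is_cd_cca (Hol_is_cd HF (le_lt_trans zr r1 : unit_disk z))).
pose S := [set normc (F z) * (r - normc z) ^+ N | z in [set z | normc z < r]].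
have S0 : S !=set0 by exists (normc (F 0) * (r - normc 0) ^+ N); exists 0 => //=; rewrite normc0.
have ubS : has_ubound S.
  exists M => _ [z /= zr <-]; have z0 := normc_ge0 z.
  have M0 : 0 <= M by apply: le_trans (normc_ge0 (F z)) (HM _ (ltW zr)).
  rewrite -[M]mulr1; apply: ler_pM; [exact: normc_ge0|apply: exprn_ge0; lra|exact: HM (ltW zr)|].
  by apply: exprn_ile1; lra.
pose A := sup S.
have hA z : normc z < r -> normc (F z) * (r - normc z) ^+ N <= A.
  by move=> zr; apply: ub_le_sup => //; exists z.
have A0 : 0 <= A.
  by apply: le_trans (hA 0 _); rewrite ?normc0 // mulr_ge0 ?normc_ge0 // exprn_ge0 // subr0 ltW.
suff AK : A <= K `^ q^-1 by move=> z /hA zA; exact: le_trans zA AK.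
have [->|An0] := eqVneq A 0; first exact: powR_ge0.
have {An0} A0 : 0 < A by rewrite lt_def An0 A0.
suff step z : normc z < r -> normc (F z) * (r - normc z) ^+ N <= K * A `^ (1 - q).
  have : A <= K * A `^ (1 - q) by apply: ge_sup => // _ [z /= zr <-]; exact: step.
  rewrite -{1}(powRr1 (ltW A0)) -{1}[1](subrK q) powRD; last by rewrite (gt_eqF A0) implybT.
  rewrite mulrC ler_pM2r ?powR_gt0 // => h.
  rewrite -[A](powRr1 (ltW A0)) -(mulfV (lt0r_neq0 q0)) powRrM.
  by apply: ge0_ler_powR; rewrite ?nnegrE ?powR_ge0 ?invr_ge0 // ltW.
move=> zr; have z0 := normc_ge0 z.
(* The square of half-side [rho] around [z] stays in |w| <= r - s, so both r - |w| and 1 - |w| are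
   at least [s] on it. *)
pose s := (r - normc z) / 2; pose rho := s / 2.
have s0 : 0 < s by rewrite divr_gt0 // subr_gt0.
have s1 : s <= 1 by rewrite /s; lra.
have rho0 : 0 < rho by rewrite divr_gt0.
have zrho : normc z + 2 * rho = r - s by rewrite /rho /s; field.
have sD w : csq z rho w -> normc w <= r - s by move=> hw; apply: csq_disk hw; rewrite zrho.
pose B := A / s ^+ N.
have B0 : 0 < B by rewrite divr_gt0 // exprn_gt0.
pose c := B `^ (1 - q) / s ^+ m.
have c0 : 0 <= c by rewrite divr_ge0 ?powR_ge0 // exprn_ge0 // ltW.
have pw w : csq z rho w -> normc (F w) <= c * ((1 - normc w) ^+ m * normc (F w) `^ q).
  move=> /sD hw.
  have w1 : s <= 1 - normc w by lra.
  have sm : s ^+ m <= (1 - normc w) ^+ m by apply: lerXn2r; rewrite // nnegrE; lra.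
  have FB : normc (F w) <= B.
    rewrite ler_pdivlMr ?exprn_gt0 //; apply: le_trans (hA w _); last by lra.
    by rewrite ler_wpM2l ?normc_ge0 //; apply: lerXn2r; rewrite ?nnegrE; lra.
  have [->|Fn0] := eqVneq (normc (F w)) 0.
    by rewrite mulr_ge0 // mulr_ge0 ?powR_ge0 // exprn_ge0 //; lra.
  have F0 : 0 < normc (F w) by rewrite lt_def Fn0 normc_ge0.
  rewrite -{1}(powRr1 (ltW F0)) -{1}[1](subrK q) powRD; last by rewrite Fn0 implybT.
  rewrite mulrA ler_pM2r ?powR_gt0 //.
  apply: (@le_trans _ _ (B `^ (1 - q))).
    by apply: ge0_ler_powR; rewrite ?nnegrE ?subr_ge0 ?normc_ge0 // ltW.
  rewrite /c mulrAC ler_pdivlMr ?exprn_gt0 // ler_wpM2l ?powR_ge0 //.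
have mu : measurable_fun DD (fun w : mR * mR => ((1 - normc (ptC w)) ^+ m * normc (F (ptC w)) `^ q)%:E).
  apply/measurable_EFinP; apply: measurable_funM.
    apply: measurable_funX; apply: measurable_funB => //.
    exact: (measurable_funTS (@measurable_normc R)).
  by apply: measurable_powR_comp; exact: measurable_Hol.
have u0 w : DD w -> (0 <= ((1 - normc (ptC w)) ^+ m * normc (F (ptC w)) `^ q)%:E)%E.
  move=> Dw; have Dw' : normc (ptC w) < 1 by [].
  by rewrite lee_fin mulr_ge0 ?powR_ge0 // exprn_ge0 // subr_ge0 ltW.
have sqD : sqr z rho `<=` DD by apply: sqr_disk; lra.
have am : (area (sqr z rho) (fun w => (normc (F (ptC w)))%:E) <= (c * J)%:E)%E.
  apply: (@le_trans _ _ (area DD (fun w => c%:E * ((1 - normc (ptC w)) ^+ m * normc (F (ptC w)) `^ q)%:E)%E)).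
    apply: area_le => //; [exact: (measurable_sqr z rho)|exact: measurable_disk|..].
    - apply/measurable_EFinP; apply: measurable_funS (measurable_Hol HF) => //.
      exact: measurable_disk.
    - exact: measurable_funeM.
    - by move=> w /sqrP hw; rewrite -EFinM !lee_fin normc_ge0; exact: pw.
    - by move=> w /u0 h; apply: mule_ge0 => //; rewrite lee_fin.
  rewrite areaZl //; last exact: measurable_disk.
  by rewrite [X in (_ <= X)%E]EFinM; apply: lee_wpmul2l => //; rewrite lee_fin.
have hm := @holo_area_mean R F z rho rho0 (fun w hw =>
   ex_intro _ _ (Hol_is_cd HF (le_lt_trans (sD w hw) (ltac:(lra) : r - s < 1)))).
have h8 : (0 <= 8%:E :> \bar R)%E by rewrite lee_fin.
have {hm am} H1 : normc (F z) * rho ^+ 2 <= 8 * (c * J).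
  by rewrite -lee_fin; apply: le_trans hm _; exact: (lee_wpmul2l h8 am).
have sN0 : 0 < s ^+ N by exact: exprn_gt0.
have sm0 : 0 < s ^+ m by exact: exprn_gt0.
have s20 : 0 < s ^+ 2 by exact: exprn_gt0.
have BE : B `^ (1 - q) * s ^+ N = A `^ (1 - q) * s `^ (N%:R * q).
  rewrite /B powRM ?invr_ge0 ?(ltW sN0) ?(ltW A0) // -mulrA; congr (_ * _).
  rewrite -powR_inv1 ?(ltW sN0) // -powRrM mulN1r opprB.
  rewrite -{2}(powRr1 (ltW sN0)) -powRD; last by rewrite (gt_eqF sN0) implybT.
  by rewrite subrK -powR_mulrn ?(ltW s0) // -powRrM.
(* Here the condition on [N] is spent: N q >= 2 + m pays for the area s^2 of the square and for the
   weight s^m, as s <= 1. *)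
have sNq : s `^ (N%:R * q) <= s ^+ (2 + m).
  by rewrite -powR_mulrn ?(ltW s0) //; apply: ger_powR; rewrite // s0.
have H2 : normc (F z) * (s ^+ 2 * s ^+ m) <= 32 * J * B `^ (1 - q).
  move: H1; rewrite /rho /c expr_div_n.
  have -> : 8 * (B `^ (1 - q) / s ^+ m * J) = (8 * J * B `^ (1 - q)) / s ^+ m by field; exact: lt0r_neq0.
  rewrite ler_pdivlMr // => h; have : normc (F z) * (s ^+ 2 / 2 ^+ 2) * s ^+ m * 4 <= 8 * J * B `^ (1 - q) * 4.
    by rewrite ler_pM2r.
  have -> : normc (F z) * (s ^+ 2 / 2 ^+ 2) * s ^+ m * 4 = normc (F z) * (s ^+ 2 * s ^+ m) by field.
  by move=> /le_trans; apply; rewrite le_eqVlt; apply/orP; left; apply/eqP; ring.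
have H3 : normc (F z) * s ^+ N <= 32 * J * A `^ (1 - q).
  rewrite -(ler_pM2r (mulr_gt0 s20 sm0)).
  apply: (@le_trans _ _ (32 * J * (B `^ (1 - q) * s ^+ N))).
    have -> : normc (F z) * s ^+ N * (s ^+ 2 * s ^+ m) = normc (F z) * (s ^+ 2 * s ^+ m) * s ^+ N by ring.
    by rewrite mulrA ler_pM2r.
  rewrite BE mulrA ler_wpM2l //; first by rewrite mulr_ge0 ?powR_ge0 // mulr_ge0.
  by rewrite -exprD.
have -> : (r - normc z) ^+ N = 2 ^+ N * s ^+ N.
  by rewrite -exprMn; congr (_ ^+ _); rewrite /s; field.
rewrite mulrCA /K -[X in _ <= X]mulrA ler_pM2l ?exprn_gt0 //.
Qed.

End bergman_growth.


(** * Growth in Bergman spaces; [Q_space] lies in the Bloch space *)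

Section space_growth.
Context (R : realType).
Implicit Types (f F : R[i] -> R[i]).
Local Notation mR := (measurableTypeR R).
Local Notation DD := [set w : mR * mR | unit_disk (ptC w)].

Lemma ge0_lty_real (A : \bar R) : (0 <= A)%E -> (A < +oo)%E -> exists2 r : R, 0 <= r & A = r%:E.
Proof.
move=> A0 Aoo; exists (fine A); first exact: fine_ge0.
by rewrite fineK // ge0_fin_numE.
Qed.

Lemma exists_nat_ge (x : R) : exists n : nat, x <= n%:R.
Proof.
exists (Num.truncn `|x|).+1; apply: le_trans (ler_norm x) _.
by have /andP[_ /ltW] := truncn_itv (normr_ge0 x).
Qed.

Lemma measurable_weight (alpha : R) :
  measurable_fun DD (fun w : mR * mR => (1 - normc (ptC w) ^+ 2) `^ alpha).
Proof.
apply: measurable_powR_comp; apply: measurable_funB => //; apply: measurable_funX.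
exact: (measurable_funTS (@measurable_normc R)).
Qed.

(** Reduction to an exponent q <= 1 and an integer weight: |F|^q <= 1 + |F|^p for q = min(p, 1), and
    (1-|z|)^m <= (1-|z|^2)^alpha for m >= max(alpha, 0). That [N] precedes [F] matters: it fixes the
    growth scale for the gliding hump. *)
Lemma bergman_growth (p alpha : R) : 0 < p -> exists N : nat, forall F, bergman_space p alpha F ->
  exists C : R, forall z, unit_disk z -> normc (F z) * (1 - normc z) ^+ N <= C.
Proof.
move=> p0.
have [m hm] := exists_nat_ge (Num.max alpha 0).
pose q := Num.min p 1.
have q0 : 0 < q by rewrite lt_min p0 ltr01.
have q1 : q <= 1 by rewrite ge_min lexx orbT.
have qp : q <= p by rewrite ge_min lexx.
have [N hN] := exists_nat_ge ((2 + m)%N%:R / q).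
exists N => F [HF].
move/(disk_integral_lty (h := fun z => (1 - normc z ^+ 2) `^ alpha * normc (F z) `^ p)).
have h0 (z : R[i]) : 0 <= (1 - normc z ^+ 2) `^ alpha * normc (F z) `^ p by rewrite mulr_ge0 ?powR_ge0.
move=> /(_ (fun z _ => h0 z)) AI.
have [J0 J00 JE] := ge0_lty_real (integral_ge0 _ (fun w _ => h0 (ptC w) : (0 <= (_)%:E)%E)) AI.
(* The 4 is the area of a square containing the disk; it accounts for the summand 1 in |F|^q <= 1 +
   |F|^p. *)
exists (2 ^+ N * (2 ^+ N * (32 * (4 + J0))) `^ q^-1).
apply: (@subharmonic_growth R F q m) => //.
- by rewrite q0.
- by move: hN; rewrite ler_pdivrMr.
- by rewrite addr_ge0.
have mD : measurable DD by exact: measurable_disk.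
have mv : measurable_fun DD (fun w : mR * mR => ((1 - normc (ptC w) ^+ 2) `^ alpha * normc (F (ptC w)) `^ p)%:E).
  apply/measurable_EFinP; apply: measurable_funM; first exact: measurable_weight.
  by apply: measurable_powR_comp; exact: measurable_Hol.
have sum_ : (area DD (fun w => 1%:E + ((1 - normc (ptC w) ^+ 2) `^ alpha * normc (F (ptC w)) `^ p)%:E)%E <= (4 + J0)%:E)%E.
  rewrite areaD //; last by move=> w _; rewrite lee_fin h0.
  rewrite EFinD; apply: leeD; last by rewrite /area JE.
  by apply: le_trans (area_disk_cst ler01) _; rewrite mulr1.
apply: le_trans sum_.
apply: area_le => //.
- apply/measurable_EFinP; apply: measurable_funM.
    apply: measurable_funX; apply: measurable_funB => //.
    exact: (measurable_funTS (@measurable_normc R)).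
  by apply: measurable_powR_comp; exact: measurable_Hol.
- exact: emeasurable_funD.
- move=> w Dw; have Dw' : normc (ptC w) < 1 by [].
  have n0 := normc_ge0 (ptC w).
  set x := normc (ptC w) in Dw' n0 *; set t := normc (F (ptC w)).
  have t0 : 0 <= t by exact: normc_ge0.
  have x2 : x ^+ 2 < 1 by rewrite expr_lt1.
  have xm0 : 0 <= (1 - x) ^+ m by rewrite exprn_ge0 // subr_ge0 ltW.
  rewrite -EFinD !lee_fin mulr_ge0 ?powR_ge0 //=.
  have tq : t `^ q <= 1 + t `^ p.
    have [t1|t1] := leP t 1.
      apply: (@le_trans _ _ 1); last by rewrite lerDl powR_ge0.
      rewrite (_ : 1 = 1 `^ q); last by rewrite powR1.
      by apply: ge0_ler_powR; rewrite ?nnegrE // ltW.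
    apply: (@le_trans _ _ (t `^ p)); last by rewrite lerDr.
    by apply: ler_powR; rewrite // ltW.
  have xm1 : (1 - x) ^+ m <= 1 by apply: exprn_ile1; lra.
  have xma : (1 - x) ^+ m <= (1 - x ^+ 2) `^ alpha.
    have x10 : 0 < 1 - x by lra.
    have [a0|a0] := leP alpha 0.
      apply: le_trans xm1 _; rewrite -{1}(powRr0 (1 - x ^+ 2)); apply: ger_powR => //.
      by rewrite subr_gt0 x2 lerBlDr lerDl sqr_ge0.
    apply: (@le_trans _ _ ((1 - x) `^ alpha)); last first.
      apply: ge0_ler_powR; rewrite ?nnegrE ?(ltW a0) ?(ltW x10) //; last by nra.
      by rewrite subr_ge0 ltW.
    rewrite -powR_mulrn ?(ltW x10) //; apply: ger_powR; first by lra.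
    by apply: le_trans hm; rewrite le_max lexx.
  apply: le_trans (ler_wpM2l xm0 tq) _; rewrite mulrDr mulr1; apply: lerD => //.
  by rewrite ler_wpM2r // powR_ge0.
- by move=> w Dw; rewrite -EFinD lee_fin addr_ge0.
Qed.

Lemma normc_conjM_lt (a z : R[i]) : unit_disk a -> unit_disk z ->
  1 - normc a <= normc (1 - a^* * z).
Proof.
move=> Da Dz; have Da' : normc a < 1 by []. have Dz' : normc z < 1 by [].
have -> : normc (1 - a^* * z) = normc (1 - a^* * z) - 0 by rewrite subr0.
have E : normc (a^* * z) = normc a * normc z.
  by rewrite normcM; congr (_ * _); case: a {Da Da'} => x y; rewrite /normc /= sqrrN.
have := ler_dist_normc 1 (a^* * z); rewrite E normc1 subr0 => H.
apply: le_trans H; apply: le_trans (ler_norm _).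
by have := normc_ge0 a; have := normc_ge0 z; nra.
Qed.

Lemma measurable_green (a : R[i]) (s : R) :
  measurable_fun DD (fun w : mR * mR => green_disk (ptC w) a `^ s).
Proof.
apply: measurable_powR_comp; apply: (measurableT_comp (@measurable_ln R)).
rewrite (_ : (fun w : mR * mR => _) =
   (fun w : mR * mR => normc (1 - a^* * ptC w) * (normc (ptC w - a)) `^ (-1))); last first.
  by apply/funext => w; rewrite normcM normcV powR_inv1 // normc_ge0.
have mD : measurable DD by exact: measurable_disk.
apply: measurable_funM.
  apply: (@cca_measurable R DD (fun z => 1 - a^* * z)) => // w _.
  rewrite (_ : (fun z => _) = (fun z => 1 + (- a^*) * z)); first exact: cca_affine.
  by apply/funext => z; rewrite mulNr.
apply: measurable_powR_comp; apply: (@cca_measurable R DD (fun z => z - a)) => // w _.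
rewrite (_ : (fun z => _) = (fun z => - a + 1 * z)); first exact: cca_affine.
by apply/funext => z; rewrite mul1r addrC.
Qed.

Lemma measurable_dnorm f : Hol_disk f ->
  measurable_fun DD (fun w : mR * mR => normc (C_deriv f (ptC w)) ^+ 2).
Proof.
move=> Hf; apply: measurable_funX; apply: cca_measurable; first exact: measurable_disk.
move=> w Dw; have Dw' : normc (ptC w) < 1 by [].
apply: (@cca_deriv _ f _ (ptC w) ((1 - normc (ptC w)) / 4)); first by rewrite divr_gt0 // subr_gt0.
move=> z /csq_disk hz; apply: Hol_is_cd => //.
by apply: le_lt_trans (hz ((1 + normc (ptC w)) / 2) _) _; lra.
Qed.

Lemma dist_ge (a z : R[i]) (t : R) : normc (z - a) <= t -> normc a - t <= normc z <= normc a + t.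
Proof.
move=> h; have := ler_dist_normc z a; rewrite ler_norml => /andP[h1 h2].
by apply/andP; split; lra.
Qed.

(** The numerator is at least 1 - |a|, which is at least four times the denominator. *)
Lemma green_lower (a z : R[i]) : unit_disk a -> z != a ->
  normc (z - a) <= (1 - normc a) / 4 -> ln 4 <= green_disk z a.
Proof.
move=> Da za h; have Da' : normc a < 1 by [].
have Dz : unit_disk z by have /andP[_ h2] := dist_ge h; apply: le_lt_trans h2 _; lra.
have n0 : 0 < normc (z - a) by rewrite normc_gt0 subr_eq0.
rewrite /green_disk ler_ln ?posrE //.
  rewrite normcM normcV ler_pdivlMr //; apply: le_trans (normc_conjM_lt Da Dz); lra.
rewrite normcM normcV divr_gt0 //; apply: lt_le_trans (normc_conjM_lt Da Dz); lra.
Qed.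

Lemma area_ge0 (D : set (mR * mR)) (u : mR * mR -> \bar R) :
  (forall w, D w -> (0 <= u w)%E) -> (0 <= area D u)%E.
Proof. by move=> u0; exact: integral_ge0. Qed.

(** Meant for the pole: [green_disk] takes the value 0 there by convention, so the lower bound ln 4
    fails at that single point. *)
Lemma area_point_le (D : set (mR * mR)) (u v : mR * mR -> \bar R) (c : mR * mR) :
  measurable D -> measurable_fun D u -> measurable_fun D v ->
  (forall w, D w -> (0 <= u w)%E) -> (forall w, D w -> (0 <= v w)%E) ->
  (forall w, D w -> w != c -> (u w <= v w)%E) -> (area D u <= area D v)%E.
Proof.
move=> mD mu mv u0 v0 uv; apply: ae_ge0_le_integral => //.
exists [set c]; split.
- rewrite (_ : [set c] = [set c.1] `*` [set c.2]); first by apply: measurableX; exact: measurable_set1.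
  by apply/seteqP; split => [w ->//|[x y] [/= -> ->]]; case: c {uv}.
- rewrite (_ : [set c] = [set c.1] `*` [set c.2]); last first.
    by apply/seteqP; split => [w ->//|[x y] [/= -> ->]]; case: c {uv}.
  apply: etrans; first by apply: product_measure1E; exact: measurable_set1.
  by rewrite /= !lebesgue_measure_set1 mul0e.
- move=> w /= h; apply/eqP/negPn/negP => wc; apply: h => Dw; exact: uv.
Qed.

(** For given [a] only the member of the supremum with pole [a] is used: near [a] the Green weight
    is at least (ln 4)^s, so the energy of a square of size comparable to 1 - |a| is bounded, and
    [sq_mean] converts it into a bound at [a]. *)
Lemma Q_Bloch (s : R) f : 0 <= s -> Q_space s f -> Hol_disk f /\
  exists C : R, 0 <= C /\ forall a, unit_disk a -> normc (C_deriv f a) * (1 - normc a) <= C.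
Proof.
move=> s0 [Hf]; set S := (X in ereal_sup X) => supS; split => //.
have h0 (a z : R[i]) : 0 <= normc (C_deriv f z) ^+ 2 * green_disk z a `^ s.
  by rewrite mulr_ge0 ?powR_ge0 // sqr_ge0.
have mD : measurable DD by exact: measurable_disk.
pose G a (w : mR * mR) := (normc (C_deriv f (ptC w)) ^+ 2 * green_disk (ptC w) a `^ s)%:E.
have mG a : measurable_fun DD (G a).
  apply/measurable_EFinP; apply: measurable_funM; first exact: measurable_dnorm.
  exact: measurable_green.
have G0 a w : (0 <= G a w)%E by rewrite lee_fin h0.
have [M M0 HM] : exists2 M : R, 0 <= M & forall a, unit_disk a -> (area DD (G a) <= M%:E)%E.
  have le_sup a : unit_disk a -> ((pi^-1)%:E * area DD (G a) <= ereal_sup S)%E.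
    by move=> Da; apply: ereal_sup_ubound; exists a.
  have sup0 : (0 <= ereal_sup S)%E.
    apply: le_trans (le_sup 0 _); last by rewrite /unit_disk /= normc0.
    by rewrite mule_ge0 ?area_ge0 // lee_fin invr_ge0 pi_ge0.
  have [M M0 ME] := ge0_lty_real sup0 supS.
  exists (pi * M); first by rewrite mulr_ge0 // pi_ge0.
  move=> a Da; have := le_sup a Da; rewrite ME => H.
  have p0 : (0 <= (pi : R)%:E)%E by rewrite lee_fin pi_ge0.
  have := lee_wpmul2l p0 H.
  by rewrite muleA -!EFinM divff ?gt_eqF ?pi_gt0 // mul1e.
pose k := ln (4 : R) `^ s.
have k0 : 0 < k by apply: powR_gt0; apply: ln_gt0; lra.
(* 256 is the constant of [sq_mean]; 64 is 8^2, from the half-side [rho] = (1-|a|)/8, which keeps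
   the square inside the range of [green_lower]. *)
pose C2 := 256 * 64 * (M / k).
have C20 : 0 <= C2 by rewrite mulr_ge0 ?ler0n ?divr_ge0 // ltW.
exists (Num.sqrt C2); split => [|a Da]; first exact: sqrtr_ge0.
have Da' : normc a < 1 by [].
pose rho := (1 - normc a) / 8.
have rho0 : 0 < rho by rewrite divr_gt0 // subr_gt0.
have ar : normc a + 2 * rho < 1 by rewrite /rho; lra.
have sm := sq_mean (fun z Dz => Hol_is_cd Hf Dz) rho0 ar.
have sD := sqr_disk ar.
have mS := measurable_sqr a rho.
have loc : (area (sqr a rho) (fun w => (normc (C_deriv f (ptC w)) ^+ 2)%:E) <= (M / k)%:E)%E.
  apply: (@le_trans _ _ (area (sqr a rho) (fun w => (k^-1)%:E * G a w)%E)).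
    apply: (@area_point_le _ _ _ (Re a, Im a)) => //.
    - apply/measurable_EFinP; exact: (measurable_funS mD sD (measurable_dnorm Hf)).
    - by apply: measurable_funeM; exact: (measurable_funS mD sD (mG a)).
    - by move=> w _; rewrite lee_fin sqr_ge0.
    - by move=> w _; apply: mule_ge0 => //; rewrite lee_fin invr_ge0 ltW.
    - move=> w /sqrP hw wa; rewrite -EFinM lee_fin mulrCA mulrC ler_peMl ?sqr_ge0 //.
      rewrite mulrC ler_pdivlMr // mul1r.
      have wna : ptC w != a.
        by apply: contraNneq wa => <-; rewrite -surjective_pairing.
      apply: ge0_ler_powR; rewrite ?nnegrE //; first by rewrite ln_ge0 //; lra.
        by apply: le_trans (green_lower Da wna _); [rewrite ln_ge0 //; lra|have := csq_normc hw; rewrite /rho; lra].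
      by apply: green_lower => //; have := csq_normc hw; rewrite /rho; lra.
  apply: (@le_trans _ _ (area DD (fun w => (k^-1)%:E * G a w)%E)).
    apply: area_le => //.
    - by apply: measurable_funeM; exact: (measurable_funS mD sD (mG a)).
    - exact: measurable_funeM.
    - by move=> w _; rewrite lexx andbT; apply: mule_ge0 => //; rewrite lee_fin invr_ge0 ltW.
    - by move=> w _; apply: mule_ge0 => //; rewrite lee_fin invr_ge0 ltW.
  rewrite areaZl ?invr_ge0 ?(ltW k0) // mulrC EFinM.
  by apply: lee_wpmul2l; [rewrite lee_fin invr_ge0 ltW|exact: HM].
have h256 : (0 <= 256%:E :> \bar R)%E by rewrite lee_fin ler0n.
have := le_trans sm (lee_wpmul2l h256 loc); rewrite -EFinM lee_fin => B.
have C1 : (normc (C_deriv f a) * (1 - normc a)) ^+ 2 <= C2.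
  have -> : 1 - normc a = 8 * rho by rewrite /rho; field.
  by move: B; rewrite /C2 !exprMn; lra.
rewrite -[leLHS]ger0_norm -?sqrtr_sqr; first exact: ler_wsqrtr.
by rewrite mulr_ge0 ?normc_ge0 // subr_ge0 ltW.
Qed.

End space_growth.


(** * Growth along dyadic shells from bounds on the derivative *)

Section radial_growth.
Context (R : realType).
Implicit Types (f F : R[i] -> R[i]).
Local Notation mR := (measurableTypeR R).
Local Notation DD := [set w : mR * mR | unit_disk (ptC w)].
Local Notation dy k := ((2 : R) ^- k).

Lemma dy_gt0 k : 0 < dy k.
Proof. by rewrite invr_gt0 exprn_gt0. Qed.

Lemma dyS k : dy k.+1 = dy k / 2.
Proof. by rewrite exprSr invfM. Qed.

Lemma dy_le1 k : dy k <= 1.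
Proof. by rewrite invf_le1 ?exprn_gt0 // exprn_ege1 // ler1n. Qed.

Lemma dy_mul k : 2 ^+ k * dy k = 1.
Proof. by rewrite mulfV // expf_neq0. Qed.

Lemma dy_le j k : (j <= k)%N -> dy k <= dy j.
Proof. by move=> jk; rewrite lef_pV2 ?posrE ?exprn_gt0 // ler_eXn2l // ltr1n. Qed.

Lemma radial_seg (l t : R) (z : R[i]) :
  l%:C * z + t%:C * (z - l%:C * z) = (l + t * (1 - l))%:C * z.
Proof.
by case: z => p q; apply/eqP; rewrite eq_complex /=; apply/andP; split; apply/eqP; ring.
Qed.

Lemma radial_sub (l : R) (z : R[i]) : z - l%:C * z = (1 - l)%:C * z.
Proof.
by case: z => p q; apply/eqP; rewrite eq_complex /=; apply/andP; split; apply/eqP; ring.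
Qed.

(** From a point of shell [m] one moves along its ray to the inner circle of the shell, over a
    distance of at most 2^-m / 2; the factor 2 of [mvi] then makes the cost exactly [b m]. *)
Lemma radial_growth f (f' : R[i] -> R[i]) (b : nat -> R) :
  (forall z, unit_disk z -> is_cd f z (f' z)) -> (forall k, 0 <= b k) ->
  (forall k c, 1 - dy k <= normc c <= 1 - dy k.+1 -> normc (f' c) <= 2 ^+ k * b k) ->
  forall m z, normc z <= 1 - dy m -> normc (f z) <= normc (f 0) + \sum_(k < m) b k.
Proof.
move=> Hf b0 Hb; elim=> [|m IH] z.
  rewrite expr0 invr1 subrr big_ord0 addr0 => z0.
  have /eqP : normc z = 0 by apply/eqP; rewrite eq_le z0 normc_ge0.
  by rewrite normc_eq0 => /eqP ->.
move=> hz; rewrite big_ord_recr /= addrA.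
have [zm|zm] := leP (normc z) (1 - dy m).
  by apply: le_trans (IH z zm) _; rewrite lerDl.
have dm0 := dy_gt0 m; have dm1 := dy_le1 m; have dmS := dyS m.
have z0 : 0 < normc z by apply: le_lt_trans zm; rewrite subr_ge0.
pose l := (1 - dy m) / normc z.
have l0 : 0 <= l by rewrite divr_ge0 ?subr_ge0 // ltW.
have l1 : l <= 1 by rewrite ler_pdivrMr // mul1r ltW.
have lz : l * normc z = 1 - dy m by rewrite /l mulfVK // gt_eqF.
pose y := l%:C * z.
have ny : normc y = 1 - dy m by rewrite normcM normc_real ger0_norm.
have seg t : y + t%:C * (z - y) = (l + t * (1 - l))%:C * z.
  exact: radial_seg.
have nseg t : 0 <= t <= 1 -> 1 - dy m <= normc (y + t%:C * (z - y)) <= 1 - dy m.+1.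
  move=> /andP[t0 t1]; rewrite seg normcM normc_real ger0_norm; last by nra.
  by apply/andP; split; nra.
have := @mvi R f f' y (z - y) (2 ^+ m * b m).
have zyE : normc (z - y) = normc z - (1 - dy m).
  rewrite /y radial_sub.
  by rewrite normcM normc_real ger0_norm ?subr_ge0 // mulrBl mul1r lz.
have -> : y + (z - y) = z by rewrite addrC subrK.
move=> /(_ _ _)H; have {}H : normc (f z - f y) <= 2 * (2 ^+ m * b m) * normc (z - y).
  apply: H => t /nseg ht; last exact: Hb.
  apply: Hf; rewrite /unit_disk /=; apply: le_lt_trans (_ : 1 - dy m.+1 < 1).
    by have /andP[] := ht.
  by rewrite ltrBlDr ltrDl dy_gt0.
have -> : f z = f y + (f z - f y) by rewrite addrC subrK.
apply: le_trans (le_normcD _ _) _; apply: lerD.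
  by apply: IH; rewrite ny.
apply: le_trans H _; rewrite zyE.
have e1 := dy_mul m.
apply: (@le_trans _ _ (2 * (2 ^+ m * b m) * (dy m / 2))).
  by rewrite ler_wpM2l //; [rewrite mulr_ge0 // mulr_ge0 // exprn_ge0|rewrite -dmS; lra].
have -> : 2 * (2 ^+ m * b m) * (dy m / 2) = 2 ^+ m * dy m * b m by field; rewrite expf_neq0.
by rewrite e1 mul1r.
Qed.

(** On shell k one has 1 - |c| >= 2^-(k+1), so |f'| <= 2^k (2 C): every shell costs the same, which
    is logarithmic growth in 1/(1-|z|). *)
Lemma Bloch_growth f (C : R) : Hol_disk f -> 0 <= C ->
  (forall a, unit_disk a -> normc (C_deriv f a) * (1 - normc a) <= C) ->
  forall m z, normc z <= 1 - dy m -> normc (f z) <= normc (f 0) + m%:R * (2 * C).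
Proof.
move=> Hf C0 HC m z hz.
have b0 (k : nat) : 0 <= 2 * C by rewrite mulr_ge0.
have bb (k : nat) c : 1 - dy k <= normc c <= 1 - dy k.+1 -> normc (C_deriv f c) <= 2 ^+ k * (2 * C).
  move=> /andP[_ h]; have d0 := dy_gt0 k.+1.
  have Dc : unit_disk c by apply: le_lt_trans h _; rewrite ltrBlDr ltrDl.
  have := HC c Dc; rewrite -ler_pdivlMr; last by rewrite subr_gt0.
  move=> /le_trans; apply.
  have -> : 2 ^+ k * (2 * C) = C / dy k.+1 by rewrite invrK exprSr; ring.
  rewrite ler_wpM2l // lef_pV2 ?posrE //; first by clear b0; lra.
  by rewrite subr_gt0.
have := radial_growth (fun z Dz => Hol_is_cd Hf Dz) b0 bb hz.
by rewrite sumr_const card_ord -[2 * C *+ m]mulr_natl.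
Qed.

Lemma sum_sqr_le (m : nat) (y : nat -> R) :
  (\sum_(k < m) y k) ^+ 2 <= m%:R * \sum_(k < m) y k ^+ 2.
Proof.
elim: m => [|m IH]; first by rewrite !big_ord0 expr0n mulr0.
rewrite !big_ord_recr /= -natr1.
move: IH; set S := \sum_(k < m) y k; set Q := \sum_(k < m) y k ^+ 2 => IH.
have Q0 : 0 <= Q by apply: sumr_ge0 => k _; exact: sqr_ge0.
have m0 : (0 : R) <= m%:R by [].
have [M0|Mn0] := eqVneq (m%:R : R) 0.
  have S0 : S = 0 by apply/eqP; rewrite -sqrf_eq0 eq_le sqr_ge0 (le_trans IH) // M0 mul0r.
  by rewrite S0 M0 !add0r mul1r lerDr.
have {m0 Mn0} m0 : (0 : R) < m%:R by rewrite lt_def Mn0 m0.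
suff : 2 * S * y m <= Q + m%:R * y m ^+ 2 by move: IH; lra.
rewrite -(ler_pM2l m0); have := sqr_ge0 (S - m%:R * y m); move: IH; nra.
Qed.

(** With [T] the tail energies, a square centred in shell k lies between tails k and k + 4. The
    differences overlap, but the sum still telescopes down to four initial terms. *)
Lemma telescope4 (T : nat -> R) n m : (forall k, 0 <= T k) -> (forall k, T k.+1 <= T k) ->
  \sum_(k < m) (T (n + k)%N - T (n + k + 4)%N) <= 4 * T n.
Proof.
move=> T0 TS.
have E : \sum_(k < m) (T (n + k)%N - T (n + k + 4)%N) =
   (T n + T n.+1 + T n.+2 + T n.+3) - (T (n + m)%N + T (n + m).+1 + T (n + m).+2 + T (n + m).+3).
  elim: m => [|m IH]; first by rewrite big_ord0 addn0 subrr.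
  by rewrite big_ord_recr /= IH !addnS addn0; ring.
rewrite E; have := TS n; have := TS n.+1; have := TS n.+2.
have := T0 (n + m)%N; have := T0 (n + m).+1; have := T0 (n + m).+2; have := T0 (n + m).+3; lra.
Qed.

Lemma area_setD (A B : set (mR * mR)) (u : mR * mR -> \bar R) :
  measurable A -> measurable B -> A `<=` B -> measurable_fun B u -> (forall w, (0 <= u w)%E) ->
  (area B u = area A u + area (B `\` A) u)%E.
Proof.
move=> mA mB AB mu u0; rewrite -{1}(setDUK AB); apply: ge0_integral_setU => //.
- exact: measurableD.
- by rewrite setDUK.
- by apply/disj_setPS => w [h []].
Qed.

(* Cauchy-Schwarz over dyadic shells: the energy of the outer shells tends to zero, which
   improves the trivial O(m) to o(m). *)
Lemma Dirichlet_growth f : dirichlet_space f -> Hol_disk f /\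
  forall e : R, 0 < e -> exists C : R, forall m z, normc z <= 1 - dy m -> normc (f z) ^+ 2 <= C + e * m%:R.
Proof.
move=> [Hf]; move/(disk_integral_lty (h := fun z => normc (C_deriv f z) ^+ 2)) => AI; split => //.
have {}AI := AI (fun z _ => sqr_ge0 _).
have mD : measurable DD by exact: measurable_disk.
pose u (w : mR * mR) := (normc (C_deriv f (ptC w)) ^+ 2)%:E.
have mu : measurable_fun DD u by apply/measurable_EFinP; exact: measurable_dnorm.
have u0 w : (0 <= u w)%E by rewrite lee_fin sqr_ge0.
pose E k := DD `&` [set w : mR * mR | 1 - normc (ptC w) <= 2 * dy k].
have mnorm := @measurable_normc R.
have mlev (c : R) : measurable [set w : mR * mR | normc (ptC w) < c].
  rewrite [X in measurable X](_ : _ = [set: mR * mR] `&` (fun w => normc (ptC w)) @^-1` `]-oo, c[).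
    by apply: mnorm => //; exact: measurable_itv.
  by rewrite setTI; apply/seteqP; split=> w; rewrite /= in_itv.
have mle (c : R) : measurable [set w : mR * mR | c <= normc (ptC w)].
  rewrite [X in measurable X](_ : _ = ~` [set w : mR * mR | normc (ptC w) < c]); first exact: measurableC.
  by apply/seteqP; split=> w /=; rewrite leNgt => /negP.
have mE k : measurable (E k).
  apply: measurableI => //; rewrite [X in measurable X](_ : _ = [set w : mR * mR | 1 - 2 * dy k <= normc (ptC w)]) //.
  by apply/seteqP; split=> w /=; lra.
have ED k : E k `<=` DD by move=> w [].
have Eoo k : (area (E k) u < +oo)%E.
  by apply: le_lt_trans AI; apply: ge0_subset_integral => //; move=> w _; exact: u0.
have /choice[T HT] k : exists r : R, 0 <= r /\ area (E k) u = r%:E.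
  by have [r r0 rE] := ge0_lty_real (area_ge0 (fun w _ => u0 w)) (Eoo k); exists r.
have T0 k : 0 <= T k by have [] := HT k.
have TE k : area (E k) u = (T k)%:E by have [] := HT k.
have Esub k l : (k <= l)%N -> E l `<=` E k.
  move=> kl w [Dw /= h]; split => //=; apply: le_trans h _.
  by rewrite ler_pM2l // dy_le.
have TS k : T k.+1 <= T k.
  rewrite -lee_fin -!TE; apply: ge0_subset_integral => //.
  - exact: (measurable_funS mD (ED k)).
  - apply: Esub; exact: leqnSn.
(* [sq_mean] gives |f'| rho <= 16 times the square root of the local energy, and [rho] = 2^-k / 8
   supplies the remaining factor 8. *)
pose b k := 128 * Num.sqrt (T k - T (k + 4)%N).
have T4 k : T (k + 4)%N <= T k by rewrite !addnS addn0; do 4 (apply: le_trans (TS _) _ => //).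
have b0 k : 0 <= b k by rewrite mulr_ge0 // sqrtr_ge0.
have bk k c : 1 - dy k <= normc c <= 1 - dy k.+1 -> normc (C_deriv f c) <= 2 ^+ k * b k.
  move=> /andP[c1 c2]; have dk0 := dy_gt0 k; have dkS := dyS k.
  pose rho := dy k / 8.
  have rho0 : 0 < rho by rewrite divr_gt0.
  have crho : normc c + 2 * rho < 1 by rewrite /rho; lra.
  have sm := sq_mean (fun z Dz => Hol_is_cd Hf Dz) rho0 crho.
  have mS := measurable_sqr c rho.
  (* Points of the square have 1 - |w| between 2^-k / 4 and 5/4 times 2^-k; tail k reaches up to 2
     times 2^-k, and tail k + 4 only up to 2^-k / 8. *)
  have sub : sqr c rho `<=` E k `\` E (k + 4)%N.
    move=> w /sqrP hw; have Dw : DD w by apply: (sqr_disk crho); apply/sqrP.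
    have /andP[w1 w2] := dist_ge (csq_normc hw).
    split; first by split => //=; move: w1; rewrite /rho; lra.
    case=> _ /=; rewrite exprD invfM => w3.
    have e16 : ((2 : R) ^+ 4)^-1 = 16^-1 by congr (_^-1); ring.
    by move: w2 w3; rewrite e16 /rho; lra.
  have mdiff : measurable (E k `\` E (k + 4)%N) by exact: measurableD.
  have dif : (area (E k `\` E (k + 4)%N) u <= (T k - T (k + 4)%N)%:E)%E.
    have dec : (area (E k) u = area (E (k + 4)%N) u + area (E k `\` E (k + 4)%N) u)%E.
      apply: area_setD => //; first by apply: Esub; rewrite leq_addr.
      exact: (measurable_funS mD (ED k)).
    rewrite EFinB -TE -TE dec TE.
    by rewrite addeAC subee // add0e.
  have loc : (area (sqr c rho) u <= (T k - T (k + 4)%N)%:E)%E.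
    apply: le_trans dif; apply: ge0_subset_integral => //.
      by apply: measurable_funS mu => //; move=> w [/ED].
  have h256 : (0 <= 256%:E :> \bar R)%E by rewrite lee_fin ler0n.
  have := le_trans sm (lee_wpmul2l h256 loc); rewrite -EFinM lee_fin => B.
  have {}B : (normc (C_deriv f c) * rho) ^+ 2 <= 16 ^+ 2 * (T k - T (k + 4)%N).
    by rewrite exprMn; lra.
  have {}B : normc (C_deriv f c) * rho <= 16 * Num.sqrt (T k - T (k + 4)%N).
    rewrite -[leLHS]ger0_norm -?sqrtr_sqr; last by rewrite mulr_ge0 ?normc_ge0 // ltW.
    rewrite -[16]ger0_norm // -sqrtr_sqr -sqrtrM ?sqr_ge0 //.
    exact: ler_wsqrtr.
  rewrite -(ler_pM2r rho0); apply: le_trans B _.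
  rewrite /b /rho; have e1 := dy_mul k.
  have -> : 2 ^+ k * (128 * Num.sqrt (T k - T (k + 4)%N)) * (dy k / 8) =
    (2 ^+ k * dy k) * (16 * Num.sqrt (T k - T (k + 4)%N)) by field; rewrite expf_neq0.
  by rewrite e1 mul1r.
(* The complements of the tails exhaust the disk; by monotone convergence they cannot all miss
   energy at least [e]. *)
have Tlim (e : R) : 0 < e -> exists n, T n <= e.
  move=> e0; have [A A0 AE] := ge0_lty_real (area_ge0 (fun w _ => u0 w)) AI.
  pose V n := DD `\` E n.
  have mV n : measurable (V n) by exact: measurableD.
  have ndV : nondecreasing_seq V.
    move=> n m nm; apply/subsetPset => w [Dw nE]; split => // Em; apply: nE; exact: Esub nm _ Em.
  have UV : \bigcup_n V n = DD.
    apply/seteqP; split => [w [n _ []//]|w Dw].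
    have Dw' : 0 < 1 - normc (ptC w) by rewrite subr_gt0.
    have [n _ Hn] := near_infty_natSinv_expn_lt (PosNum (divr_gt0 Dw' (@ltr0Sn R 1))).
    have {Hn} /= := Hn n (leqnn n); rewrite div1r => Hn.
    by exists n => //; split => //; case=> _ /=; lra.
  have cv := @ge0_nondecreasing_set_cvg_integral _ _ R V u ((@lebesgue_measure R) \x (@lebesgue_measure R))%E ndV mV
    (fun n => measurable_funS mD (@subDsetl _ _ _) mu) (fun n w _ => u0 w).
  rewrite UV in cv.
  apply: contrapT => /forallNP N.
  have VA n : (area (V n) u <= (A - e)%:E)%E.
    have dec : (area DD u = area (E n) u + area (V n) u)%E.
      exact: area_setD.
    have nT := N n; have {}nT : e <= T n by rewrite ltW // ltNge; apply/negP.
    have V0 := area_ge0 (D := V n) (fun w _ => u0 w).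
    have Voo : (area (V n) u < +oo)%E.
      by apply: le_lt_trans AI; apply: ge0_subset_integral => //; move=> w [].
    have [v v0 vE] := ge0_lty_real V0 Voo.
    have AT : A = T n + v by apply: EFin_inj; rewrite EFinD -vE -TE -AE.
    rewrite vE.
    by rewrite lee_fin AT; lra.
  have cV : (fun n => area (V n) u) @ \oo --> area DD u by exact: cv.
  have L : limn (fun n => area (V n) u) = area DD u by apply: cvg_lim.
  have : (limn (fun n => area (V n) u) <= (A - e)%:E)%E.
    apply: lime_le; first by apply/cvg_ex; exists (area DD u).
    by apply: nearW => n; exact: VA.
  rewrite L.
  by rewrite AE lee_fin; lra.
move=> e e0.
have [n Tn] := Tlim (e / (2 * 128 ^+ 2 * 4)) ltac:(by rewrite divr_gt0 // mulr_gt0 // mulr_gt0 // exprn_gt0).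
pose C0 := normc (f 0) + \sum_(k < n) b k.
have C00 : 0 <= C0 by rewrite addr_ge0 ?normc_ge0 // sumr_ge0.
exists (2 * C0 ^+ 2) => m z hz.
(* The radius is enlarged to 1 - 2^-(n+m), so that the sum splits into [n] fixed shells, absorbed in
   [C0], and exactly [m] shells of small total energy. *)
have hz' : normc z <= 1 - dy (n + m)%N.
  by apply: le_trans hz _; rewrite lerD2l lerN2 dy_le // leq_addl.
have G := radial_growth (fun z Dz => Hol_is_cd Hf Dz) b0 bk hz'.
rewrite big_split_ord /= addrA -/C0 in G.
pose y k := 128 * Num.sqrt (T (n + k)%N - T (n + k + 4)%N).
have cs := sum_sqr_le m y.
have sq : \sum_(k < m) y k ^+ 2 <= 128 ^+ 2 * (4 * T n).
  rewrite (eq_bigr (fun k : 'I_m => 128 ^+ 2 * (T (n + k)%N - T (n + k + 4)%N))); last first.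
    by move=> k _; rewrite exprMn sqr_sqrtr // subr_ge0.
  by rewrite -mulr_sumr ler_pM2l ?exprn_gt0 //; exact: telescope4.
set S := \sum_(k < m) y k in cs.
have {}G : normc (f z) <= C0 + S by exact: G.
have S0 : 0 <= S by apply: sumr_ge0 => k _; exact: (b0 (n + k)%N).
have : normc (f z) ^+ 2 <= (C0 + S) ^+ 2.
  by apply: lerXn2r; rewrite ?nnegrE ?normc_ge0 // addr_ge0.
move=> /le_trans; apply.
apply: (@le_trans _ _ (2 * C0 ^+ 2 + 2 * S ^+ 2)); first by have := sqr_ge0 (C0 - S); nra.
rewrite lerD2l.
have : m%:R * (\sum_(k < m) y k ^+ 2) <= m%:R * (128 ^+ 2 * (4 * T n)) by rewrite ler_wpM2l.
have m0 : (0 : R) <= m%:R by [].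
have : m%:R * (128 ^+ 2 * (4 * T n)) <= m%:R * (e / 2).
  rewrite ler_wpM2l //; have -> : e / 2 = 128 ^+ 2 * (4 * (e / (2 * 128 ^+ 2 * 4))) by field.
  by rewrite ler_pM2l ?exprn_gt0 // ler_pM2l.
by move=> h1 h2; have := le_trans cs (le_trans h2 h1); lra.
Qed.

End radial_growth.


(** * Areas of thin annuli, and the sufficiency of the growth conditions *)

Section area_series.
Context (R : realType).
Local Notation mR := (measurableTypeR R).
Local Notation leb := (@lebesgue_measure R).
Local Notation DD := [set w : mR * mR | unit_disk (ptC w)].
Local Notation dy k := ((2 : R) ^- k).

Lemma area_le_series (D : set (mR * mR)) (u : mR * mR -> \bar R) (v : nat -> mR * mR -> \bar R)
    (e : nat -> R) (S : R) :
  measurable D -> measurable_fun D u -> (forall w, D w -> (0 <= u w)%E) ->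
  (forall k, measurable_fun D (v k)) -> (forall k w, (0 <= v k w)%E) ->
  (forall w, D w -> (u w <= \sum_(0 <= k <oo) v k w)%E) ->
  (forall k, (area D (v k) <= (e k)%:E)%E) ->
  (forall n, \sum_(k < n) e k <= S) -> (area D u <= S%:E)%E.
Proof.
move=> mD mu u0 mv v0 uv ve eS.
apply: (@le_trans _ _ (area D (fun w => \sum_(0 <= k <oo) v k w)%E)).
  apply: ge0_le_integral => //; exact: ge0_emeasurable_sum.
rewrite /area integral_nneseries //.
apply: lime_le.
  by apply: is_cvg_nneseries => n _ _; exact: integral_ge0.
apply: nearW => n; apply: (@le_trans _ _ (\sum_(0 <= k < n) (e k)%:E)%E).
  by apply: lee_sum => k _; exact: ve.
by rewrite sumEFin lee_fin big_mkord.
Qed.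

Lemma nneseries_ge_term (v : nat -> \bar R) k : (forall k, (0 <= v k)%E) ->
  (v k <= \sum_(0 <= i <oo) v i)%E.
Proof.
move=> v0; apply: le_trans (nneseries_lim_ge k.+1 (fun n _ _ => v0 n)).
by rewrite big_nat_recr //= leeDr // sume_ge0.
Qed.

Lemma area_series (D : set (mR * mR)) (u : mR * mR -> \bar R) (E : nat -> set (mR * mR))
    (c d : nat -> R) (S : R) :
  measurable D -> measurable_fun D u -> (forall w, D w -> (0 <= u w)%E) ->
  (forall k, measurable (E k)) -> (forall k, E k `<=` D) -> (forall k, 0 <= c k) ->
  (forall w, D w -> exists2 k, E k w & (u w <= (c k)%:E)%E) ->
  (forall k, (((leb \x leb) (E k)) <= (d k)%:E)%E) ->
  (forall n, \sum_(k < n) c k * d k <= S) -> (area D u <= S%:E)%E.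
Proof.
move=> mD mu u0 mE ED c0 cov Ed cdS.
pose v k (w : mR * mR) : \bar R := ((c k)%:E * (\1_(E k) w)%:E)%E.
have mv k : measurable_fun D (v k).
  by apply: measurable_funeM; apply/measurable_EFinP; exact: measurable_indic.
have v0 k w : (0 <= v k w)%E by rewrite mule_ge0 // lee_fin.
apply: (@area_le_series D u v (fun k => c k * d k)) => //.
- move=> w /cov[k Ekw ukw]; apply: le_trans ukw _.
  apply: le_trans (nneseries_ge_term k (fun k => v0 k w)).
  by rewrite /v indicE mem_set // mule1.
- move=> k; rewrite /v areaZl //.
    rewrite EFinM; apply: lee_wpmul2l; first by rewrite lee_fin.
    rewrite /area integral_indic // setIidl //; exact: Ed.
  by apply/measurable_EFinP; exact: measurable_indic.
Qed.

(** The part of the annulus 1 - eta <= |w|^2 <= 1 at distance at least 1/2 from the horizontal axis,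
    where vertical lines cross it transversally. *)
Definition annX (eta : R) : set (mR * mR) :=
  [set w | [/\ `|w.1| <= 1, 1 / 4 <= w.2 ^+ 2, 1 - eta <= w.1 ^+ 2 + w.2 ^+ 2 & w.1 ^+ 2 + w.2 ^+ 2 <= 1]].

Lemma integral_indicT (I : set mR) : measurable I -> (\int[leb]_y (\1_I y)%:E = leb I)%E.
Proof. by move=> mI; rewrite integral_indic //; congr (lebesgue_measure _); exact: setIT. Qed.

(** On the slice y^2 ranges over [A, B] with A >= 1/4 and B - A <= eta. Since the two square roots
    add up to at least 1, they differ by at most eta; the two signs of y give 2 eta. *)
Lemma annX_slice (eta t : R) : 0 < eta -> measurable (annX eta) ->
  (\int[leb]_y (\1_(annX eta) (t, y))%:E <= (2 * eta)%:E * (\1_`[(-1)%R, 1%R] t)%:E)%E.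
Proof.
move=> eta0 mX.
have mind : measurable_fun [set: mR * mR] (fun w => (\1_(annX eta) w)%:E : \bar R).
  by apply/measurable_EFinP; exact: measurable_indic.
have [t1|t1] := boolP (`|t| <= 1); last first.
  rewrite (eq_integral (cst 0%E)) ?integral0; last first.
    by move=> y _; rewrite indicE memNset // => -[/=]; rewrite (negbTE t1).
  by rewrite mule_ge0 // lee_fin // mulr_ge0 // ltW.
have -> : \1_`[(-1)%R, 1%R] t = 1 :> R by rewrite indicE mem_set //= in_itv /= -ler_norml.
rewrite mule1.
pose A := Num.max (1 / 4) (1 - eta - t ^+ 2); pose B := 1 - t ^+ 2.
have [BA|AB] := ltP B A.
  rewrite (eq_integral (cst 0%E)) ?integral0; last first.
    move=> y _; rewrite indicE memNset // => -[/= _ h1 h2 h3].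
    move: BA; rewrite /A /B lt_max => /orP[]; lra.
  by rewrite lee_fin mulr_ge0 // ltW.
have A4 : 1 / 4 <= A by rewrite le_max lexx.
have sA : 1 / 2 <= Num.sqrt A.
  have -> : 1 / 2 = Num.sqrt ((1 / 2) ^+ 2) :> R by rewrite sqrtr_sqr ger0_norm //; lra.
  by apply: ler_wsqrtr; apply: le_trans A4; lra.
have sAB : Num.sqrt A <= Num.sqrt B by exact: ler_wsqrtr.
have A0 : 0 <= A by apply: le_trans A4; lra.
have B0 : 0 <= B by exact: le_trans AB.
have dAB : Num.sqrt B - Num.sqrt A <= eta.
  have := sqr_sqrtr A0; have := sqr_sqrtr B0.
  have : B - A <= eta by rewrite lerBlDr /B -lerBlDl le_max; apply/orP; right; lra.
  nra.
pose I1 := `[Num.sqrt A, Num.sqrt B]%classic; pose I2 := `[- Num.sqrt B, - Num.sqrt A]%classic.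
have mI1 : measurable_fun [set: mR] (fun y => (\1_I1 y)%:E : \bar R).
  by apply/measurable_EFinP; apply: measurable_indic; exact: measurable_itv.
have mI2 : measurable_fun [set: mR] (fun y => (\1_I2 y)%:E : \bar R).
  by apply/measurable_EFinP; apply: measurable_indic; exact: measurable_itv.
apply: (@le_trans _ _ (\int[leb]_y ((\1_I1 y)%:E + (\1_I2 y)%:E))%E).
  apply: ge0_le_integral => //.
  - exact: (measurableT_comp mind (pair1_measurable t)).
  - exact: emeasurable_funD.
  - move=> y _; rewrite -EFinD lee_fin.
    have [/set_mem[_ /= h1 h2 h3]|h] := boolP ((t, y) \in annX eta); last first.
      by rewrite indicE (negbTE h) addr_ge0.
    rewrite indicE mem_set //.
    have Ay : A <= y ^+ 2 by rewrite ge_max; apply/andP; split; lra.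
    have yB : y ^+ 2 <= B by rewrite /B; lra.
    have [y0|y0] := leP 0 y.
      have I1y : I1 y.
        rewrite /I1 /= in_itv /= -(ger0_norm y0) -sqrtr_sqr.
        by rewrite !ler_wsqrtr.
      by rewrite indicE mem_set // lerDl.
    have I2y : I2 y.
      rewrite /I2 /= in_itv /= -[y]opprK !lerN2 -(ltr0_norm y0) -sqrtr_sqr.
      by rewrite !ler_wsqrtr.
    by rewrite [X in _ + X]indicE mem_set // lerDr.
rewrite ge0_integralD //.
rewrite !integral_indicT; [|exact: measurable_itv|exact: measurable_itv].
rewrite /I1 /I2 /= !lebesgue_measure_itv /= !lte_fin.
have h : 0 <= eta by exact: ltW.
case: ifPn => _; case: ifPn => _; rewrite -?EFinB -?EFinD ?adde0 ?add0e lee_fin; lra.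
Qed.

Lemma measurable_sqradd : measurable_fun [set: mR * mR] (fun w : mR * mR => w.1 ^+ 2 + w.2 ^+ 2).
Proof.
by apply: measurable_funD; apply: measurable_funX; [exact: measurable_fst|exact: measurable_snd].
Qed.

Lemma normc_ptC_sqr (w : mR * mR) : normc (ptC w) ^+ 2 = w.1 ^+ 2 + w.2 ^+ 2.
Proof. by rewrite /normc /= sqr_sqrtr // addr_ge0 ?sqr_ge0. Qed.


Lemma measurable_annX (eta : R) : measurable (annX eta).
Proof.
have mf : measurable_fun [set: mR * mR] (fun w : mR * mR => w.1) by exact: measurable_fst.
have ms : measurable_fun [set: mR * mR] (fun w : mR * mR => w.2 ^+ 2).
  by apply: measurable_funX; exact: measurable_snd.
rewrite [X in measurable X](_ : _ = ([set: mR * mR] `&` (fun w : mR * mR => w.1) @^-1` `[-1, 1])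
  `&` (([set: mR * mR] `&` (fun w : mR * mR => w.2 ^+ 2) @^-1` `[1 / 4, +oo[)
  `&` ([set: mR * mR] `&` (fun w : mR * mR => w.1 ^+ 2 + w.2 ^+ 2) @^-1` `[1 - eta, 1]))).
  apply: measurableI; first by apply: mf => //; exact: measurable_itv.
  apply: measurableI; first by apply: ms => //; exact: measurable_itv.
  by apply: measurable_sqradd => //; exact: measurable_itv.
apply/seteqP; split=> w /=; rewrite !in_itv /= !andbT -ler_norml.
  by case=> ? ? ? ?; do !split => //; apply/andP.
by case=> -[_ ?] [[_ ?] [_ /andP[? ?]]].
Qed.

Lemma measurable_level (c : R) : measurable [set w : mR * mR | 1 - normc (ptC w) <= c].
Proof.
rewrite [X in measurable X](_ : _ = [set: mR * mR] `&` (fun w : mR * mR => 1 - normc (ptC w)) @^-1` `]-oo, c]).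
  have mf : measurable_fun [set: mR * mR] (fun w : mR * mR => 1 - normc (ptC w)).
    by apply: measurable_funB => //; exact: measurable_normc.
  by apply: mf => //; exact: measurable_itv.
by rewrite setTI; apply/seteqP; split=> w; rewrite /= in_itv.
Qed.

(** Polar coordinates are avoided: for small [eta] a point of the annulus has |y| >= 1/2 or |x| >=
    1/2, so [annX] and its mirror image cover it and Fubini integrates the slices. For [eta] at
    least 1/16 the trivial area 4 is good enough. *)
Lemma annulus_measure (eta : R) : 0 < eta ->
  ((leb \x leb) (DD `&` [set w : mR * mR | (1 - normc (ptC w) <= eta)%R]) <= (64 * eta)%:E)%E.
Proof.
move=> eta0; set V := DD `&` _.
have mV : measurable V.
  by apply: measurableI; [exact: measurable_disk|exact: measurable_level].
have VE : ((leb \x leb) V = area V (fun=> 1%E))%E by rewrite /area integral_cst // mul1e.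
rewrite VE.
have [big|small] := leP (1 / 16) eta.
  apply: (@le_trans _ _ (area DD (fun=> 1%E))).
    apply: ge0_subset_integral => //; [exact: measurable_disk|by move=> w []].
  by apply: le_trans (area_disk_cst ler01) _; rewrite lee_fin; lra.
pose X := annX (2 * eta).
have mX : measurable X by exact: measurable_annX.
pose Y (w : mR * mR) := X (w.2, w.1).
pose iX (w : mR * mR) : \bar R := (\1_X w)%:E.
pose iY (w : mR * mR) : \bar R := (\1_X (w.2, w.1))%:E.
have miX : measurable_fun [set: mR * mR] iX by apply/measurable_EFinP; exact: measurable_indic.
have miY : measurable_fun [set: mR * mR] iY.
  have msw : measurable_fun [set: mR * mR] (fun w : mR * mR => (w.2, w.1)).
    by apply: measurable_fun_pair; [exact: measurable_snd|exact: measurable_fst].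
  exact: (measurableT_comp miX msw).
have eta20 : 0 < 2 * eta by lra.
have half : (\int[leb]_x ((2 * (2 * eta))%:E * (\1_`[(-1)%R, 1%R] x)%:E) <= (8 * eta)%:E)%E.
  rewrite ge0_integralZl_EFin //; last 2 first.
  - by apply/measurable_EFinP; apply: measurable_indic; exact: measurable_itv.
  - by lra.
  rewrite integral_indicT; last exact: measurable_itv.
  rewrite /= lebesgue_measure_itv /= lte_fin ifT; last by lra.
  by rewrite -EFinB -EFinM lee_fin; lra.
have mI : measurable_fun [set: mR] (fun x => ((2 * (2 * eta))%:E * (\1_`[(-1)%R, 1%R] x)%:E)%E).
  by apply: measurable_funeM; apply/measurable_EFinP; apply: measurable_indic; exact: measurable_itv.
have HX : (area [set: mR * mR] iX <= (8 * eta)%:E)%E.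
  rewrite /area fubini_tonelli1 //; last by move=> w; rewrite lee_fin.
  apply: le_trans half; apply: ge0_le_integral => //.
  - by move=> x _; apply: integral_ge0 => y _; rewrite lee_fin.
  - by apply: measurable_fun_fubini_tonelli_F => // w; rewrite lee_fin.
  - by move=> x _; exact: annX_slice.
have HY : (area [set: mR * mR] iY <= (8 * eta)%:E)%E.
  rewrite /area fubini_tonelli2 //; last by move=> w; rewrite lee_fin.
  apply: le_trans half; apply: ge0_le_integral => //.
  - by move=> x _; apply: integral_ge0 => y _; rewrite lee_fin.
  - by apply: measurable_fun_fubini_tonelli_G => // w; rewrite lee_fin.
  - by move=> x _; exact: annX_slice.
have XY0 w : (0 <= iX w + iY w)%E by rewrite -EFinD lee_fin addr_ge0.
apply: (@le_trans _ _ (area [set: mR * mR] (fun w => iX w + iY w)%E)).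
  apply: area_le => //.
  - exact: emeasurable_funD.
  - move=> w [Dw /= hw]; rewrite lee_fin ler01 /= -EFinD lee_fin.
    have Dw' : normc (ptC w) < 1 by [].
    have n0 := normc_ge0 (ptC w).
    have up : w.1 ^+ 2 + w.2 ^+ 2 <= 1 by rewrite -normc_ptC_sqr expr_le1 // ltW.
    have lo : 1 - 2 * eta <= w.1 ^+ 2 + w.2 ^+ 2 by rewrite -normc_ptC_sqr; nra.
    have a1 : `|w.1| <= 1 by apply: le_trans (normc_Re (ptC w)) (ltW Dw').
    have a2 : `|w.2| <= 1 by apply: le_trans (normc_Im (ptC w)) (ltW Dw').
    have [h|h] := leP (1 / 4) (w.2 ^+ 2).
      by rewrite indicE mem_set ?lerDl.
    by rewrite [X in _ + X]indicE mem_set ?lerDr //; split => //=; lra.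
rewrite areaD //; [|by move=> w _; rewrite lee_fin|by move=> w _; rewrite lee_fin].
by apply: le_trans (leeD HX HY) _; rewrite -EFinD lee_fin; lra.
Qed.

Lemma geo_sum_le (q : R) n : 0 <= q -> (\sum_(k < n) q ^+ k) * (1 - q) = 1 - q ^+ n.
Proof.
move=> q0; elim: n => [|n IH]; first by rewrite big_ord0 mul0r expr0 subrr.
by rewrite big_ord_recr /= mulrDl IH exprS; ring.
Qed.

(* Dyadic shells: on [2^-k <= 1 - |z| <= 2^(1-k)] the integrand is at most [K q^k] with
   [q < 2], while the shell has area O(2^-k). *)
Lemma disk_dyadic_lty (u : mR * mR -> R) (K q : R) : measurable_fun DD u ->
  (forall w, DD w -> 0 <= u w) -> 0 <= K -> 0 <= q -> q < 2 ->
  (forall k w, DD w -> dy k <= 1 - normc (ptC w) <= 2 * dy k -> u w <= K * q ^+ k) ->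
  (area DD (fun w => (u w)%:E) < +oo)%E.
Proof.
move=> mu u0 K0 q0 q2 uK.
pose E k := DD `&` [set w : mR * mR | 1 - normc (ptC w) <= 2 * dy k].
have mD : measurable DD by exact: measurable_disk.
have mE k : measurable (E k).
  by apply: measurableI => //; exact: measurable_level.
have q20 : 0 <= q / 2 by lra.
apply: (@le_lt_trans _ _ (128 * K / (1 - q / 2))%:E); last exact: ltry.
apply: (@area_series DD _ E (fun k => K * q ^+ k) (fun k => 64 * (2 * dy k))) => //.
- exact/measurable_EFinP.
- by move=> k w [].
- by move=> k; rewrite mulr_ge0 // exprn_ge0.
- move=> w Dw; have Dw' : 0 < 1 - normc (ptC w) by rewrite subr_gt0.
  have ex : exists n, dy n <= 1 - normc (ptC w).
    have [n _ Hn] := near_infty_natSinv_expn_lt (PosNum Dw').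
    by have {Hn} /= := Hn n (leqnn n); rewrite div1r => /ltW; exists n.
  have [k hk kmin] := ex_minnP ex.
  have up : 1 - normc (ptC w) <= 2 * dy k.
    case: k hk kmin => [|k] hk kmin.
      by rewrite expr0 invr1; have := normc_ge0 (ptC w); lra.
    rewrite leNgt; apply/negP => h.
    have : dy k <= 1 - normc (ptC w) by have := dyS R k; lra.
    by move/kmin; rewrite ltnn.
  by exists k; [split|rewrite lee_fin; apply: uK => //; rewrite hk].
- by move=> k; apply: annulus_measure; have := dy_gt0 R k; lra.
- move=> n.
  rewrite (eq_bigr (fun k : 'I_n => 128 * K * (q / 2) ^+ k)); last first.
    by move=> k _; rewrite expr_div_n; ring.
  rewrite -mulr_sumr ler_wpM2l ?mulr_ge0 //.
  have q1 : 0 < 1 - q / 2 by lra.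
  rewrite -[leRHS]mul1r ler_pdivlMr // mulrC.
  by rewrite mulrC geo_sum_le // lerBlDr lerDl exprn_ge0.
Qed.

(** Shell k carries the weight 2^(-alpha k) and the factor e^(p e k), against an area 2^-k. As alpha
    > -1, 2^(-alpha) < 2, which leaves room for a small positive [e]. *)
Lemma superposition_bergman (phi f : R[i] -> R[i]) (p alpha : R) : entire phi -> Hol_disk f ->
  0 < p -> -1 < alpha ->
  (forall e : R, 0 < e -> exists C : R, forall k z, normc z <= 1 - dy k ->
     normc (phi (f z)) <= expR (C + e * k%:R)) ->
  bergman_space p alpha (superposition phi f).
Proof.
move=> hphi Hf p0 a1 H.
have HF : Hol_disk (superposition phi f).
  move=> z Dz; apply: is_cd_C_derivable.
  apply: (@is_cd_comp R f phi z (C_deriv f z) (C_deriv phi (f z))); first exact: Hol_is_cd.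
  by apply/C_derivableP; exact: hphi.
split => //.
apply/(disk_integral_lty (h := fun z => (1 - normc z ^+ 2) `^ alpha * normc (superposition phi f z) `^ p)).
  by move=> z _; rewrite mulr_ge0 ?powR_ge0.
pose om := (2 : R) `^ (- alpha).
have om0 : 0 < om by exact: powR_gt0.
have om2 : om < 2.
  rewrite /om /powR gt_eqF // -[ltRHS](@lnK R) ?posrE // ltr_expR.
  by have : 0 < ln (2 : R) by [apply: ln_gt0; lra]; nra.
(* Chosen so that e^(p e) is the square root of 2 / [om]; then [q] is the square root of 2 [om],
   still below 2. *)
pose e := ln (2 / om) / 2 / p.
have e0 : 0 < e by rewrite divr_gt0 // divr_gt0 // ln_gt0 // ltr_pdivlMr // mul1r.
have [C HC] := H e e0.
(* For alpha >= 0 the bound 1 - |z|^2 <= 4 times 2^-k is used, which costs 4^alpha; for alpha < 0, 1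
   - |z|^2 >= 2^-k costs nothing, and 4 to the power |alpha| covers both. *)
pose K := 4 `^ `|alpha| * expR (p * C).
pose q := om * expR (p * e).
have q0 : 0 <= q by rewrite mulr_ge0 ?expR_ge0 // ltW.
have q2 : q < 2.
  rewrite /q mulrC -ltr_pdivlMr // -[ltRHS](@lnK R) ?posrE ?divr_gt0 // ltr_expR.
  have -> : p * e = ln (2 / om) / 2 by rewrite /e; field; exact: lt0r_neq0.
  have : 0 < ln (2 / om) by rewrite ln_gt0 // ltr_pdivlMr // mul1r.
  lra.
apply: (@disk_dyadic_lty (fun w => (1 - normc (ptC w) ^+ 2) `^ alpha * normc (superposition phi f (ptC w)) `^ p) K q) => //.
- by apply: measurable_funM; [exact: measurable_weight|apply: measurable_powR_comp; exact: measurable_Hol].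
- by move=> w _; rewrite mulr_ge0 ?powR_ge0.
- by rewrite mulr_ge0 ?powR_ge0 // expR_ge0.
move=> k w Dw /andP[w1 w2].
have Dw' : normc (ptC w) < 1 by [].
have n0 := normc_ge0 (ptC w).
have dk0 := dy_gt0 R k.
set x := normc (ptC w) in w1 w2 Dw' n0 *.
have -> : K * q ^+ k = (4 `^ `|alpha| * om ^+ k) * (expR (p * C) * expR (p * e) ^+ k).
  by rewrite /K /q exprMn; ring.
have omk : om ^+ k = (dy k) `^ alpha.
  rewrite -powR_mulrn ?(ltW om0) // /om -powRrM -powR_invn // -powRrM.
  by congr (_ `^ _); ring.
have x2 : x ^+ 2 <= x by rewrite expr2; nra.
apply: ler_pM; rewrite ?powR_ge0 //.
  rewrite omk.
  have [a0|a0] := leP 0 alpha.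
    rewrite ger0_norm // -powRM ?(ltW dk0) //.
    by apply: ge0_ler_powR; rewrite // ?nnegrE; nra.
  rewrite -[leLHS]mul1r; apply: ler_pM; rewrite ?powR_ge0 //.
    by rewrite -[X in X <= _](powRr0 4); apply: ler_powR; rewrite ?normr_ge0 // ler1n.
  have [b b0 ->] : exists2 b, 0 <= b & alpha = - b by exists (- alpha); [rewrite oppr_ge0 ltW|rewrite opprK].
  have y0 : 0 < 1 - x ^+ 2 by lra.
  rewrite !powRN lef_pV2 ?posrE ?powR_gt0 //.
  by apply: ge0_ler_powR; rewrite ?nnegrE; nra.
have h : normc (superposition phi f (ptC w)) <= expR (C + e * k%:R) by apply: HC; rewrite -/x; lra.
apply: (@le_trans _ _ (expR (C + e * k%:R) `^ p)).
  by apply: ge0_ler_powR; rewrite ?nnegrE ?normc_ge0 ?expR_ge0 // ltW.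
rewrite /powR gt_eqF ?expR_gt0 // expRK -expRM_natl -expRD ler_expR.
by rewrite le_eqVlt; apply/orP; left; apply/eqP; rewrite -mulr_natl; ring.
Qed.

Lemma Dirichlet_sufficient (phi f : R[i] -> R[i]) (p alpha A B : R) : entire phi ->
  0 < p -> -1 < alpha -> 0 < B -> (forall w, normc (phi w) <= expR (A + B * normc w ^+ 2)) ->
  dirichlet_space f -> bergman_space p alpha (superposition phi f).
Proof.
move=> hphi p0 a1 B0 HB /Dirichlet_growth[Hf G].
apply: superposition_bergman => // e e0.
have [C HC] := G (e / B) (divr_gt0 e0 B0).
exists (A + B * C) => k z /HC h.
apply: le_trans (HB _) _; rewrite ler_expR -addrA lerD2l.
apply: le_trans (ler_wpM2l (ltW B0) h) _.
rewrite le_eqVlt; apply/orP; left; apply/eqP; field; exact: lt0r_neq0.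
Qed.

Lemma Q_sufficient (phi f : R[i] -> R[i]) (s p alpha : R) : entire phi ->
  0 < p -> -1 < alpha -> 0 <= s ->
  (forall e : R, 0 < e -> exists A : R, forall w, normc (phi w) <= expR (A + e * normc w)) ->
  Q_space s f -> bergman_space p alpha (superposition phi f).
Proof.
move=> hphi p0 a1 s0 HB /(Q_Bloch s0)[Hf [C [C0 HC]]].
apply: superposition_bergman => // e e0.
have K0 : 0 < 2 * C + 1 by lra.
have [A HA] := HB (e / (2 * C + 1)) (divr_gt0 e0 K0).
exists (A + e / (2 * C + 1) * normc (f 0)) => k z hz.
have h := Bloch_growth Hf C0 HC hz.
apply: le_trans (HA _) _; rewrite ler_expR -addrA lerD2l.
have c0 : 0 <= e / (2 * C + 1) by rewrite divr_ge0 // ltW.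
apply: le_trans (ler_wpM2l c0 h) _; rewrite mulrDr lerD2l.
have -> : e * k%:R = e / (2 * C + 1) * (k%:R * (2 * C + 1)) by field; exact: lt0r_neq0.
by rewrite ler_wpM2l // ler_wpM2l // lerDl.
Qed.

End area_series.


(** * The test functions and their derivatives *)

Section csum.
Context (R : realType).
Implicit Types (u v : nat -> R[i]).
Local Notation dy k := ((2 : R) ^- k).

(** A total operation. It is used only for geometrically dominated terms, where [csum_tail] gives a
    rate of convergence and [csum_unique] turns such a rate into an identification of the sum. *)
Definition csum u : R[i] :=
  (limn (series (fun k => Re (u k)))) +i* (limn (series (fun k => Im (u k)))).

Lemma exists_pow_le (M q e : R) : 0 <= q -> q < 1 -> 0 < e -> exists n : nat, M * q ^+ n <= e.
Proof.
move=> q0 q1 e0.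
have cv : (fun n => q ^+ n) @ \oo --> (0 : R) by apply: cvg_expr; rewrite ger0_norm.
have M0 : 0 < `|M| + 1 by rewrite ltr_wpDl.
have /cvgrPdist_le/(_ (e / (`|M| + 1))) := cv; rewrite divr_gt0 // => /(_ isT)[n _ Hn].
exists n; have := Hn n (leqnn n); rewrite /= sub0r normrN ger0_norm ?exprn_ge0 // => h.
apply: (@le_trans _ _ ((`|M| + 1) * q ^+ n)).
  by rewrite ler_wpM2r ?exprn_ge0 // (le_trans (ler_norm M)) // lerDl.
by rewrite mulrC -ler_pdivlMr.
Qed.

Lemma le_of_pow (a b M q : R) : 0 <= q -> q < 1 -> (forall n : nat, a <= b + M * q ^+ n) -> a <= b.
Proof.
move=> q0 q1 H; apply/ler_addgt0Pr => e e0.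
have [n hn] := exists_pow_le M q0 q1 e0.
by apply: le_trans (H n) _; rewrite lerD2l.
Qed.

Lemma geo_tail (u : nat -> R) (M q : R) : 0 <= q -> q < 1 -> (forall k, `|u k| <= M * q ^+ k) ->
  forall n, `|limn (series u) - \sum_(k < n) u k| <= M / (1 - q) * q ^+ n.
Proof.
move=> q0 q1 H n.
have M0 : 0 <= M by have := H 0%N; rewrite expr0 mulr1; apply: le_trans.
have cvu : cvgn (series u).
  apply: normed_cvg; apply: (@series_le_cvg _ _ (geometric M q)) => [k|k|k|] /=.
  - by rewrite normr_ge0.
  - by rewrite mulr_ge0 // exprn_ge0.
  - exact: H.
  - by apply: is_cvg_geometric_series; rewrite ger0_norm.
have part m : (n <= m)%N -> `|series u m - \sum_(k < n) u k| <= M / (1 - q) * q ^+ n.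
  move=> nm; rewrite /series /= -(big_mkord xpredT u) (big_cat_nat (leq0n n) nm) //= addrAC subrr add0r.
  apply: le_trans (ler_norm_sum _ _ _) _.
  apply: (@le_trans _ _ (\sum_(n <= k < m) M * q ^+ k)); first by apply: ler_sum => k _; exact: H.
  rewrite -{1}[n]add0n big_addn big_mkord.
  rewrite (eq_bigr (fun k : 'I_(m - n) => M * q ^+ n * q ^+ k)); last first.
    by move=> k _; rewrite addnC exprD mulrA.
  rewrite -mulr_sumr.
  have -> : M / (1 - q) * q ^+ n = M * q ^+ n * (1 - q)^-1 by ring.
  rewrite ler_wpM2l ?mulr_ge0 ?exprn_ge0 //.
  have q10 : 0 < 1 - q by rewrite subr_gt0.
  by rewrite -[leRHS]mul1r ler_pdivlMr // geo_sum_le // lerBlDr lerDl exprn_ge0.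
have cvd : (fun m => `|series u m - \sum_(k < n) u k|) @ \oo --> `|limn (series u) - \sum_(k < n) u k|.
  by apply: cvg_norm; apply: cvgB; [exact: cvu|exact: cvg_cst].
rewrite -(cvg_lim _ cvd) //; apply: limr_le; first by apply/cvg_ex; eexists; exact: cvd.
by exists n => // m /= nm; exact: part.
Qed.

Definition geo_bounded u (M q : R) := forall k, normc (u k) <= M * q ^+ k.

Lemma csum_tail u (M q : R) : 0 <= q -> q < 1 -> geo_bounded u M q ->
  forall n, normc (csum u - \sum_(k < n) u k) <= 2 * (M / (1 - q)) * q ^+ n.
Proof.
move=> q0 q1 H n; apply: le_trans (normc_le_ReIm _) _.
have -> : 2 * (M / (1 - q)) * q ^+ n = M / (1 - q) * q ^+ n + M / (1 - q) * q ^+ n by ring.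
apply: lerD.
  have -> : Re (csum u - \sum_(k < n) u k) = limn (series (fun k => Re (u k))) - \sum_(k < n) Re (u k).
    by rewrite raddfB raddf_sum.
  by apply: geo_tail => // k; exact: le_trans (normc_Re _) (H k).
have -> : Im (csum u - \sum_(k < n) u k) = limn (series (fun k => Im (u k))) - \sum_(k < n) Im (u k).
  by rewrite raddfB raddf_sum.
by apply: geo_tail => // k; exact: le_trans (normc_Im _) (H k).
Qed.

Lemma csum_le u (M q X : R) : 0 <= q -> q < 1 -> geo_bounded u M q ->
  (forall n : nat, \sum_(k < n) normc (u k) <= X) -> normc (csum u) <= X.
Proof.
move=> q0 q1 H HX; apply: (@le_of_pow _ _ (2 * (M / (1 - q))) q) => // n.
rewrite -[csum u](subrK (\sum_(k < n) u k)); apply: le_trans (le_normcD _ _) _.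
rewrite addrC; apply: lerD; last exact: csum_tail.
apply: le_trans (HX n); elim: n => [|n IH]; first by rewrite !big_ord0 normc0.
by rewrite !big_ord_recr /=; apply: le_trans (le_normcD _ _) _; rewrite lerD2r.
Qed.

Lemma csum_unique u (M q : R) (S : R[i]) (K : R) : 0 <= q -> q < 1 -> geo_bounded u M q ->
  (forall n : nat, normc (S - \sum_(k < n) u k) <= K * q ^+ n) -> csum u = S.
Proof.
move=> q0 q1 H HS; apply/eqP; rewrite -subr_eq0 -normc_eq0 eq_le normc_ge0 andbT.
apply: (@le_of_pow _ _ (2 * (M / (1 - q)) + K) q) => // n; rewrite add0r.
have -> : csum u - S = (csum u - \sum_(k < n) u k) - (S - \sum_(k < n) u k) by ring.
apply: le_trans (le_normcD _ _) _; rewrite normcN mulrDl; apply: lerD; last exact: HS.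
exact: csum_tail.
Qed.

Lemma csumB u v (M N q : R) : 0 <= q -> q < 1 -> geo_bounded u M q -> geo_bounded v N q ->
  csum (fun k => u k - v k) = csum u - csum v.
Proof.
move=> q0 q1 Hu Hv.
apply: (@csum_unique _ (M + N) q _ (2 * (M / (1 - q)) + 2 * (N / (1 - q)))) => //.
  move=> k; apply: le_trans (le_normcD _ _) _; rewrite normcN mulrDl; exact: lerD.
move=> n; rewrite big_split /= sumrN.
have -> : csum u - csum v - (\sum_(k < n) u k - \sum_(k < n) v k) =
  (csum u - \sum_(k < n) u k) - (csum v - \sum_(k < n) v k) by ring.
apply: le_trans (le_normcD _ _) _; rewrite normcN mulrDl; apply: lerD; exact: csum_tail.
Qed.

Lemma csumZ (a : R[i]) u (M q : R) : 0 <= q -> q < 1 -> geo_bounded u M q ->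
  csum (fun k => a * u k) = a * csum u.
Proof.
move=> q0 q1 Hu.
apply: (@csum_unique _ (normc a * M) q _ (normc a * (2 * (M / (1 - q))))) => //.
  by move=> k; rewrite normcM -mulrA ler_wpM2l ?normc_ge0.
move=> n; rewrite -mulr_sumr -mulrBr normcM -mulrA ler_wpM2l ?normc_ge0 //.
exact: csum_tail.
Qed.

Definition tden (k : nat) (z : R[i]) : R[i] := (1 + dy k)%:C - z.

Definition tf (c : nat -> R[i]) (z : R[i]) : R[i] := csum (fun k => c k * (dy k)%:C / tden k z).

Definition tf' (c : nat -> R[i]) (z : R[i]) : R[i] := csum (fun k => c k * (dy k)%:C / tden k z ^+ 2).

Lemma tden_ge k (z : R[i]) : 1 - normc z <= normc (tden k z).
Proof.
have d0 := dy_gt0 R k.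
have := ler_dist_normc (1 + dy k)%:C z; rewrite -/(tden k z) normc_real [`|1 + _|]ger0_norm; last by lra.
by rewrite ler_norml => /andP[_ h]; lra.
Qed.

(** Since Re (1 - z) >= 0, adding 2^-k does not shrink 1 - z: the denominator dominates both |1 - z|
    and 2^-k, hence half their sum. *)
Lemma tden_ge2 k (z : R[i]) : unit_disk z -> normc (1 - z) + dy k <= 2 * normc (tden k z).
Proof.
move=> Dz; have Dz' : normc z < 1 by []. have d0 := dy_gt0 R k.
have R1 : 0 <= Re (1 - z).
  by rewrite raddfB /= subr_ge0; apply: le_trans (ler_norm _) (le_trans (normc_Re z) (ltW Dz')).
have E : tden k z = (1 - z) + (dy k)%:C.
  by rewrite /tden rmorphD rmorph1 addrAC.
have s1 : dy k <= normc (tden k z).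
  apply: le_trans (normc_Re _); rewrite E raddfD /= ger0_norm; first by rewrite lerDr.
  by rewrite addr_ge0 // ltW.
suff s2 : normc (1 - z) <= normc (tden k z) by lra.
rewrite E; move: R1; case: (1 - z) => x y /= x0; rewrite /normc /= addr0; apply: ler_wsqrtr.
by rewrite lerD2r; nra.
Qed.

(** Any ratio strictly between 1 and 2 would serve: bounded and polynomially growing coefficients
    are covered, and multiplication by 2^-k still leaves the summable ratio 3/4. *)
Definition tadm (B : R) (c : nat -> R[i]) := forall k, normc (c k) <= B * (3 / 2) ^+ k.

Lemma tterm (B : R) (c : nat -> R[i]) k : tadm B c ->
  normc (c k * (dy k)%:C) <= B * (3 / 4) ^+ k.
Proof.
move=> H; rewrite normcM normc_real ger0_norm; last by rewrite ltW // dy_gt0.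
have -> : B * (3 / 4) ^+ k = B * (3 / 2) ^+ k * dy k.
  by rewrite -exprVn -mulrA -exprMn; congr (_ * _ ^+ _); field.
by rewrite ler_wpM2r // ltW // dy_gt0.
Qed.

Lemma tterm_div (B : R) (c : nat -> R[i]) k (w : R[i]) (X : R) : tadm B c -> 0 < X ->
  X <= normc w -> normc (c k * (dy k)%:C / w) <= B / X * (3 / 4) ^+ k.
Proof.
move=> H X0 Xw; rewrite normcM normcV.
have -> : B / X * (3 / 4) ^+ k = B * (3 / 4) ^+ k * X^-1 by ring.
apply: ler_pM; rewrite ?normc_ge0 ?invr_ge0 ?normc_ge0 //; first exact: tterm.
by rewrite lef_pV2 ?posrE // (lt_le_trans X0).
Qed.

Let q0 : 0 <= (3 / 4 : R). Proof. by lra. Qed.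
Let q1 : (3 / 4 : R) < 1. Proof. by lra. Qed.

Lemma tf_bounded (B : R) (c : nat -> R[i]) (z : R[i]) : tadm B c -> unit_disk z ->
  geo_bounded (fun k => c k * (dy k)%:C / tden k z) (B / (1 - normc z)) (3 / 4).
Proof.
move=> H Dz k; apply: tterm_div => //; first by rewrite subr_gt0.
exact: tden_ge.
Qed.

Lemma tf'_bounded (B : R) (c : nat -> R[i]) (z : R[i]) : tadm B c -> unit_disk z ->
  geo_bounded (fun k => c k * (dy k)%:C / tden k z ^+ 2) (B / (1 - normc z) ^+ 2) (3 / 4).
Proof.
move=> H Dz k; have Dz' : 0 < 1 - normc z by rewrite subr_gt0.
apply: tterm_div => //; first by rewrite exprn_gt0.
rewrite expr2 normcM -expr2; apply: lerXn2r; rewrite ?nnegrE ?normc_ge0 ?(ltW Dz') //.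
exact: tden_ge.
Qed.

Lemma tden_neq0 k (z : R[i]) : unit_disk z -> tden k z != 0.
Proof.
move=> Dz; rewrite -normc_gt0; apply: lt_le_trans (tden_ge k z).
by rewrite subr_gt0.
Qed.

(** Termwise, 1/(D-h) - 1/D - h/D^2 = h^2 / (D^2 (D-h)). Linearity of [csum] pulls out h^2, and the
    remaining series is bounded uniformly for small [h]. *)
Lemma is_cd_tf (B : R) (c : nat -> R[i]) (z : R[i]) : tadm B c -> unit_disk z ->
  is_cd (tf c) z (tf' c z).
Proof.
move=> H Dz e e0; have Dz' : 0 < 1 - normc z by rewrite subr_gt0.
have B0 : 0 <= B by have := H 0%N; rewrite expr0 mulr1; apply: le_trans; exact: normc_ge0.
set x := 1 - normc z in Dz'.
pose K := B / (x ^+ 2 * (x / 2)).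
have K0 : 0 <= K by rewrite divr_ge0 // mulr_ge0 ?exprn_ge0 ?divr_ge0 // ltW.
exists (Num.min (x / 2) (e / (4 * K + 1))).
  by rewrite lt_min !divr_gt0 // ltr_wpDl // mulr_ge0.
move=> h; rewrite lt_min => /andP[hx he].
have z1 : normc z < 1 by [].
have Dzh : unit_disk (z + h).
  apply: le_lt_trans (le_normcD _ _) _; move: hx; rewrite /x; lra.
have xh : x / 2 <= 1 - normc (z + h).
  have := le_normcD z h; move: hx; rewrite /x; lra.
pose v k := c k * (dy k)%:C / (tden k z ^+ 2 * tden k (z + h)).
have bv : geo_bounded v K (3 / 4).
  move=> k; apply: tterm_div => //; first by rewrite mulr_gt0 ?exprn_gt0 ?divr_gt0.
  rewrite normcM expr2 normcM -expr2; apply: ler_pM; rewrite ?exprn_ge0 ?divr_ge0 ?(ltW Dz') //.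
    by apply: lerXn2r; rewrite ?nnegrE ?normc_ge0 ?(ltW Dz') //; exact: tden_ge.
  by apply: le_trans xh _; exact: tden_ge.
have E : tf c (z + h) - tf c z - tf' c z * h = h ^+ 2 * csum v.
  rewrite mulrC /tf /tf'.
  rewrite -(csumZ h q0 q1 (tf'_bounded H Dz)).
  rewrite -(csumB q0 q1 (tf_bounded H Dzh) (tf_bounded H Dz)).
  rewrite -(@csumB _ _ (B / (1 - normc (z + h)) + B / (1 - normc z)) (normc h * (B / (1 - normc z) ^+ 2)) (3 / 4)) //.
  - rewrite -(csumZ _ q0 q1 bv); congr csum; apply/funext => k; rewrite /v.
    have n1 := tden_neq0 k Dz; have n2 := tden_neq0 k Dzh.
    have Eh : tden k (z + h) = tden k z - h by rewrite /tden; ring.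
    rewrite Eh in n2 *; move: (c k * _) => t; by field; rewrite n1 n2.
  - move=> k; apply: le_trans (le_normcD _ _) _; rewrite normcN mulrDl.
    by apply: lerD; [exact: tf_bounded|exact: tf_bounded].
  - by move=> k; rewrite normcM -[leRHS]mulrA ler_wpM2l ?normc_ge0 //; exact: tf'_bounded.
rewrite E normcM expr2 normcM.
have bs : normc (csum v) <= 4 * K.
  apply: (csum_le q0 q1 bv) => n.
  apply: (@le_trans _ _ (\sum_(k < n) K * (3 / 4) ^+ k)); first by apply: ler_sum => k _; exact: bv.
  rewrite -mulr_sumr mulrC ler_wpM2r //.
  have := geo_sum_le n q0; have : 0 <= (3 / 4 : R) ^+ n by exact: exprn_ge0.
  lra.
have K40 : 0 < 4 * K + 1 by lra.
rewrite ltr_pdivlMr // in he.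
have := normc_ge0 h; have := normc_ge0 (csum v); nra.
Qed.

End csum.


(** * Scale-invariant majorants, and test functions in the Dirichlet space *)

Section membership.
Context (R : realType).
Local Notation mR := (measurableTypeR R).
Local Notation DD := [set w : mR * mR | unit_disk (ptC w)].
Local Notation dy k := ((2 : R) ^- k).

Definition dist (a : R[i]) (w : mR * mR) : R := normc (ptC w - a).

(** A majorant invariant under scaling: dilating the distance to [a] and [b] together only rescales
    the density, so its integral over the plane does not depend on [b]. The exponent [sigma] gives
    decay on both sides of the scale [b]. *)
Definition Phi (sigma b : R) (a : R[i]) (w : mR * mR) : R :=
  (Num.min (dist a w / b) (b / dist a w)) `^ sigma / dist a w ^+ 2.

Lemma measurable_dist a : measurable_fun [set: mR * mR] (dist a).
Proof.
apply: (@cca_measurable R setT (fun z => z - a)) => // w _.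
rewrite (_ : (fun z => _) = (fun z => - a + 1 * z)); first exact: cca_affine.
by apply/funext => z; rewrite mul1r addrC.
Qed.

Lemma dist_ge0 a w : 0 <= dist a w.
Proof. exact: normc_ge0. Qed.

Lemma measurable_invr (D : set (mR * mR)) (u : mR * mR -> R) :
  measurable_fun D u -> (forall w, 0 <= u w) -> measurable_fun D (fun w => (u w)^-1).
Proof.
move=> mu u0; rewrite (_ : (fun w => _) = (fun w => u w `^ (-1))).
  exact: measurable_powR_comp.
by apply/funext => w; rewrite powR_inv1.
Qed.

Lemma measurable_Phi sigma b a : measurable_fun [set: mR * mR] (Phi sigma b a).
Proof.
have md := measurable_dist a.
have mi := measurable_invr md (dist_ge0 a).
apply: measurable_funM; last first.
  by apply: measurable_invr; [exact: measurable_funX|move=> w; rewrite sqr_ge0].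
apply: measurable_powR_comp; apply: measurable_minr; first exact: measurable_funM.
exact: measurable_funM.
Qed.

Lemma Phi_ge0 sigma b a w : 0 <= Phi sigma b a w.
Proof. by rewrite divr_ge0 ?powR_ge0 // sqr_ge0. Qed.

Lemma dist_sqr a (w : mR * mR) (r : R) : dist a w <= r -> sqr a r w.
Proof. by move=> h; apply/sqrP; exact: normc_csq. Qed.

Lemma dyadic_between (x b : R) : 0 < x -> 0 < b ->
  (exists k : nat, dy k.+1 * b <= x <= dy k * b) \/ (exists k : nat, 2 ^+ k * b <= x <= 2 ^+ k.+1 * b).
Proof.
move=> x0 b0; have [xb|bx] := leP x b.
  left.
  have ex : exists n, dy n * b < x.
    have [n _ Hn] := near_infty_natSinv_expn_lt (PosNum (divr_gt0 x0 b0)).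
    by have {Hn} /= := Hn n (leqnn n); rewrite div1r ltr_pdivlMr //; exists n.
  have [[|k] hk kmin] := ex_minnP ex.
    by move: hk; rewrite expr0 invr1 mul1r ltNge xb.
  exists k; rewrite (ltW hk) /= leNgt; apply/negP => /kmin.
  by rewrite ltnn.
right.
have ex : exists n : nat, x <= 2 ^+ n * b.
  have [n _ Hn] := near_infty_natSinv_expn_lt (PosNum (divr_gt0 b0 x0)).
  exists n; have {Hn} /= := Hn n (leqnn n); rewrite div1r ltr_pdivlMr // mulrC => h.
  by rewrite mulrC -ler_pdivrMr ?exprn_gt0 // ltW.
have [[|k] hk kmin] := ex_minnP ex.
  by move: hk; rewrite expr0 mul1r leNgt bx.
exists k; rewrite hk andbT leNgt; apply/negP => /ltW/kmin.
by rewrite ltnn.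
Qed.

(** Dyadic rings inside and outside radius [b]: ring k has squared size cancelling the factor 1/d^2,
    and the power contributes 2^(-sigma k). The inner and the outer ring of index k each add 16
    q^k. *)
Lemma area_Phi (sigma : R) : 0 < sigma <= 1 -> exists2 C : R, 0 <= C & forall b a, 0 < b ->
  (area [set: mR * mR] (fun w => (Phi sigma b a w)%:E) <= C%:E)%E.
Proof.
move=> /andP[s0 s1].
pose q := (2 : R) `^ (- sigma).
have q0 : 0 < q by exact: powR_gt0.
have q1 : q < 1.
  by rewrite /q /powR gt_eqF // expR_lt1 mulNr oppr_lt0 mulr_gt0 // ln_gt0 //; lra.
have q1' : 0 < 1 - q by rewrite subr_gt0.
exists (32 / (1 - q)); first by rewrite divr_ge0 // ltW.
move=> b a b0.
have dyq k : (dy k) `^ sigma = q ^+ k.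
  apply/esym; rewrite -powR_mulrn ?(ltW q0) // /q -powRrM -powR_invn // -powRrM.
  by congr (_ `^ _); ring.
pose cI k := 4 * q ^+ k / (dy k * b) ^+ 2.
pose cO k := q ^+ k / (2 ^+ k * b) ^+ 2.
have cI0 k : 0 <= cI k by rewrite divr_ge0 ?sqr_ge0 // mulr_ge0 // exprn_ge0 // ltW.
have cO0 k : 0 <= cO k by rewrite divr_ge0 ?sqr_ge0 // exprn_ge0 // ltW.
pose v k (w : mR * mR) : \bar R := ((cI k)%:E * (\1_(sqr a (dy k * b)) w)%:E + (cO k)%:E * (\1_(sqr a (2 ^+ k.+1 * b)) w)%:E)%E.
have mind (r : R) : measurable_fun [set: mR * mR] (fun w => (\1_(sqr a r) w)%:E : \bar R).
  by apply/measurable_EFinP; apply: measurable_indic; exact: (measurable_sqr a r).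
have v1 (c r : R) : 0 <= c -> forall w, (0 <= c%:E * (\1_(sqr a r) w)%:E)%E.
  by move=> c0 w; rewrite mule_ge0 // lee_fin.
have v0 k w : (0 <= v k w)%E by rewrite adde_ge0 // v1.
have half (c r : R) : 0 <= c -> 0 < r ->
    (area [set: mR * mR] (fun w => c%:E * (\1_(sqr a r) w)%:E)%E = (c * (4 * r ^+ 2))%:E)%E.
  move=> c0 r0.
  have i0 (w : mR * mR) : [set: mR * mR] w -> (0 <= (\1_(sqr a r) w)%:E :> \bar R)%E by rewrite lee_fin.
  rewrite (areaZl measurableT (mind r) i0 c0).
  rewrite EFinM; congr (_ * _)%E.
  have -> : (4 * r ^+ 2)%:E = area (sqr a r) (fun=> 1%E) by rewrite area_sqr // mul1e.
  rewrite /area integral_cst ?mul1e; last exact: (measurable_sqr a r).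
  rewrite integral_indic //; last exact: (measurable_sqr a r).
  by congr (product_measure1 _ _ _); exact: setIT.
apply: (@area_le_series R setT _ v (fun k => 32 * q ^+ k)) => //.
- by apply/measurable_EFinP; exact: measurable_Phi.
- by move=> w _; rewrite lee_fin Phi_ge0.
- by move=> k; apply: emeasurable_funD; apply: measurable_funeM.
- move=> w _; set d := dist a w.
  have [d0|dn0] := eqVneq d 0.
    by rewrite /Phi -/d d0 expr0n /= invr0 mulr0; apply: nneseries_ge0.
  have {dn0} d0 : 0 < d by rewrite lt_def dn0 dist_ge0.
  have [[k /andP[k1 k2]]|[k /andP[k1 k2]]] := dyadic_between d0 b0.
    apply: le_trans (nneseries_ge_term k (fun k => v0 k w)).
    apply: (@le_trans _ _ ((cI k)%:E * (\1_(sqr a (dy k * b)) w)%:E)%E); last by rewrite leeDl // v1.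
    rewrite indicE mem_set; last exact: dist_sqr.
    rewrite mule1 lee_fin /Phi -/d /cI.
    have dk0 := dy_gt0 R k.
    have db0 : 0 < dy k * b by rewrite mulr_gt0.
    have -> : 4 * q ^+ k / (dy k * b) ^+ 2 = q ^+ k / (dy k.+1 * b) ^+ 2.
      by rewrite dyS; field; rewrite (lt0r_neq0 b0) expf_neq0.
    apply: ler_pM; rewrite ?powR_ge0 ?invr_ge0 ?sqr_ge0 //.
      rewrite -dyq; apply: ge0_ler_powR; rewrite ?nnegrE ?(ltW s0) ?(ltW dk0) //.
        by rewrite le_min !divr_ge0 // ltW.
      by rewrite ge_min ler_pdivrMr // k2.
    have dk1 := dy_gt0 R k.+1.
    rewrite lef_pV2 ?posrE ?exprn_gt0 ?mulr_gt0 //.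
    by apply: lerXn2r; rewrite ?nnegrE ?(ltW d0) // mulr_ge0 // ltW.
  apply: le_trans (nneseries_ge_term k (fun k => v0 k w)).
  apply: (@le_trans _ _ ((cO k)%:E * (\1_(sqr a (2 ^+ k.+1 * b)) w)%:E)%E); last by rewrite leeDr // v1.
  rewrite indicE mem_set; last exact: dist_sqr.
  rewrite mule1 lee_fin /Phi -/d /cO.
  have p0 : (0 : R) < 2 ^+ k by exact: exprn_gt0.
  apply: ler_pM; rewrite ?powR_ge0 ?invr_ge0 ?sqr_ge0 //.
    rewrite -dyq; apply: ge0_ler_powR; rewrite ?nnegrE ?(ltW s0) ?(ltW (dy_gt0 R k)) //.
      by rewrite le_min !divr_ge0 // ltW.
    rewrite ge_min; apply/orP; right.
    by rewrite ler_pdivrMr // mulrC ler_pdivlMr // mulrC.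
  rewrite lef_pV2 ?posrE ?exprn_gt0 ?mulr_gt0 //.
  by apply: lerXn2r; rewrite ?nnegrE ?(ltW d0) // mulr_ge0 // ltW.
- move=> k; have dk0 := dy_gt0 R k.
  have p0 : (0 : R) < 2 ^+ k by exact: exprn_gt0.
  have pS0 : (0 : R) < 2 ^+ k.+1 by exact: exprn_gt0.
  rewrite /v areaD //; [|by apply: measurable_funeM|by apply: measurable_funeM|by move=> w _; exact: v1|by move=> w _; exact: v1].
  rewrite !half //; [|exact: mulr_gt0|exact: mulr_gt0].
  rewrite -EFinD lee_fin le_eqVlt; apply/orP; left; apply/eqP.
  rewrite /cI /cO (exprS 2 k); move: (2 ^+ k) p0 (dy k) dk0 (q ^+ k) => x x0 y y0 t.
  by field; rewrite (lt0r_neq0 b0) (lt0r_neq0 x0) (lt0r_neq0 y0).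
- move=> n; rewrite -mulr_sumr ler_wpM2l //.
  by rewrite -[leRHS]mul1r ler_pdivlMr // geo_sum_le ?(ltW q0) // lerBlDr lerDl exprn_ge0 // ltW.
Qed.

(** With x = 2^-k the summand is a dyadic Riemann term for the integral of dx / (d+x)^2, and is
    dominated by twice the increment of the primitive over [x/2, x]. *)
Lemma kernel_sum (d : R) n : 0 < d -> \sum_(k < n) dy k / (d + dy k) ^+ 2 <= 2 / d.
Proof.
move=> d0.
suff : \sum_(k < n) dy k / (d + dy k) ^+ 2 <= 2 * ((d + dy n)^-1 - (d + dy 0)^-1).
  move=> /le_trans; apply; rewrite ler_pM2l //.
  have dn := dy_gt0 R n; have d00 := dy_gt0 R 0.
  have : (d + dy n)^-1 <= d^-1 by rewrite lef_pV2 ?posrE ?addr_gt0 // lerDl ltW.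
  have : 0 <= (d + dy 0)^-1 by rewrite invr_ge0 addr_ge0 // ltW.
  lra.
elim: n => [|n IH]; first by rewrite big_ord0 subrr mulr0.
rewrite big_ord_recr /=; apply: le_trans (lerD IH (lexx _)) _.
have dn := dy_gt0 R n; rewrite dyS; set x := dy n in dn *.
suff : x / (d + x) ^+ 2 <= 2 * ((d + x / 2)^-1 - (d + x)^-1) by lra.
have a1 : 0 < d + x by rewrite addr_gt0.
have a2 : 0 < d + x / 2 by rewrite addr_gt0 // divr_gt0.
have -> : 2 * ((d + x / 2)^-1 - (d + x)^-1) = x / ((d + x / 2) * (d + x)).
  field; rewrite (lt0r_neq0 a1) /=.
  by have -> : d * 2 + x = 2 * (d + x / 2) by [field]; rewrite mulf_neq0 // lt0r_neq0.
rewrite ler_pM2l // lef_pV2 ?posrE ?mulr_gt0 ?exprn_gt0 //.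
by rewrite expr2 ler_pM2r // lerD2l; lra.
Qed.

Lemma dist1_gt0 (z : R[i]) : unit_disk z -> 0 < normc (1 - z).
Proof.
move=> Dz; rewrite normc_gt0 subr_eq0; apply: contraTneq Dz => <-.
by rewrite /unit_disk /= normc1 ltxx.
Qed.

Lemma tf'_le (B X : R) (c : nat -> R[i]) (z : R[i]) : tadm B c -> unit_disk z ->
  (forall n : nat, \sum_(k < n) normc (c k) * (dy k / (normc (1 - z) + dy k) ^+ 2) <= X) ->
  normc (tf' c z) <= 4 * X.
Proof.
move=> H Dz HX; have d0 := dist1_gt0 Dz.
apply: (csum_le _ _ (tf'_bounded H Dz)); [lra|lra|move=> n].
apply: (@le_trans _ _ (4 * \sum_(k < n) normc (c k) * (dy k / (normc (1 - z) + dy k) ^+ 2))); last by rewrite ler_pM2l.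
rewrite mulr_sumr; apply: ler_sum => k _.
have dk := dy_gt0 R k; have D2 := tden_ge2 k Dz.
have s0 : 0 < normc (1 - z) + dy k by rewrite addr_gt0.
have D0 : 0 < normc (tden k z) by lra.
rewrite normcM normcV normcM normc_real (ger0_norm (ltW dk)) expr2 normcM.
have -> : 4 * (normc (c k) * (dy k / (normc (1 - z) + dy k) ^+ 2)) =
   normc (c k) * dy k * (4 / (normc (1 - z) + dy k) ^+ 2) by ring.
rewrite ler_wpM2l ?mulr_ge0 ?normc_ge0 ?(ltW dk) // -expr2.
have -> : 4 / (normc (1 - z) + dy k) ^+ 2 = (((normc (1 - z) + dy k) / 2) ^+ 2)^-1 by rewrite expr_div_n invf_div; congr (_ / _); ring.
rewrite lef_pV2 ?posrE ?exprn_gt0 ?divr_gt0 //.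
by apply: lerXn2r; rewrite ?nnegrE ?divr_ge0 ?(ltW D0) ?(ltW s0) //; lra.
Qed.

Lemma tf'_sup (K : R) (c : nat -> R[i]) (z : R[i]) : (forall k, normc (c k) <= K) -> unit_disk z ->
  normc (tf' c z) <= 8 * K / normc (1 - z).
Proof.
move=> H Dz; have d0 := dist1_gt0 Dz.
have K0 : 0 <= K := le_trans (normc_ge0 _) (H 0%N).
have Hc : tadm K c.
  move=> k; apply: le_trans (H k) _; rewrite ler_peMr //.
  by apply: exprn_ege1; lra.
have -> : 8 * K / normc (1 - z) = 4 * (K * (2 / normc (1 - z))) by ring.
apply: (tf'_le Hc Dz) => n.
apply: (@le_trans _ _ (K * \sum_(k < n) dy k / (normc (1 - z) + dy k) ^+ 2)).
  rewrite mulr_sumr; apply: ler_sum => k _; rewrite ler_wpM2r // divr_ge0 ?sqr_ge0 //.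
by rewrite ler_wpM2l //; exact: kernel_sum.
Qed.

Lemma weighted_CS (a m : nat -> R) n : (forall k, 0 <= m k) ->
  (\sum_(k < n) a k * m k) ^+ 2 <= (\sum_(k < n) a k ^+ 2 * m k) * \sum_(k < n) m k.
Proof.
move=> m0; elim: n => [|n IH]; first by rewrite !big_ord0 expr0n mulr0.
rewrite !big_ord_recr /=.
move: IH; set S := \sum_(k < n) a k * m k; set Q := \sum_(k < n) a k ^+ 2 * m k; set M := \sum_(k < n) m k => IH.
have Q0 : 0 <= Q by apply: sumr_ge0 => k _; rewrite mulr_ge0 // sqr_ge0.
have M0 : 0 <= M by exact: sumr_ge0.
have mn := m0 n.
have key : 0 <= Q + a n ^+ 2 * M - 2 * S * a n.
  have [M00|Mn0] := eqVneq M 0.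
    have S0 : S = 0 by apply/eqP; rewrite -sqrf_eq0 eq_le sqr_ge0 (le_trans IH) // M00 mulr0.
    by rewrite S0 M00; lra.
  have {Mn0} Mp : 0 < M by rewrite lt_def Mn0 M0.
  rewrite -(pmulr_rge0 _ Mp); have := sqr_ge0 (S - a n * M); move: IH; nra.
have := mulr_ge0 mn key; move: IH; nra.
Qed.

Lemma tf_Hol (B : R) (c : nat -> R[i]) : tadm B c -> Hol_disk (tf c).
Proof. by move=> H z Dz; exact: is_cd_C_derivable (is_cd_tf H Dz). Qed.

Lemma tf_deriv (B : R) (c : nat -> R[i]) (z : R[i]) : tadm B c -> unit_disk z -> C_deriv (tf c) z = tf' c z.
Proof. by move=> H Dz; exact: is_cd_C_deriv (is_cd_tf H Dz). Qed.

(** Because (d+b)^2 is at least b^2 and at least d^2, the product b d / (d+b)^2 is below both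
    ratios. *)
Lemma Phi1_ge (d b : R) : 0 < d -> 0 < b ->
  b / (d + b) ^+ 2 / d <= (Num.min (d / b) (b / d)) `^ 1 / d ^+ 2.
Proof.
move=> d0 b0; have db : 0 < d + b by rewrite addr_gt0.
rewrite powRr1; last by rewrite le_min !divr_ge0 // ltW.
have -> : b / (d + b) ^+ 2 / d = (b * d / (d + b) ^+ 2) / d ^+ 2.
  by field; rewrite (lt0r_neq0 d0) (lt0r_neq0 db).
rewrite ler_pM2r ?invr_gt0 ?exprn_gt0 // le_min; apply/andP; split.
  by rewrite ler_pdivrMr ?exprn_gt0 // mulrAC ler_pdivlMr //; nra.
by rewrite ler_pdivrMr ?exprn_gt0 // mulrAC ler_pdivlMr //; nra.
Qed.

(** A Schur test: Cauchy-Schwarz with the weights 2^-k / (d + 2^-k)^2, whose sum is at most 2/d for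
    d = |1 - z|, bounds |f'|^2 by a series of 32 |c_k|^2 times [Phi 1 (2^-k) 1]. All these majorants
    have integrals below one constant. *)
Lemma tf_Dirichlet (c : nat -> R[i]) (M : R) :
  (forall n : nat, \sum_(k < n) normc (c k) ^+ 2 <= M) -> dirichlet_space (tf c).
Proof.
move=> HM.
have c2 k : normc (c k) ^+ 2 <= M.
  by apply: le_trans (HM k.+1); rewrite big_ord_recr /= lerDr sumr_ge0 // => i _; exact: sqr_ge0.
have M0 : 0 <= M := le_trans (sqr_ge0 _) (c2 0%N).
have Hc : tadm (M + 1) c.
  move=> k; apply: (@le_trans _ _ (M + 1)).
    have := sqr_ge0 (normc (c k) - 1); have := c2 k; have := normc_ge0 (c k); nra.
  by rewrite ler_peMr //; [lra|apply: exprn_ege1; lra].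
split; first exact: tf_Hol Hc.
apply/(disk_integral_lty (h := fun z => normc (C_deriv (tf c) z) ^+ 2)); first by move=> z _; exact: sqr_ge0.
have [C C0 HC] := @area_Phi 1 ltac:(lra).
pose v k (w : mR * mR) : \bar R := ((32 * normc (c k) ^+ 2)%:E * (Phi 1 (dy k) 1 w)%:E)%E.
have a0 k : 0 <= 32 * normc (c k) ^+ 2 by rewrite mulr_ge0 // sqr_ge0.
have v0 k w : (0 <= v k w)%E by rewrite mule_ge0 // lee_fin // Phi_ge0.
have mP k : measurable_fun [set: mR * mR] (fun w => (Phi 1 (dy k) 1 w)%:E).
  by apply/measurable_EFinP; exact: measurable_Phi.
have mD : measurable DD by exact: measurable_disk.
apply: (@le_lt_trans _ _ (32 * M * C)%:E); last exact: ltry.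
apply: (@area_le_series R DD _ v (fun k => 32 * normc (c k) ^+ 2 * C)) => //.
- apply/measurable_EFinP; exact: measurable_dnorm (tf_Hol Hc).
- by move=> w _; rewrite lee_fin sqr_ge0.
- by move=> k; apply: measurable_funeM; exact: measurable_funTS.
- move=> w Dw; rewrite (tf_deriv Hc) //.
  have d0 := dist1_gt0 Dw; set d := normc (1 - ptC w) in d0.
  have dE : dist 1 w = d by rewrite /dist normcB.
  set S := (X in (_ <= X)%E).
  have S0 : (0 <= S)%E by apply: nneseries_ge0.
  (* If the majorising series is infinite there is nothing to show; otherwise its real value bounds
     the partial sums that enter Cauchy-Schwarz. *)
  have [->|Sfin] := eqVneq S +oo%E; first exact: leey.
  have SE : S = (fine S)%:E by rewrite fineK // ge0_fin_numE // lt_neqAle Sfin leey.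
  have part n : \sum_(k < n) 32 / d * (normc (c k) ^+ 2 * (dy k / (d + dy k) ^+ 2)) <= fine S.
    rewrite -lee_fin -SE; apply: le_trans (nneseries_lim_ge n (fun k _ _ => v0 k w)).
    rewrite big_mkord -sumEFin; apply: lee_sum => k _.
    rewrite /v -EFinM lee_fin /Phi dE.
    have -> : 32 / d * (normc (c k) ^+ 2 * (dy k / (d + dy k) ^+ 2)) =
      32 * normc (c k) ^+ 2 * (dy k / (d + dy k) ^+ 2 / d) by ring.
    by rewrite ler_wpM2l //; apply: Phi1_ge => //; exact: dy_gt0.
  rewrite SE lee_fin.
  have m0 k : 0 <= dy k / (d + dy k) ^+ 2 by rewrite divr_ge0 ?sqr_ge0 // ltW // dy_gt0.
  have fS0 : 0 <= fine S by exact: fine_ge0.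
  have X n : \sum_(k < n) normc (c k) * (dy k / (d + dy k) ^+ 2) <= Num.sqrt (fine S / 16).
    have X0 : 0 <= \sum_(k < n) normc (c k) * (dy k / (d + dy k) ^+ 2).
      by apply: sumr_ge0 => k _; rewrite mulr_ge0 ?normc_ge0.
    rewrite -[leLHS](ger0_norm X0) -sqrtr_sqr; apply: ler_wsqrtr.
    apply: le_trans (weighted_CS (fun k => normc (c k)) n m0) _.
    have Q0 : 0 <= \sum_(k < n) normc (c k) ^+ 2 * (dy k / (d + dy k) ^+ 2).
      by apply: sumr_ge0 => k _; rewrite mulr_ge0 ?sqr_ge0.
    apply: le_trans (ler_wpM2l Q0 (kernel_sum n d0)) _.
    have := part n; rewrite -mulr_sumr => h.
    rewrite ler_pdivlMr // mulrC; apply: le_trans h.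
    by rewrite le_eqVlt; apply/orP; left; apply/eqP; field; exact: lt0r_neq0.
  have := tf'_le Hc Dw X => h.
  apply: (@le_trans _ _ ((4 * Num.sqrt (fine S / 16)) ^+ 2)).
    by apply: lerXn2r; rewrite ?nnegrE ?normc_ge0 // mulr_ge0 // sqrtr_ge0.
  by rewrite exprMn sqr_sqrtr ?divr_ge0 //; lra.
- move=> k; apply: (@le_trans _ _ (area [set: mR * mR] (v k))).
    apply: ge0_subset_integral => //.
    by apply: measurable_funeM.
  rewrite /v areaZl //; last by move=> w _; rewrite lee_fin Phi_ge0.
  have a0' : (0 <= (32 * normc (c k) ^+ 2)%:E)%E by rewrite lee_fin.
  by have := lee_wpmul2l a0' (HC (dy k) 1 (dy_gt0 R k)); rewrite -EFinM.
- move=> n; rewrite -mulr_suml -mulr_sumr ler_wpM2r // ler_pM2l //.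
Qed.

End membership.


(** * Test functions in Bergman spaces; the Green function away from its pole *)

Section membership_Bergman_Q.
Context (R : realType).
Local Notation mR := (measurableTypeR R).
Local Notation DD := [set w : mR * mR | unit_disk (ptC w)].
Local Notation dy k := ((2 : R) ^- k).

(** For k <= j the left side is at most 1 and the right side at least 1; for k > j the left side is
    at most 2^(j-k), and Y <= 2. The free base [Y] trades decay in k against growth in j. *)
Lemma dyadic_kernel_le (Y : R) (j k : nat) : 1 <= Y <= 2 -> dy k / (dy j + dy k) <= Y ^+ j / Y ^+ k.
Proof.
move=> /andP[Y1 Y2]; have dj := dy_gt0 R j; have dk := dy_gt0 R k.
have Y0 : 0 < Y by lra.
have [kj|jk] := leqP k j.
  apply: (@le_trans _ _ 1); first by rewrite ler_pdivrMr ?addr_gt0 // mul1r lerDr ltW.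
  by rewrite ler_pdivlMr ?exprn_gt0 // mul1r; apply: ler_weXn2l.
apply: (@le_trans _ _ (dy k / dy j)).
  by rewrite ler_wpM2l ?(ltW dk) // lef_pV2 ?posrE ?addr_gt0 // lerDl ltW.
rewrite invrK ler_pdivlMr ?exprn_gt0 // -mulrA mulrC ler_pdivrMr ?exprn_gt0 //.
rewrite -(subnK (ltnW jk)) !exprD.
have : Y ^+ (k - j) <= 2 ^+ (k - j) by apply: lerXn2r; rewrite ?nnegrE // ltW.
have : 0 < Y ^+ j * 2 ^+ j by rewrite mulr_gt0 // exprn_gt0.
set u := Y ^+ (k - j); set v := 2 ^+ (k - j) => p0 uv.
have -> : 2 ^+ j * (u * Y ^+ j) = Y ^+ j * 2 ^+ j * u by ring.
have -> : Y ^+ j * (v * 2 ^+ j) = Y ^+ j * 2 ^+ j * v by ring.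
by rewrite ler_pM2l.
Qed.

(** With |c_k| <= K y^k and the kernel bounded with base y^2, the terms decay like y^-k and the
    value at radius 1 - 2^-j is O(y^(2 j)). As y > 1 is arbitrary, [superposition_bergman] applies
    with the identity. *)
Lemma tf_Bergman (c : nat -> R[i]) (p alpha : R) : 0 < p -> -1 < alpha ->
  (forall x : R, 1 < x -> exists K : R, forall k, normc (c k) <= K * x ^+ k) ->
  bergman_space p alpha (tf c).
Proof.
move=> p0 a1 H.
have [B HB] := H (3 / 2) ltac:(lra).
apply: (@superposition_bergman R id (tf c)) => //.
- by move=> z; apply: is_cd_C_derivable (is_cd_id z).
- exact: tf_Hol HB.
(* The cap 5/4 ensures y^2 <= 2, the range of [dyadic_kernel_le], and the other entry gives y^2 <=
   e^e. *)
move=> e e0; pose y := Num.min (expR (e / 2)) (5 / 4).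
have y1 : 1 < y by rewrite lt_min; apply/andP; split; [rewrite expR_gt1 divr_gt0|lra].
have y5 : y <= 5 / 4 by rewrite ge_min lexx orbT.
have ye : y <= expR (e / 2) by rewrite ge_min lexx.
have [K HK] := H y y1.
have K0 : 0 <= K by have := HK 0%N; rewrite expr0 mulr1; apply: le_trans; exact: normc_ge0.
have yi0 : 0 <= y^-1 by rewrite invr_ge0; lra.
have yi1 : y^-1 < 1 by rewrite invf_lt1; lra.
have yi10 : 0 < 1 - y^-1 by rewrite subr_gt0.
exists (2 * K / (1 - y^-1)) => j z hz; rewrite /id.
have dj := dy_gt0 R j.
have Dz : unit_disk z by apply: le_lt_trans hz _; rewrite ltrBlDr ltrDl.
have d1 : dy j <= normc (1 - z).
  by have := ler_dist_normc 1 z; rewrite normc1 => /(le_trans (ler_norm _)); lra.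
rewrite expRD; apply: (@le_trans _ _ (2 * K / (1 - y^-1) * expR (e * j%:R))); last first.
  by rewrite ler_wpM2r ?expR_ge0 // ltW // (lt_le_trans _ (expR_ge1Dx _)) // ltrDr.
apply: (@le_trans _ _ (2 * K / (1 - y^-1) * (y ^+ 2) ^+ j)); last first.
  rewrite ler_wpM2l ?divr_ge0 ?mulr_ge0 ?(ltW yi10) // -exprM.
  have -> : e * j%:R = (2 * j)%:R * (e / 2) by rewrite natrM; field.
  by rewrite expRM_natl; apply: lerXn2r; rewrite ?nnegrE ?expR_ge0 //; lra.
apply: (csum_le _ _ (tf_bounded HB Dz)); [lra|lra|move=> n].
apply: (@le_trans _ _ (\sum_(k < n) 2 * K * (y ^+ 2) ^+ j * y^-1 ^+ k)).
  apply: ler_sum => k _; have dk := dy_gt0 R k; have D2 := tden_ge2 k Dz.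
  have D0 : 0 < normc (tden k z) by lra.
  rewrite normcM normcV normcM normc_real (ger0_norm (ltW dk)).
  apply: (@le_trans _ _ (K * y ^+ k * (2 * (dy k / (dy j + dy k))))).
    rewrite -mulrA; apply: ler_pM; rewrite ?normc_ge0 ?divr_ge0 ?(ltW dk) ?(ltW D0) //.
    rewrite mulrCA ler_wpM2l ?(ltW dk) //.
    by rewrite -[leRHS]invf_div lef_pV2 ?posrE ?divr_gt0 ?addr_gt0 //; lra.
  have yk : 0 < y ^+ k by apply: exprn_gt0; lra.
  have := @dyadic_kernel_le (y ^+ 2) j k _; rewrite expr2 => /(_ ltac:(nra)) h.
  apply: (@le_trans _ _ (K * y ^+ k * (2 * ((y * y) ^+ j / (y * y) ^+ k)))).
    by rewrite ler_wpM2l ?mulr_ge0 ?(ltW yk) // ler_pM2l.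
  rewrite le_eqVlt; apply/orP; left; apply/eqP; rewrite [(y * y) ^+ k]exprMn exprVn.
  by field; exact: lt0r_neq0.
rewrite -mulr_sumr.
have -> : 2 * K / (1 - y^-1) * (y ^+ 2) ^+ j = 2 * K * (y ^+ 2) ^+ j * (1 - y^-1)^-1 by ring.
have C0 : 0 <= 2 * K * (y ^+ 2) ^+ j by rewrite mulr_ge0 ?mulr_ge0 // exprn_ge0 // sqr_ge0.
apply: (ler_wpM2l C0).
by rewrite -[leRHS]mul1r ler_pdivlMr // geo_sum_le // lerBlDr lerDl exprn_ge0.
Qed.

Lemma normc_sqr (z : R[i]) : normc z ^+ 2 = Re z ^+ 2 + Im z ^+ 2.
Proof. by case: z => x y; rewrite /normc /= sqr_sqrtr // addr_ge0 // sqr_ge0. Qed.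

Lemma pseudo_hyperbolic (a z : R[i]) :
  normc (1 - a^* * z) ^+ 2 - normc (z - a) ^+ 2 = (1 - normc a ^+ 2) * (1 - normc z ^+ 2).
Proof. by rewrite !normc_sqr; case: a => x y; case: z => u v /=; ring. Qed.

Lemma normc_conjc (a : R[i]) : normc (a^*) = normc a.
Proof. by case: a => x y; rewrite /normc /= sqrrN. Qed.

(** ln x = s ln (x^(1/s)) <= s x^(1/s), raised to the power [s]. Any power of the logarithmic
    singularity is thus tamed by a simple pole, which is integrable in the plane. *)
Lemma powR_ln_le (s x : R) : 0 < s -> 1 <= x -> (ln x) `^ s <= s `^ s * x.
Proof.
move=> s0 x1; have x0 : 0 < x by lra.
have y0 : 0 < x `^ s^-1 by exact: powR_gt0.
have l : ln x <= s * x `^ s^-1.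
  have : ln (x `^ s^-1) <= x `^ s^-1.
    by apply: ltW; exact: ln_sublinear.
  by rewrite ln_powR ler_pdivrMl.
apply: (@le_trans _ _ ((s * x `^ s^-1) `^ s)).
  by apply: ge0_ler_powR; rewrite ?nnegrE ?ln_ge0 // ?mulr_ge0 // ltW.
rewrite powRM ?(ltW s0) ?(ltW y0) // -powRrM mulVf ?gt_eqF // powRr1 //.
exact: ltW.
Qed.

Lemma normcM_le1 (a z : R[i]) : normc a <= 1 -> normc (a * z) <= normc z.
Proof. by move=> a1; rewrite normcM -[leRHS]mul1r ler_wpM2r ?normc_ge0. Qed.

Lemma normc_conj_swap (a z : R[i]) : normc (1 - z^* * a) = normc (1 - a^* * z).
Proof.
rewrite -[LHS]normc_conjc; congr normc; case: a => x y; case: z => u v.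
by apply/eqP; rewrite eq_complex /=; apply/andP; split; apply/eqP; ring.
Qed.

Lemma normc_sub1J (a : R[i]) : normc (1 - a^*) = normc (1 - a).
Proof.
rewrite -[LHS]normc_conjc; congr normc; case: a => x y.
by apply/eqP; rewrite eq_complex /=; apply/andP; split; apply/eqP; ring.
Qed.

(** At pseudo-hyperbolic distance at least 1/2 the Green function is comparable to
    (1-|a|^2)(1-|z|^2) / |1 - conj(a) z|^2. Bounding this by the ratios of |1 - z| to |1 - a|, in
    both orders, recentres everything at the boundary point 1, where the test functions are
    singular. *)
Lemma green_far (a z : R[i]) (s sigma : R) : unit_disk a -> unit_disk z ->
  0 < sigma <= 1 -> sigma <= s -> normc (1 - a^* * z) <= 2 * normc (z - a) ->
  green_disk z a `^ s <=
    16 * (Num.min (normc (1 - z) / normc (1 - a)) (normc (1 - a) / normc (1 - z))) `^ sigma.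
Proof.
move=> Da Dz /andP[s0 s1] ss he; have Da' : normc a < 1 by []. have Dz' : normc z < 1 by [].
have d0 := dist1_gt0 Dz; have b0 := dist1_gt0 Da.
have a0 := normc_ge0 a; have z0 := normc_ge0 z.
have Nh := normc_conjM_lt Da Dz; have N0 : 0 < normc (1 - a^* * z) by lra.
have Nz : 1 - normc z <= normc (1 - a^* * z).
  have := normc_conjM_lt Dz Da; rewrite normc_conj_swap; apply.
have bN : normc (1 - a) <= normc (1 - a^* * z) + normc (1 - z).
  rewrite -normc_sub1J.
  have -> : 1 - a^* = (1 - a^* * z) - a^* * (1 - z) by ring.
  apply: le_trans (le_normcD _ _) _; rewrite lerD2l normcN; apply: normcM_le1.
  by rewrite normc_conjc ltW.
have dN : normc (1 - z) <= normc (1 - a^* * z) + normc (1 - a).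
  have -> : 1 - z = (1 - a^* * z) - z * (1 - a^*) by ring.
  apply: le_trans (le_normcD _ _) _; rewrite lerD2l normcN.
  rewrite -[leRHS]normc_sub1J.
  by apply: normcM_le1; exact: ltW.
have hb : 1 - normc a <= normc (1 - a).
  by have := ler_dist_normc 1 a; rewrite normc1 => /(le_trans (ler_norm _)).
have hd : 1 - normc z <= normc (1 - z).
  by have := ler_dist_normc 1 z; rewrite normc1 => /(le_trans (ler_norm _)).
have PH := pseudo_hyperbolic a z.
rewrite /green_disk normcM normcV.
have eN : normc (z - a) <= normc (1 - a^* * z).
  have : 0 <= (1 - normc a ^+ 2) * (1 - normc z ^+ 2).
    by rewrite mulr_ge0 // subr_ge0 expr_le1 // ltW.
  rewrite -PH subr_ge0 => h; rewrite -[leLHS]ger0_norm ?normc_ge0 // -[leRHS]ger0_norm ?normc_ge0 //.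
  by rewrite -!sqrtr_sqr; exact: ler_wsqrtr.
move: PH N0 Nh Nz bN dN he eN hb hd d0 b0.
set N := normc (1 - a^* * z); set e := normc (z - a); set d := normc (1 - z); set b := normc (1 - a).
move: (normc a) (normc z) a0 z0 Da' Dz' => x y x0 y0 x1 y1 PH N0 Nh Nz bN dN he eN hb hd d0 b0.
have e0 : 0 < e by lra.
have Ne1 : 1 <= N / e by rewrite ler_pdivlMr // mul1r.
have L0 : 0 <= ln (N / e) by exact: ln_ge0.
have LN : ln (N / e) <= N / e - 1.
  have := @le_ln1Dx R (N / e - 1); rewrite addrCA subrr addr0; apply; lra.
have L1 : ln (N / e) <= 1.
  have : N / e <= 2 by rewrite ler_pdivrMr.
  lra.
pose T := (1 - x ^+ 2) * (1 - y ^+ 2).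
(* ln x <= x - 1 leaves (N - e) N^2, while 2 e (N + e) >= N^2 because N <= 2 e; [pseudo_hyperbolic]
   identifies N^2 - e^2 with [T]. *)
have LT : ln (N / e) * N ^+ 2 <= 2 * T.
  apply: (@le_trans _ _ ((N / e - 1) * N ^+ 2)); first by rewrite ler_wpM2r // sqr_ge0.
  rewrite /T -PH -(ler_pM2r e0).
  have -> : (N / e - 1) * N ^+ 2 * e = (N - e) * N ^+ 2 by field; exact: lt0r_neq0.
  have -> : 2 * (N ^+ 2 - e ^+ 2) * e = (N - e) * (2 * e * (N + e)) by ring.
  rewrite ler_wpM2l ?subr_ge0 //; nra.
have T1 : T <= 2 * N * (1 - y ^+ 2).
  by apply: ler_wpM2r; [rewrite subr_ge0 expr_le1 // ltW|nra].
have T2 : T <= (1 - x ^+ 2) * (2 * N).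
  by apply: ler_wpM2l; [rewrite subr_ge0 expr_le1 // ltW|nra].
have TN : T <= N ^+ 2 by rewrite /T -PH lerBlDr lerDl sqr_ge0.
have y2 : 1 - y ^+ 2 <= 2 * d by nra.
have x2 : 1 - x ^+ 2 <= 2 * b by nra.
have N20 : 0 < N ^+ 2 by rewrite exprn_gt0.
(* If b <= 2 d the bound ln (N / e) <= 1 suffices. Otherwise b <= N + d forces b <= 2 N, and T <= 2
   N (2 d) then leaves N^2 to cancel. *)
have Lb : ln (N / e) * b <= 16 * d.
  have [bd|db] := leP b (2 * d).
    have : ln (N / e) * b <= 2 * d by nra.
    lra.
  rewrite -(ler_pM2r N20) mulrAC; apply: (@le_trans _ _ (2 * T * b)); first by rewrite ler_pM2r.
  have bN2 : b <= 2 * N by lra.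
  apply: (@le_trans _ _ (2 * (2 * N * (2 * d)) * (2 * N))); last by rewrite le_eqVlt; apply/orP; left; apply/eqP; ring.
  have T0 : 0 <= T by rewrite mulr_ge0 // subr_ge0 expr_le1 // ltW.
  by apply: ler_pM => //; [lra|lra|nra].
have Ld : ln (N / e) * d <= 16 * b.
  have [bd|db] := leP d (2 * b).
    have : ln (N / e) * d <= 2 * b by nra.
    lra.
  rewrite -(ler_pM2r N20) mulrAC; apply: (@le_trans _ _ (2 * T * d)); first by rewrite ler_pM2r.
  have bN2 : d <= 2 * N by lra.
  apply: (@le_trans _ _ (2 * (2 * b * (2 * N)) * (2 * N))); last by rewrite le_eqVlt; apply/orP; left; apply/eqP; ring.
  have T0 : 0 <= T by rewrite mulr_ge0 // subr_ge0 expr_le1 // ltW.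
  by apply: ler_pM => //; [lra|lra|nra].
set m := Num.min _ _.
have m0 : 0 <= m by rewrite le_min !divr_ge0 // ltW.
have Lm : ln (N / e) <= 16 * m.
  rewrite -ler_pdivrMl // mulrC le_min; apply/andP; split.
    by rewrite ler_pdivlMr // mulrAC ler_pdivrMr // mulrC [d * _]mulrC mulrC.
  by rewrite ler_pdivlMr // mulrAC ler_pdivrMr // [b * _]mulrC.
have [Lz|Lnz] := eqVneq (ln (N / e)) 0.
  by rewrite Lz powR0 ?gt_eqF ?(lt_le_trans s0) // mulr_ge0 // powR_ge0.
have {Lnz} Lp : 0 < ln (N / e) by rewrite lt_def Lnz L0.
(* The logarithm is at most 1 here, so lowering the exponent from [s] to [sigma] only increases the
   power. *)
apply: (@le_trans _ _ (ln (N / e) `^ sigma)); first by apply: ger_powR => //; rewrite Lp.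
apply: (@le_trans _ _ ((16 * m) `^ sigma)).
  by apply: ge0_ler_powR; rewrite ?nnegrE ?mulr_ge0 // ltW.
rewrite powRM // ler_wpM2r ?powR_ge0 //; apply: ler1_powR => //; lra.
Qed.

End membership_Bergman_Q.


(** * The Green function near its pole, and test functions in [Q_space] *)

Section membership_Q.
Context (R : realType).
Local Notation mR := (measurableTypeR R).
Local Notation DD := [set w : mR * mR | unit_disk (ptC w)].

(** At pseudo-hyperbolic distance below 1/2 the triangle inequality gives |1 - conj(a) z| <= 4
    (1-|a|), and [pseudo_hyperbolic] bounds 1 - |z| from below by a multiple of 1 - |a|. The
    logarithm is handled by [powR_ln_le]. *)
Lemma green_near (a z : R[i]) (s : R) : unit_disk a -> unit_disk z -> z != a -> 0 < s ->
  2 * normc (z - a) < normc (1 - a^* * z) ->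
  [/\ normc (z - a) <= 2 * (1 - normc a), 3 * (1 - normc a) <= 16 * normc (1 - z)
    & green_disk z a `^ s * normc (z - a) <= s `^ s * (4 * (1 - normc a))].
Proof.
move=> Da Dz za s0 he; have Da' : normc a < 1 by []. have Dz' : normc z < 1 by [].
have d0 := dist1_gt0 Dz.
have a0 := normc_ge0 a; have z0 := normc_ge0 z.
have Nh := normc_conjM_lt Da Dz; have N0 : 0 < normc (1 - a^* * z) by lra.
have e0 : 0 < normc (z - a) by rewrite normc_gt0 subr_eq0.
have hd : 1 - normc z <= normc (1 - z).
  by have := ler_dist_normc 1 z; rewrite normc1 => /(le_trans (ler_norm _)).
have NN : normc (1 - a^* * z) <= (1 - normc a ^+ 2) + normc (z - a).
  have -> : 1 - a^* * z = (1 - normc a ^+ 2)%:C - a^* * (z - a).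
    rewrite normc_sqr; case: (a) => x y; case: (z) => u v.
    by apply/eqP; rewrite eq_complex /=; apply/andP; split; apply/eqP; ring.
  apply: le_trans (le_normcD _ _) _; rewrite normc_real ger0_norm ?subr_ge0 ?expr_le1 ?(ltW Da') //.
  by rewrite lerD2l normcN; apply: normcM_le1; rewrite normc_conjc ltW.
have PH := pseudo_hyperbolic a z.
rewrite /green_disk normcM normcV.
move: PH N0 Nh NN he e0 hd d0.
set N := normc (1 - a^* * z); set e := normc (z - a); set d := normc (1 - z).
move: (normc a) (normc z) a0 z0 Da' Dz' => x y x0 y0 x1 y1 PH N0 Nh NN he e0 hd d0.
have N4 : N <= 4 * (1 - x) by nra.
split; first by lra.
  have N2 : 3 * N ^+ 2 <= 4 * ((1 - x ^+ 2) * (1 - y ^+ 2)) by rewrite -PH; nra.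
  have y2 : 0 <= 1 - y ^+ 2 by rewrite subr_ge0 expr_le1 // ltW.
  have h1 : (1 - x ^+ 2) * (1 - y ^+ 2) <= 2 * (1 - x) * (1 - y ^+ 2) by apply: ler_wpM2r => //; nra.
  have h2 : (1 - x) ^+ 2 <= N ^+ 2 by apply: lerXn2r; rewrite ?nnegrE //; lra.
  have h3 : 3 * (1 - x) <= 8 * (1 - y ^+ 2).
    have xp : 0 < 1 - x by lra.
    by rewrite -(ler_pM2l xp); nra.
  nra.
have Ne1 : 1 <= N / e by rewrite ler_pdivlMr // mul1r; lra.
apply: (@le_trans _ _ (s `^ s * (N / e) * e)).
  by apply: ler_wpM2r; [exact: ltW|exact: powR_ln_le].
by rewrite -mulrA divfK ?gt_eqF // ler_wpM2l ?powR_ge0.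
Qed.

(** Two majorants cover the two regimes: [Phi] centred at 1 with scale |1 - a| away from the pole,
    and [Phi] centred at the pole with scale 2 (1-|a|) near it. At the pole itself the left side is
    0 by convention. *)
Lemma green_bound (a : R[i]) (w : mR * mR) (s sigma : R) : unit_disk a -> unit_disk (ptC w) ->
  0 < sigma <= 1 -> sigma <= s ->
  green_disk (ptC w) a `^ s / normc (1 - ptC w) ^+ 2 <=
    16 * Phi sigma (normc (1 - a)) 1 w + 228 * s `^ s * Phi 1 (2 * (1 - normc a)) a w.
Proof.
move=> Da Dz s01 ss; have s0 : 0 < s by case/andP: s01 => s0 _; exact: lt_le_trans ss.
have d0 := dist1_gt0 Dz; have P1 := Phi_ge0 sigma (normc (1 - a)) 1 w.
have P2 := Phi_ge0 1 (2 * (1 - normc a)) a w.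
have S0 : 0 <= 228 * s `^ s by rewrite mulr_ge0 ?ler0n ?powR_ge0.
have dE : dist 1 w = normc (1 - ptC w) by rewrite /dist normcB.
have [he|he] := leP (normc (1 - a^* * ptC w)) (2 * normc (ptC w - a)).
  apply: (@le_trans _ _ (16 * Phi sigma (normc (1 - a)) 1 w)); last first.
    by rewrite lerDl (mulr_ge0 S0 P2).
  rewrite /Phi dE mulrA ler_pM2r ?invr_gt0 ?exprn_gt0 //; exact: green_far.
apply: (@le_trans _ _ (228 * s `^ s * Phi 1 (2 * (1 - normc a)) a w)); last first.
  by rewrite lerDr mulr_ge0.
have [->|za] := eqVneq (ptC w) a.
  rewrite /green_disk subrr invr0 mulr0 normc0 ln0 // powR0 ?gt_eqF // mul0r.
  exact: mulr_ge0 S0 P2.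
have [e2 h16 G] := green_near Da Dz za s0 he.
have e0 : 0 < normc (ptC w - a) by rewrite normc_gt0 subr_eq0.
have h0 : 0 < 1 - normc a by rewrite subr_gt0.
rewrite /Phi /dist.
have -> : Num.min (normc (ptC w - a) / (2 * (1 - normc a))) (2 * (1 - normc a) / normc (ptC w - a)) =
   normc (ptC w - a) / (2 * (1 - normc a)).
  apply/min_idPl; apply: (@le_trans _ _ 1).
    by rewrite ler_pdivrMr ?mulr_gt0 // mul1r.
  by rewrite ler_pdivlMr // mul1r.
rewrite powRr1; last by rewrite divr_ge0 ?normc_ge0 // mulr_ge0 // ltW.
move: d0 e0 h0 e2 h16 G.
set d := normc (1 - ptC w); set e := normc (ptC w - a); set h := 1 - normc a; set g := _ `^ s.
have ss0 := powR_ge0 s s; set S := s `^ s in ss0 *.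
move=> d0 e0 h0 e2 h16 G.
(* [green_near] yields 4 h^2 <= 4 (16/3)^2 d^2, and 4 times 256/9 is just below 114; the scale 2 h
   doubles this to 228. *)
have -> : 228 * S * (e / (2 * h) / e ^+ 2) = 114 * S / (h * e).
  by field; rewrite (lt0r_neq0 e0) (lt0r_neq0 h0).
rewrite ler_pdivlMr ?mulr_gt0 // mulrAC ler_pdivrMr ?exprn_gt0 //.
apply: (@le_trans _ _ (S * (4 * h) * h)).
  by rewrite mulrCA mulrC ler_wpM2r ?(ltW h0) // mulrC.
rewrite -!mulrA [leRHS]mulrCA ler_wpM2l // -expr2.
have := lerXn2r 2 (_ : 3 * h \in Num.nneg) (_ : 16 * d \in Num.nneg) h16.
rewrite !nnegrE => /(_ ltac:(lra) ltac:(lra)).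
by rewrite !expr2; nra.
Qed.

(** For bounded coefficients |f'|^2 <= 64 K^2 / |1 - z|^2, so [green_bound] majorises the integrand
    by two [Phi] whose integrals are bounded independently of [a], as the supremum requires. *)
Lemma tf_Q (c : nat -> R[i]) (K s : R) : 0 < s -> (forall k, normc (c k) <= K) -> Q_space s (tf c).
Proof.
move=> s0 HK.
have K0 : 0 <= K := le_trans (normc_ge0 _) (HK 0%N).
have Hc : tadm K c.
  move=> k; apply: le_trans (HK k) _; rewrite ler_peMr //.
  by apply: exprn_ege1; lra.
have Hf := tf_Hol Hc; split => //.
pose sigma := Num.min s 1.
have s01 : 0 < sigma <= 1 by rewrite lt_min s0 ltr01 ge_min lexx orbT.
have ss : sigma <= s by rewrite ge_min lexx.
have [C1 C10 H1] := area_Phi s01.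
have [C2 C20 H2] := @area_Phi R 1 ltac:(lra).
have mD : measurable DD by exact: measurable_disk.
pose A1 := 64 * K ^+ 2 * 16; pose A2 := 64 * K ^+ 2 * (228 * s `^ s).
have A10 : 0 <= A1 by rewrite mulr_ge0 // mulr_ge0 // sqr_ge0.
have A20 : 0 <= A2 by rewrite !mulr_ge0 ?ler0n ?sqr_ge0 ?powR_ge0.
have M a : unit_disk a -> (area DD (fun w => (normc (C_deriv (tf c) (ptC w)) ^+ 2 * green_disk (ptC w) a `^ s)%:E)
   <= (A1 * C1 + A2 * C2)%:E)%E.
  move=> Da.
  pose U (w : mR * mR) := (A1%:E * (Phi sigma (normc (1 - a)) 1 w)%:E)%E.
  pose V (w : mR * mR) := (A2%:E * (Phi 1 (2 * (1 - normc a)) a w)%:E)%E.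
  have b0 := dist1_gt0 Da.
  have h0 : 0 < 2 * (1 - normc a) by rewrite mulr_gt0 // subr_gt0.
  have mP sg b x : measurable_fun [set: mR * mR] (fun w => (Phi sg b x w)%:E).
    by apply/measurable_EFinP; exact: measurable_Phi.
  have P0 sg b x (w : mR * mR) : [set: mR * mR] w -> (0 <= (Phi sg b x w)%:E)%E.
    by move=> _; rewrite lee_fin Phi_ge0.
  have mU : measurable_fun [set: mR * mR] U by exact: measurable_funeM.
  have mV : measurable_fun [set: mR * mR] V by exact: measurable_funeM.
  have U0 w : (0 <= U w)%E by rewrite mule_ge0 // lee_fin // Phi_ge0.
  have V0 w : (0 <= V w)%E by rewrite mule_ge0 // lee_fin // Phi_ge0.
  apply: (@le_trans _ _ (area [set: mR * mR] (fun w => U w + V w)%E)).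
    apply: area_le => //.
    - by apply/measurable_EFinP; apply: measurable_funM; [exact: measurable_dnorm|exact: measurable_green].
    - exact: emeasurable_funD.
    - move=> w Dw; rewrite lee_fin mulr_ge0 ?sqr_ge0 ?powR_ge0 //=.
      rewrite /U /V -!EFinM -EFinD lee_fin (tf_deriv Hc) //.
      have d0 := dist1_gt0 Dw.
      have G := green_bound Da Dw s01 ss.
      have g0 : 0 <= green_disk (ptC w) a `^ s by exact: powR_ge0.
      have T : normc (tf' c (ptC w)) ^+ 2 <= 64 * K ^+ 2 / normc (1 - ptC w) ^+ 2.
        have -> : 64 * K ^+ 2 / normc (1 - ptC w) ^+ 2 = (8 * K / normc (1 - ptC w)) ^+ 2.
          by field; exact: lt0r_neq0.
        apply: lerXn2r; rewrite ?nnegrE ?normc_ge0 ?divr_ge0 ?mulr_ge0 ?(ltW d0) //; exact: tf'_sup.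
      apply: le_trans (ler_wpM2r g0 T) _.
      have K2 : 0 <= 64 * K ^+ 2 by rewrite mulr_ge0 // sqr_ge0.
      have := ler_wpM2l K2 G; move: (green_disk _ _ `^ s) (Phi sigma _ _ _) (Phi 1 _ _ _) => g P Q.
      have -> : 64 * K ^+ 2 / normc (1 - ptC w) ^+ 2 * g = 64 * K ^+ 2 * (g / normc (1 - ptC w) ^+ 2) by ring.
      have -> // : 64 * K ^+ 2 * (16 * P + 228 * s `^ s * Q) = A1 * P + A2 * Q by rewrite /A1 /A2; ring.
    - by move=> w _; rewrite adde_ge0.
  rewrite areaD // (areaZl measurableT (mP _ _ _) (P0 _ _ _) A10) (areaZl measurableT (mP _ _ _) (P0 _ _ _) A20).
  rewrite EFinD !EFinM; apply: leeD.
    have A10' : (0 <= A1%:E)%E by rewrite lee_fin.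
    exact: (lee_wpmul2l A10' (H1 (normc (1 - a)) 1 b0)).
  have A20' : (0 <= A2%:E)%E by rewrite lee_fin.
  exact: (lee_wpmul2l A20' (H2 (2 * (1 - normc a)) a h0)).
apply: (@le_lt_trans _ _ ((pi^-1)%:E * (A1 * C1 + A2 * C2)%:E)%E); last by rewrite -EFinM ltry.
apply: ge_ereal_sup => _ [a Da <-]; rewrite /disk_integral -/(area _ _).
have p0 : (0 <= (pi^-1)%:E :> \bar R)%E by rewrite lee_fin invr_ge0 pi_ge0.
exact: (lee_wpmul2l p0 (M a Da)).
Qed.

End membership_Q.


(** * The gliding hump argument *)

Section gliding_hump.
Context (R : realType).
Local Notation dy k := ((2 : R) ^- k).
Variables (W T : nat -> R) (om : R) (G : nat -> (nat -> R[i]) -> R).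

Definition wbounded (c : nat -> R[i]) := forall k, normc (c k) <= W k.

(** The factor [om] switches the square-sum constraint: 1 for the Dirichlet space, 0 for the two
    cases where only the weights [W] restrict the sequence. *)
Definition mass_le (c : nat -> R[i]) (r : R) := forall n : nat, \sum_(k < n) om * normc (c k) ^+ 2 <= r.

Hypotheses (T0 : forall m, 0 < T m) (W0 : forall k, 0 <= W k).
(** Lower semicontinuity in the product topology: a violated bound is already forced by finitely
    many coefficients, so later modifications cannot repair it. *)
Hypothesis robust : forall m c t, wbounded c -> t < G m c ->
  exists n : nat, forall c', wbounded c' -> (forall k, (k < n)%N -> c' k = c k) -> t < G m c'.
Hypothesis pointwise : forall c, wbounded c -> mass_le c 2 -> exists C : R, forall m, G m c <= C * T m.

(* Were the bound to fail near every finitely supported [c0], finitely supported sequences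
   violating it with constants [j = 0, 1, 2, ...], each a small perturbation of the previous one
   beyond the places that matter so far, would converge to a sequence violating [pointwise]. *)
Lemma gliding_hump : exists n0 c0 r C, [/\ 0 < r, wbounded c0, (forall k, (n0 <= k)%N -> c0 k = 0) &
  forall c N, (forall k, (N <= k)%N -> c k = 0) -> wbounded c ->
   (forall k, (k < n0)%N -> c k = c0 k) -> mass_le (fun k => c k - c0 k) r ->
   forall m, G m c <= C * T m].
Proof.
apply: contrapT => nex.
pose good (s : nat * (nat -> R[i])) := wbounded s.2 /\ (forall k, (s.1 <= k)%N -> s.2 k = 0).
pose rel j (s s' : nat * (nat -> R[i])) := [/\ good s', (s.1 < s'.1)%N,
  (forall k, (k < s.1)%N -> s'.2 k = s.2 k), mass_le (fun k => s'.2 k - s.2 k) (dy j)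
  & exists m, forall c, wbounded c -> (forall k, (k < s'.1)%N -> c k = s'.2 k) -> j%:R * T m < G m c].
have step js : exists s', good js.2 -> rel js.1 js.2 s'.
  case: js => j [n0 c0] /=.
  have [[bc0 sc0]|ng] := pselect (good (n0, c0)); last by exists (n0, c0) => /ng.
  apply: contrapT => nstep; apply: nex; exists n0, c0, (dy j), j%:R; split => //.
  move=> c N sc bc ec mc m; rewrite leNgt; apply/negP => viol; apply: nstep.
  have [n Hn] := robust bc viol.
  exists (maxn (maxn N n) n0.+1, c) => _; split => //=.
  - by split => //= k; rewrite !geq_max => /andP[/andP[/sc]].
  - by rewrite leq_max ltnSn orbT.
  - exists m => c' bc' ec'; apply: Hn => // k kn; apply: ec'.
    by rewrite !leq_max kn orbT.
have [F HF] := choice step.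
pose x := fix x j := if j is i.+1 then F (i, x i) else (0%N, fun=> 0 : R[i]).
have gx j : good (x j).
  elim: j => [|j IH]; first by split => //= k; rewrite normc0.
  by have [] := HF (j, x j) IH.
have rx j : rel j (x j) (x j.+1) by exact: (HF (j, x j) (gx j)).
have nx j : (j <= (x j).1)%N.
  by elim: j => // j IH; have [_ h _ _ _] := rx j; exact: leq_ltn_trans h.
have ax i d k : (k < (x i).1)%N -> (x (d + i)%N).2 k = (x i).2 k /\ (k < (x (d + i)%N).1)%N.
  move=> ki; elim: d => [|d [IH1 IH2]] //; rewrite addSn.
  have [_ h1 h2 _ _] := rx (d + i)%N; split; first by rewrite h2.
  exact: ltn_trans h1.
have axl i j k : (i <= j)%N -> (k < (x i).1)%N -> (x j).2 k = (x i).2 k.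
  by move=> ij ki; have [] := ax i (j - i)%N k ki; rewrite subnK.
(* Stage k + 1 has frozen at least k + 1 places, hence place k. *)
pose c k := (x k.+1).2 k.
have cx j k : (k < (x j).1)%N -> c k = (x j).2 k.
  move=> kj; rewrite /c; have [jk|jk] := leqP j k.+1; first exact: axl.
  by rewrite (axl k.+1 j k (ltnW jk) (nx k.+1)).
have bc : wbounded c by move=> k; have [h _] := gx k.+1; exact: h.
(* 2 - 2 times 2^-j is the sum of 2^-i over i < j. Masses add without cross terms, because each
   perturbation begins where the previous sequence has ended. *)
have mx j : mass_le (x j).2 (2 - 2 * dy j).
  elim: j => [|j IH] n.
    rewrite expr0 invr1 mulr1 subrr le_eqVlt; apply/orP; left; apply/eqP.
    by apply: big1 => k _; rewrite /= normc0 expr0n mulr0.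
  have [_ _ h2 h3 _] := rx j; have [_ s0] := gx j.
  rewrite (eq_bigr (fun k : 'I_n => om * normc ((x j).2 k) ^+ 2 + om * normc ((x j.+1).2 k - (x j).2 k) ^+ 2)).
    by rewrite big_split /=; have := IH n; have := h3 n; rewrite dyS; lra.
  move=> k _; have [kj|kj] := ltnP k (x j).1.
    by rewrite h2 // subrr normc0 expr0n mulr0 addr0.
  by rewrite (s0 k kj) subr0 normc0 expr0n mulr0 add0r.
have mc : mass_le c 2.
  move=> n; apply: (@le_trans _ _ (\sum_(k < n) om * normc ((x n).2 k) ^+ 2)).
    by apply: ler_sum => k _; rewrite (cx n) // (leq_trans (ltn_ord k) (nx n)).
  by apply: le_trans (mx n n) _; have := dy_gt0 R n; lra.
have [C HC] := pointwise bc mc.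
have [j Cj] := exists_nat_ge C.
have [_ _ _ _ [m Hm]] := rx j.
have := Hm c bc (fun k => cx j.+1 k); apply/negP; rewrite -leNgt.
by apply: le_trans (HC m) _; rewrite ler_pM2r.
Qed.

End gliding_hump.


(** * Prescribing the value of a test function *)

Section reach.
Context (R : realType).
Local Notation dy k := ((2 : R) ^- k).

(** Quantitative dependence on coordinates: together with the continuity of [phi] it provides the
    hypothesis [robust] of the gliding hump. *)
Lemma tf_agree (B : R) (c c' : nat -> R[i]) (z : R[i]) (n : nat) : tadm B c -> tadm B c' -> unit_disk z ->
  (forall k, (k < n)%N -> c' k = c k) ->
  normc (tf c' z - tf c z) <= 16 * B / (1 - normc z) * (3 / 4) ^+ n.
Proof.
move=> H H' Dz E.
have q0 : (0 : R) <= 3 / 4 by lra.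
have q1 : (3 / 4 : R) < 1 by lra.
rewrite /tf -(csumB q0 q1 (tf_bounded H' Dz) (tf_bounded H Dz)).
set u := fun k => _.
have bu : geo_bounded u (B / (1 - normc z) + B / (1 - normc z)) (3 / 4).
  move=> k; apply: le_trans (le_normcD _ _) _; rewrite normcN mulrDl.
  by apply: lerD; exact: tf_bounded.
have := csum_tail q0 q1 bu n.
have -> : \sum_(k < n) u k = 0 by apply: big1 => k _; rewrite /u E // subrr.
rewrite subr0 => /le_trans; apply; rewrite le_eqVlt; apply/orP; left; apply/eqP.
have -> : 1 - 3 / 4 = (4^-1 : R) by lra.
by rewrite invrK; ring.
Qed.

Lemma csum_finite (u : nat -> R[i]) (N : nat) (M q : R) : 0 <= q -> q < 1 -> geo_bounded u M q ->
  (forall k, (N <= k)%N -> u k = 0) -> csum u = \sum_(k < N) u k.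
Proof.
move=> q0 q1 H u0; apply/eqP; rewrite -subr_eq0 -normc_eq0 eq_le normc_ge0 andbT.
apply: (@le_of_pow R _ _ (2 * (M / (1 - q)) * q ^+ N) q) => // n; rewrite add0r -mulrA -exprD.
have <- : \sum_(k < N + n) u k = \sum_(k < N) u k; last exact: csum_tail.
by rewrite big_split_ord /= [X in _ + X]big1 ?addr0 // => k _; rewrite u0 // leq_addr.
Qed.

Definition radial m : R[i] := (1 - dy m)%:C.

(** The value of the k-th kernel at [radial m]. *)
Definition kap k m : R := dy k / (dy k + dy m).

Lemma normc_radial m : normc (radial m) = 1 - dy m.
Proof. by rewrite normc_real ger0_norm // subr_ge0 dy_le1. Qed.

Lemma radial_disk m : unit_disk (radial m).
Proof. by rewrite /unit_disk /= normc_radial ltrBlDr ltrDl dy_gt0. Qed.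

Lemma kap_ge0 k m : 0 <= kap k m.
Proof. by rewrite divr_ge0 ?addr_ge0 // ltW // dy_gt0. Qed.

Lemma kap_le1 k m : kap k m <= 1.
Proof.
have dk := dy_gt0 R k; have dm := dy_gt0 R m.
by rewrite ler_pdivrMr ?addr_gt0 // mul1r lerDl ltW.
Qed.

Lemma kap_ge k m : (k <= m)%N -> 2^-1 <= kap k m.
Proof.
move=> km; have dk := dy_gt0 R k; have dm := dy_gt0 R m; have := dy_le R km.
by rewrite ler_pdivlMr ?addr_gt0 //; lra.
Qed.

Lemma tf_radial (B : R) (c : nat -> R[i]) (N m : nat) : tadm B c -> (forall k, (N <= k)%N -> c k = 0) ->
  tf c (radial m) = \sum_(k < N) c k * (kap k m)%:C.
Proof.
move=> H c0; have Dz := radial_disk m.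
have E k : (dy k)%:C / tden k (radial m) = (kap k m)%:C.
  rewrite /tden /radial -rmorphB.
  have -> : 1 + dy k - (1 - dy m) = dy k + dy m by ring.
  by rewrite /kap rmorphM /=; congr (_ * _); rewrite fmorphV.
have q0 : (0 : R) <= 3 / 4 by lra.
have q1 : (3 / 4 : R) < 1 by lra.
rewrite /tf (csum_finite q0 q1 (tf_bounded H Dz) (N := N)); last first.
  by move=> k kN; rewrite c0 // !mul0r.
by apply: eq_bigr => k _; rewrite -mulrA E.
Qed.

Lemma block_sum (X : R) (n n1 m : nat) :
  \sum_(k < n) (if (n1 <= k < m)%N then X else 0) = (minn n m - n1)%:R * X.
Proof.
elim: n => [|n IH]; first by rewrite big_ord0 min0n sub0n mul0r.
rewrite big_ord_recr /= IH.
have [nm|mn] := ltnP n m; last first.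
  by rewrite andbF addr0 (minn_idPr (leqW mn)).
rewrite andbT (minn_idPl nm).
have [n1n|nn1] := leqP n1 n; first by rewrite subSn // -natr1 mulrDl mul1r.
have -> : (n - n1 = 0)%N by apply/eqP; rewrite subn_eq0 ltnW.
have -> : (n.+1 - n1 = 0)%N by apply/eqP; rewrite subn_eq0.
by rewrite addr0.
Qed.

(* Perturbing [c0] by a constant [v] on a block of places changes the value of the test function
   at [radial m] by [v] times at least half the length of the block. *)
Lemma hump_reach (W T : nat -> R) (om B : R) (phi : R[i] -> R[i]) : entire phi ->
  0 <= om -> (forall m, 0 < T m) -> (forall k, 0 <= W k <= B * (3 / 2) ^+ k) ->
  (forall c, wbounded W c -> mass_le om c 2 ->
    exists C : R, forall m, normc (phi (tf c (radial m))) <= C * T m) ->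
  exists n0 A r C, [/\ 0 < r, 0 <= A & forall w n1 m, (n0 <= n1 < m)%N ->
    (forall k, (n1 <= k < m)%N -> 2 * (normc w + A) / (m - n1)%:R <= W k) ->
    om * (4 * (normc w + A) ^+ 2 / (m - n1)%:R) <= r ->
    normc (phi w) <= C * T m].
Proof.
move=> hphi om0 T0 HW pw.
have W0 k : 0 <= W k by have /andP[] := HW k.
have adm c : wbounded W c -> tadm B c.
  by move=> H k; apply: le_trans (H k) _; have /andP[] := HW k.
have B0 : 0 <= B by have /andP[/le_trans h /h] := HW 0%N; rewrite expr0 mulr1.
have robust m c t : wbounded W c -> t < normc (phi (tf c (radial m))) ->
   exists n : nat, forall c', wbounded W c' -> (forall k, (k < n)%N -> c' k = c k) ->
     t < normc (phi (tf c' (radial m))).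
  move=> bc lt; set w := tf c (radial m) in lt *.
  have e0 : 0 < (normc (phi w) - t) / 2 by rewrite divr_gt0 // subr_gt0.
  have cw : cca phi w by have /C_derivableP := hphi w; exact: is_cd_cca.
  have [d d0 Hd] := cw _ e0.
  have d20 : 0 < d / 2 by rewrite divr_gt0.
  have [n Hn] := @exists_pow_le R (16 * B / (1 - normc (radial m))) (3 / 4) _ ltac:(lra) ltac:(lra) d20.
  exists n => c' bc' ec'.
  have h : normc (tf c' (radial m) - w) < d.
    apply: le_lt_trans (tf_agree (adm _ bc) (adm _ bc') (radial_disk m) ec') _.
    by apply: le_lt_trans Hn _; lra.
  have := Hd _ h; rewrite [w + _]addrC subrK => h2.
  have := ler_dist_normc (phi w) (phi (tf c' (radial m))); rewrite normcB => /(le_trans (ler_norm _)).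
  lra.
have [n0 [c0 [r [C [r0 bc0 sc0 H]]]]] := gliding_hump T0 W0 robust pw.
pose A := \sum_(k < n0) normc (c0 k).
exists n0, A, r, C; split => //; first by apply: sumr_ge0 => k _; exact: normc_ge0.
move=> w n1 m /andP[n01 n1m] hW hr.
have mn0 : (0 : R) < (m - n1)%:R by rewrite ltr0n subn_gt0.
pose S := \sum_(k < m) (if (n1 <= k < m)%N then kap k m else 0).
have S2 : (m - n1)%:R / 2 <= S.
  have := block_sum 2^-1 m n1 m; rewrite minnn => <-; apply: ler_sum => k _.
  by case: ifP => // _; exact: kap_ge (ltnW (ltn_ord k)).
have S0 : 0 < S by apply: lt_le_trans S2; rewrite divr_gt0.
pose w0 := \sum_(k < n0) c0 k * (kap k m)%:C.
have w0A : normc w0 <= A.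
  rewrite /w0 /A; elim: n0 {sc0 H n01 hW hr A w0} => [|n IH]; first by rewrite !big_ord0 normc0.
  rewrite !big_ord_recr /=; apply: le_trans (le_normcD _ _) _; apply: lerD => //.
  by rewrite normcM normc_real ger0_norm ?kap_ge0 // ler_piMr ?normc_ge0 // kap_le1.
(* [w0] is the contribution of [c0] and [S] that of a unit block, so this height makes the value
   exactly [w]. Since S is at least half the block length, the height is at most 2 (|w| + A) over
   that length. *)
pose v := (w - w0) / S%:C.
have Sc0 : S%:C != 0 by rewrite -normc_gt0 normc_real gtr0_norm.
have vle : normc v <= 2 * (normc w + A) / (m - n1)%:R.
  rewrite normcM normcV normc_real gtr0_norm //.
  have -> : 2 * (normc w + A) / (m - n1)%:R = (normc w + A) * ((m - n1)%:R / 2)^-1.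
    by field; exact: lt0r_neq0.
  apply: ler_pM; rewrite ?normc_ge0 ?invr_ge0 ?(ltW S0) //.
    by apply: le_trans (le_normcD _ _) _; rewrite normcN lerD2l.
  by rewrite lef_pV2 ?posrE // divr_gt0.
pose c k := c0 k + (if (n1 <= k < m)%N then v else 0).
have bc : wbounded W c.
  move=> k; rewrite /c; case: ifPn => [km|_]; last by rewrite addr0.
  rewrite sc0 ?add0r; last by case/andP: km => h _; exact: leq_trans h.
  exact: le_trans vle (hW k km).
have sc k : (m <= k)%N -> c k = 0.
  by move=> mk; rewrite /c sc0 ?[(k < m)%N]ltnNge ?mk ?andbF ?addr0 // (leq_trans _ mk) // ltnW // (leq_ltn_trans n01).
have ec k : (k < n0)%N -> c k = c0 k.
  by move=> kn; rewrite /c leqNgt (leq_trans kn n01) addr0.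
have Ew : tf c (radial m) = w.
  rewrite (tf_radial m (adm _ bc) sc).
  rewrite (eq_bigr (fun k : 'I_m => c0 k * (kap k m)%:C + v * (if (n1 <= k < m)%N then kap k m else 0)%:C)); last first.
    by move=> k _; rewrite /c mulrDl; congr (_ + _); case: ifP => _ //; rewrite mul0r mulr0.
  rewrite big_split /= -mulr_sumr -rmorph_sum /= -/S /v mulfVK //.
  have -> : \sum_(k < m) c0 k * (kap k m)%:C = w0.
    rewrite -(subnKC (leq_trans n01 (ltnW n1m))) big_split_ord /= [X in _ + X]big1 ?addr0; last first.
      by move=> k _; rewrite sc0 ?mul0r // leq_addr.
    by rewrite /w0 subnKC // (leq_trans n01 (ltnW n1m)).
  by rewrite addrC subrK.
rewrite -Ew; apply: (H c m) => // n.
apply: le_trans hr.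
rewrite (eq_bigr (fun k : 'I_n => if (n1 <= k < m)%N then om * normc v ^+ 2 else 0)); last first.
  by move=> k _; rewrite /c addrC addKr; case: ifP => // _; rewrite normc0 expr0n mulr0.
rewrite block_sum mulrCA ler_wpM2l //.
apply: (@le_trans _ _ ((m - n1)%:R * (2 * (normc w + A) / (m - n1)%:R) ^+ 2)).
  apply: ler_pM => //; first exact: sqr_ge0.
    by rewrite ler_nat leq_sub2r // geq_minr.
  have A0 : 0 <= A by apply: sumr_ge0 => k _; exact: normc_ge0.
  apply: lerXn2r; rewrite ?nnegrE ?normc_ge0 // divr_ge0 ?mulr_ge0 ?addr_ge0 ?normc_ge0 //.
by rewrite le_eqVlt; apply/orP; left; apply/eqP; field; exact: lt0r_neq0.
Qed.

End reach.


(** * Necessity of the growth conditions *)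

Section necessity.
Context (R : realType).
Local Notation dy k := ((2 : R) ^- k).
Implicit Types phi : R[i] -> R[i].

Lemma nat_between (y : R) : 0 <= y -> exists2 n : nat, (0 < n)%N & y <= n%:R <= y + 1.
Proof.
move=> y0; exists (Num.truncn y).+1 => //; apply/andP; split; first exact: ltW (truncnS_gt _).
by rewrite -natr1 lerD2r truncn_le.
Qed.

Lemma pow2_le_expR (n : nat) : (2 : R) ^+ n <= expR n%:R.
Proof.
have h : (2 : R) <= expR 1 by have := expR_ge1Dx (1 : R); lra.
by rewrite -[n%:R]mulr1 expRM_natl; apply: lerXn2r; rewrite ?nnegrE ?expR_ge0.
Qed.

Lemma bergman_pointwise phi (p alpha : R) : 0 < p -> exists N : nat, forall f,
  bergman_space p alpha (superposition phi f) ->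
  exists C : R, forall m, normc (phi (f (radial R m))) <= C * 2 ^+ (N * m).
Proof.
move=> p0; have [N HN] := bergman_growth alpha p0; exists N => f /HN[C HC]; exists C => m.
have := HC _ (radial_disk R m); rewrite normc_radial.
have -> : 1 - (1 - dy m) = dy m by ring.
by rewrite exprVn ler_pdivrMr ?exprn_gt0 // -exprM mulnC.
Qed.

Lemma Dirichlet_necessary phi (p alpha : R) : entire phi -> 0 < p ->
  (forall f, dirichlet_space f -> bergman_space p alpha (superposition phi f)) ->
  exists A B : R, 0 < B /\ forall w, normc (phi w) <= expR (A + B * normc w ^+ 2).
Proof.
move=> hphi p0 H; have [N HN] := bergman_pointwise phi alpha p0.
(* [om] = 1 imposes square summability; the weight 2 merely caps single coefficients. *)
have [||||n0 [A [r [C [r0 A0 HC]]]]] := @hump_reach R (fun=> 2) (fun m => 2 ^+ (N * m)) 1 2 phi hphi.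
- by [].
- by move=> m; exact: exprn_gt0.
- by move=> k; rewrite ler0n ler_peMr //; apply: exprn_ege1; lra.
- move=> c _ mc; apply: HN; apply: H; apply: (@tf_Dirichlet R c 2) => n.
  by have := mc n; under eq_bigr do rewrite mul1r.
pose r' := Num.min r 1.
have r'0 : 0 < r' by rewrite lt_min r0 ltr01.
have r'1 : r' <= 1 by rewrite ge_min lexx orbT.
have r'r : r' <= r by rewrite ge_min lexx.
move: (r') r'0 r'1 r'r => {}r' r'0 r'1 r'r.
exists (C + N%:R * (n0%:R + 2 + 8 * A ^+ 2 / r')), (8 * N%:R / r' + 1).
have B0 : 0 <= 8 * N%:R / r' by rewrite divr_ge0 // ?mulr_ge0 // ltW.
split=> [|w]; first by lra.
pose t := normc w + A; have t0 : 0 <= t by rewrite addr_ge0 ?normc_ge0.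
have tr : 4 * t ^+ 2 <= 4 * t ^+ 2 / r'.
  by rewrite ler_pdivlMr // ler_piMr // mulr_ge0 // sqr_ge0.
have t2 : 0 <= t ^+ 2 by exact: sqr_ge0.
have y0 : 0 <= 4 * t ^+ 2 / r' + 1 by lra.
(* A block of length m >= 4 t^2 / r' + 1 has mass 4 t^2 / m at most r'. It also gives t <= m, so its
   coefficients 2 t / m respect the weight 2. *)
have [m m0 /andP[ym my]] := nat_between y0.
have mp : (0 : R) < m%:R by rewrite ltr0n.
have := HC w n0 (n0 + m)%N; rewrite leqnn -[X in (X < _)%N]addn0 ltn_add2l m0 addnC addnK mul1r => /(_ isT).
have tm : t <= m%:R by have := sqr_ge0 (t - 1); rewrite sqrrB; nra.
move=> /(_ _ _) h; apply: le_trans (h _ _) _.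
- by move=> k _; rewrite ler_pdivrMr // ler_pM2l.
- apply: le_trans r'r; rewrite ler_pdivrMr // -/t.
  have : 4 * t ^+ 2 / r' <= m%:R by lra.
  by rewrite ler_pdivrMr // [m%:R * _]mulrC.
apply: (@le_trans _ _ (expR C * expR (N * (m + n0))%:R)).
  apply: (@le_trans _ _ (expR C * 2 ^+ (N * (m + n0)))).
    by rewrite ler_wpM2r ?exprn_ge0 //; have := expR_ge1Dx C; lra.
  by rewrite ler_pM2l ?expR_gt0 // pow2_le_expR.
rewrite -expRD ler_expR -addrA lerD2l natrM natrD.
have N0 : (0 : R) <= N%:R by [].
apply: (@le_trans _ _ (N%:R * (4 * t ^+ 2 / r' + 1 + 1 + n0%:R))).
  by rewrite ler_wpM2l // lerD2r.
have -> : N%:R * (n0%:R + 2 + 8 * A ^+ 2 / r') + (8 * N%:R / r' + 1) * normc w ^+ 2 =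
  N%:R * (8 * (A ^+ 2 + normc w ^+ 2) / r' + 1 + 1 + n0%:R) + normc w ^+ 2.
  by field; exact: lt0r_neq0.
rewrite ler_wpDr ?sqr_ge0 // ler_wpM2l // !lerD2r ler_pM2r ?invr_gt0 //.
by rewrite /t; have := sqr_ge0 (normc w - A); rewrite !expr2; nra.
Qed.

Lemma Q_necessary phi (p alpha s : R) : entire phi -> 0 < p -> 0 < s ->
  (forall f, Q_space s f -> bergman_space p alpha (superposition phi f)) ->
  forall e : R, 0 < e -> exists A : R, forall w, normc (phi w) <= expR (A + e * normc w).
Proof.
move=> hphi p0 s0 H e e0; have [N HN] := bergman_pointwise phi alpha p0.
have N0 : (0 : R) <= N%:R by [].
(* A block of height [K] reaches [w] in about 2 |w| / K places, so phi(w) is at most of size 2^(2 N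
   |w| / K), and K is taken with 2 N / K <= e. The gliding hump is run anew for each K, so its
   constants depend on [e]. *)
pose K := 2 * N%:R / e + 1.
have K0 : 0 < K by rewrite ltr_wpDl // divr_ge0 ?mulr_ge0 // ltW.
have KN : 2 * N%:R / K <= e.
  rewrite ler_pdivrMr // /K.
  have -> : e * (2 * N%:R / e + 1) = 2 * N%:R + e by field; exact: lt0r_neq0.
  by rewrite lerDl ltW.
have [||||n0 [A [r [C [r0 A0 HC]]]]] := @hump_reach R (fun=> K) (fun m => 2 ^+ (N * m)) 0 K phi hphi.
- by [].
- by move=> m; exact: exprn_gt0.
- by move=> k; rewrite (ltW K0) ler_peMr ?(ltW K0) //; apply: exprn_ege1; lra.
- by move=> c bc _; apply: HN; apply: H; exact: tf_Q s0 bc.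
exists (C + N%:R * (n0%:R + 1 + 2 * A / K)) => w.
pose t := normc w + A; have t0 : 0 <= t by rewrite addr_ge0 ?normc_ge0.
have y0 : 0 <= 2 * t / K by rewrite divr_ge0 ?mulr_ge0 // ltW.
have [m m0 /andP[ym my]] := nat_between y0.
have mp : (0 : R) < m%:R by rewrite ltr0n.
have := HC w n0 (n0 + m)%N; rewrite leqnn -[X in (X < _)%N]addn0 ltn_add2l m0 addnC addnK mul0r => /(_ isT).
move=> /(_ _ (ltW r0)) h; apply: le_trans (h _) _.
  by move=> k _; rewrite ler_pdivrMr // [K * _]mulrC -ler_pdivrMr.
apply: (@le_trans _ _ (expR C * expR (N * (m + n0))%:R)).
  apply: (@le_trans _ _ (expR C * 2 ^+ (N * (m + n0)))).
    by rewrite ler_wpM2r ?exprn_ge0 //; have := expR_ge1Dx C; lra.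
  by rewrite ler_pM2l ?expR_gt0 // pow2_le_expR.
rewrite -expRD ler_expR -addrA lerD2l natrM natrD.
apply: (@le_trans _ _ (N%:R * (2 * t / K + 1 + n0%:R))).
  by rewrite ler_wpM2l // lerD2r.
have -> : N%:R * (2 * t / K + 1 + n0%:R) = N%:R * (n0%:R + 1 + 2 * A / K) + 2 * N%:R / K * normc w.
  by rewrite /t; field; exact: lt0r_neq0.
by rewrite lerD2l ler_wpM2r ?normc_ge0.
Qed.

Lemma Bernoulli (h : R) k : 0 <= h -> 1 + k%:R * h <= (1 + h) ^+ k.
Proof.
move=> h0; elim: k => [|k IH]; first by rewrite mul0r addr0 expr0.
rewrite exprSr -natr1; have h1 : 0 <= 1 + h by lra.
apply: le_trans (ler_wpM2r h1 IH).
have := mulr_ge0 (ler0n R k) (sqr_ge0 h); rewrite expr2; lra.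
Qed.

(** Bernoulli with h <= 1 gives (k+1) h <= (1+h)^k. Squaring, it remains that (1+h)^2 <= 1 + 3 h <=
    x, which explains the division by 3 in the choice of [h]. *)
Lemma square_subexponential (x : R) : 1 < x -> exists K : R, forall k, (k.+1%:R) ^+ 2 <= K * x ^+ k.
Proof.
move=> x1; pose h := Num.min 1 ((x - 1) / 3).
have h0 : 0 < h by rewrite lt_min ltr01 divr_gt0 // subr_gt0.
have h1 : h <= 1 by rewrite ge_min lexx.
have hx : h <= (x - 1) / 3 by rewrite ge_min lexx orbT.
exists (h ^+ 2)^-1 => k; rewrite mulrC ler_pdivlMr ?exprn_gt0 // -exprMn.
apply: (@le_trans _ _ (((1 + h) ^+ 2) ^+ k)); last first.
  by apply: lerXn2r; rewrite ?nnegrE ?sqr_ge0 //; [lra|rewrite expr2; nra].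
rewrite exprAC; apply: lerXn2r; rewrite ?nnegrE ?mulr_ge0 ?exprn_ge0 ?addr_ge0 ?(ltW h0) //.
apply: le_trans (Bernoulli k (ltW h0)).
by rewrite -natr1 mulrDl mul1r addrC lerD2r.
Qed.

Lemma Liouville phi : entire phi ->
  (forall e : R, 0 < e -> exists D : R, forall w, normc (phi w) <= D + e * normc w) -> constant_fun phi.
Proof.
move=> hphi H; exists (phi 0) => u.
have d w : is_cd phi w (C_deriv phi w) by apply/C_derivableP; exact: hphi.
have d0 w : normc (C_deriv phi w) <= 0.
  apply/ler_addgt0Pr => e e0; rewrite add0r.
  have e32 : 0 < e / 32 by rewrite divr_gt0.
  have [D HD] := H _ e32.
  have D0 : 0 <= D + e / 32 * normc w by apply: le_trans (HD w); exact: normc_ge0.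
  (* Cauchy's estimate on a square of half-side [r], reaching to distance 2 r, gives 8 (D + e|w|/32)
     / r + e/2; this [r] makes the first term at most e/2. *)
  pose r := 16 * (D + e / 32 * normc w) / e + 1.
  have r0 : 0 < r by rewrite ltr_wpDl // divr_ge0 ?mulr_ge0 // ltW.
  have := @cauchy_estimate R phi w (C_deriv phi w) r (D + e / 32 * (normc w + 2 * r)) r0 _ _ (d w).
  move=> /(_ _ _) h; apply: le_trans (h _ _) _.
  - by move=> z _; exists (C_deriv phi z).
  - move=> z /csq_normc hz; apply: le_trans (HD z) _; rewrite lerD2l ler_wpM2l ?(ltW e32) //.
    by rewrite -{1}[z](subrK w) addrC; apply: le_trans (le_normcD _ _) _; rewrite lerD2l.
  rewrite ler_pdivrMr // /r; set X := normc w.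
  have -> : 8 * (D + e / 32 * (X + 2 * (16 * (D + e / 32 * X) / e + 1))) =
    8 * (D + e / 32 * X) + 8 * (D + e / 32 * X) + e / 2 by field; exact: lt0r_neq0.
  have -> : e * (16 * (D + e / 32 * X) / e + 1) = 16 * (D + e / 32 * X) + e by field; exact: lt0r_neq0.
  lra.
have := @mvi R phi (C_deriv phi) 0 u 0 (fun t _ => d _) (fun t _ => d0 _).
rewrite mulr0 mul0r add0r => h.
by apply/eqP; rewrite -subr_eq0 -normc_eq0 eq_le normc_ge0 h.
Qed.

Lemma constant_necessary phi (p alpha s : R) : entire phi -> 0 < p -> -1 < alpha -> 0 <= s ->
  (forall f, bergman_space p alpha f -> Q_space s (superposition phi f)) -> constant_fun phi.
Proof.
move=> hphi p0 a1 s0 H; apply: Liouville => // e e0.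
have [B HB] := @square_subexponential (3 / 2) ltac:(lra).
(* Weights growing as (k+1)^2 still give functions in every Bergman space, and they let a single
   coefficient of index about |w|^(1/2) reach [w]. *)
have [||||n0 [A [r [C [r0 A0 HC]]]]] :=
    @hump_reach R (fun k => (k.+1%:R) ^+ 2) (fun m => m.+1%:R) 0 B phi hphi.
- by [].
- by move=> m; rewrite ltr0n.
- by move=> k; rewrite sqr_ge0 HB.
- move=> c bc _; have Bc : bergman_space p alpha (tf c).
    apply: tf_Bergman => // x x1; have [K HK] := square_subexponential x1.
    by exists K => k; exact: le_trans (bc k) (HK k).
  have [Hf [C [C0 HC]]] := Q_Bloch s0 (H (tf c) Bc).
  exists (normc (superposition phi (tf c) 0) + 2 * C) => m.
  have := Bloch_growth Hf C0 HC (_ : normc (radial R m) <= 1 - dy m).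
  rewrite normc_radial lexx => /(_ isT) h; apply: le_trans h _.
  rewrite /= -(natr1 m) mulrDr mulr1 mulrDl.
  have := mulr_ge0 (normc_ge0 (superposition phi (tf c) 0)) (ler0n R m); lra.
pose C' := Num.max C 1; have C'0 : 0 < C' by rewrite lt_max ltr01 orbT.
have CC' : C <= C' by rewrite le_max lexx.
pose e' := e / C'; have e'0 : 0 < e' by rewrite divr_gt0.
exists (C' * (n0%:R + 3 + e'^-1 + e' * A)) => w.
pose t := normc w + A; have t0 : 0 <= t by rewrite addr_ge0 ?normc_ge0.
(* The block is the single place n0 + j. By the arithmetic-geometric mean inequality (e' t + 1/e')^2
   >= 2 t, so j above this value meets the weight, and the resulting bound already has the form D +
   e |w| required by [Liouville]. *)
have y0 : 0 <= e' * t + e'^-1 by rewrite addr_ge0 ?mulr_ge0 ?invr_ge0 // ltW.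
have [j j0 /andP[yj jy]] := nat_between y0.
have := HC w (n0 + j)%N (n0 + j).+1; rewrite leq_addr ltnSn subSnn mul0r => /(_ isT).
move=> /(_ _ (ltW r0)) h; apply: le_trans (h _) _.
  move=> k /andP[k1 k2]; have -> : k = (n0 + j)%N by apply/eqP; rewrite eqn_leq k1 -ltnS k2.
  rewrite divr1 -/t; apply: (@le_trans _ _ ((e' * t + e'^-1) ^+ 2)).
    have E : e' * t * e'^-1 = t by rewrite mulrAC divff ?mul1r // gt_eqF.
    have := sqr_ge0 (e' * t - e'^-1); rewrite sqrrB sqrrD E.
    have := sqr_ge0 (e' * t); have := sqr_ge0 e'^-1; lra.
  apply: lerXn2r; rewrite ?nnegrE // (le_trans yj) // ler_nat.
  by rewrite -addSn leq_addl.
apply: (@le_trans _ _ (C' * ((n0 + j).+2)%:R)); first by rewrite ler_wpM2r.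
have -> : C' * (n0%:R + 3 + e'^-1 + e' * A) + e * normc w = C' * (n0%:R + 3 + e'^-1 + e' * t).
  by rewrite /t /e'; field; rewrite (lt0r_neq0 C'0) (lt0r_neq0 e0).
rewrite ler_pM2l // -(natr1 (n0 + j).+1) -(natr1 (n0 + j)) natrD; lra.
Qed.

End necessity.


(** * Order and type in terms of explicit exponential bounds *)

Section order_type.
Context (R : realType).
Implicit Types phi : R[i] -> R[i].

Lemma limsup_le (g : R -> R) (x r0 : R) : (forall r, r0 < r -> g r <= x) ->
  (limf_esup (fun r => (g r)%:E) (pinfty_nbhs R) <= x%:E)%E.
Proof.
move=> H; apply: ge_ereal_inf.
exists (ereal_sup [set (g r)%:E | r in [set r | r0 < r]]).
  by exists [set r | r0 < r] => //; exists r0; split => //; exact: num_real.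
by apply: ge_ereal_sup => _ [r /= /H hr <-]; rewrite lee_fin.
Qed.

Lemma limsup_lt (g : R -> R) (x : R) :
  (limf_esup (fun r => (g r)%:E) (pinfty_nbhs R) < x%:E)%E ->
  exists r0, forall r, r0 < r -> g r < x.
Proof.
move=> /ereal_inf_lt[_ [V [r0 [_ HV]] <-] h]; exists r0 => r /HV Vr.
by rewrite -lte_fin; apply: le_lt_trans h; apply: ereal_sup_ubound; exists r.
Qed.

Lemma max_modulus_ge phi w : entire phi -> normc (phi w) <= max_modulus (normc w) phi.
Proof.
move=> hphi; have [M HM] := @bounded_disk R phi (normc w) (fun z _ => is_cd_cca (iffLR (C_derivableP _ _) (hphi z))).
apply: ub_le_sup; last by exists w.
by exists M => _ [z /= zw <-]; apply: HM; rewrite zw.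
Qed.

Lemma max_modulus_le phi (r X : R) : 0 <= r -> (forall w, normc w = r -> normc (phi w) <= X) ->
  max_modulus r phi <= X.
Proof.
move=> r0 H; apply: ge_sup; last by move=> _ [z /= zr <-]; exact: H.
by exists (normc (phi r%:C)); exists r%:C => //=; rewrite normc_real ger0_norm.
Qed.

Lemma ln_max_modulus_le phi (A B : R) (q : nat) (r : R) : 0 <= B -> 0 <= r ->
  (forall w, normc (phi w) <= expR (A + B * normc w ^+ q)) ->
  ln (max_modulus r phi) <= `|A| + B * r ^+ q.
Proof.
move=> B0 r0 H.
have h : max_modulus r phi <= expR (`|A| + B * r ^+ q).
  apply: max_modulus_le => // w wr; apply: le_trans (H w) _.
  by rewrite wr ler_expR lerD2r ler_norm.
have [M0|M0] := ltP 0 (max_modulus r phi).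
  by rewrite -(expRK (`|A| + _)) ler_ln ?posrE ?expR_gt0.
rewrite ln0 //; exact: addr_ge0 (normr_ge0 _) (mulr_ge0 B0 (exprn_ge0 _ r0)).
Qed.

Lemma order_le phi (A B : R) (q : nat) : 0 <= B ->
  (forall w, normc (phi w) <= expR (A + B * normc w ^+ q)) -> (entire_order phi <= q%:R%:E)%E.
Proof.
move=> B0 H; rewrite /entire_order; case: asboolP => [_|_]; first by rewrite lee_fin.
apply/lee_addgt0Pr => e e0; rewrite -EFinD.
pose K := `|A| + B + 1; have K1 : 1 <= K by rewrite lerDr addr_ge0.
(* For r > 1 one has ln M <= K r^q, hence ln ln M <= ln K + q ln r; beyond this radius ln K <= e ln
   r. *)
apply: (@limsup_le _ _ (expR (1 + ln K / e))) => r hr.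
have lK : 0 <= ln K by exact: ln_ge0.
have r1 : 1 < r.
  by apply: lt_trans hr; rewrite expR_gt1 ltr_pwDl // divr_ge0 // ltW.
have r0 : 0 < r by lra.
have lr : 1 + ln K / e < ln r by rewrite -(expRK (1 + _)) ltr_ln ?posrE ?expR_gt0.
have lr0 : 0 < ln r by rewrite ln_gt0.
have rq : 1 <= r ^+ q by apply: exprn_ege1; exact: ltW.
have LM := ln_max_modulus_le B0 (ltW r0) H.
rewrite ler_pdivrMr // mulrDl.
have [M0|M0] := ltP 0 (ln (max_modulus r phi)); last first.
  by rewrite ln0 // addr_ge0 // mulr_ge0 // ltW.
have : ln (max_modulus r phi) <= K * r ^+ q.
  apply: le_trans LM _; have := normr_ge0 A; rewrite /K; nra.
rewrite -ler_ln ?posrE ?mulr_gt0 ?exprn_gt0 //; last by lra.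
rewrite lnM ?posrE ?exprn_gt0 //; last by lra.
have : ln K <= e * ln r by rewrite mulrC -ler_pdivrMr //; lra.
rewrite lnXn // -mulr_natl; lra.
Qed.

Lemma type_le phi (A B e : R) (q : nat) : (0 < q)%N -> 0 <= B -> 0 < e ->
  (forall w, normc (phi w) <= expR (A + B * normc w ^+ q)) -> entire_order phi = q%:R%:E ->
  (entire_type phi <= (B + e)%:E)%E.
Proof.
move=> q0 B0 e0 H oq; rewrite /entire_type oq /=.
apply: (@limsup_le _ _ (1 + `|A| / e)) => r hr.
have Ae : 0 <= `|A| / e by rewrite divr_ge0 // ltW.
have r0 : 0 < r by lra.
rewrite powR_mulrn ?(ltW r0) // ler_pdivrMr ?exprn_gt0 //.
apply: le_trans (ln_max_modulus_le B0 (ltW r0) H) _.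
rewrite addrC mulrDl lerD2l.
have : `|A| <= e * r by rewrite mulrC -ler_pdivrMr //; lra.
move/le_trans; apply; rewrite ler_pM2l //.
by case: q q0 {H oq} => // q _; rewrite exprS ler_peMr ?(ltW r0) //; apply: exprn_ege1; lra.
Qed.

(* Otherwise [ln M < 0] eventually, and the convention [ln x = 0] for [x <= 0] makes the order
   at most [0]. *)
Lemma type_ge0 phi (q : nat) : (0 < q)%N -> entire_order phi = q%:R%:E -> (0 <= entire_type phi)%E.
Proof.
move=> q0 oq; rewrite leNgt; apply/negP; rewrite /entire_type oq /= => /limsup_lt[r0 H].
have : (entire_order phi <= 0%:E)%E.
  rewrite /entire_order; case: asboolP => // _.
  apply: (@limsup_le _ _ (Num.max r0 1)) => r; rewrite gt_max => /andP[/H h r1].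
  have rp : 0 < r by lra.
  move: h; rewrite ltr_pdivrMr ?powR_gt0 // mul0r => h.
  by rewrite ln0 ?mul0r // ltW.
by rewrite oq lee_fin leNgt ltr0n q0.
Qed.

Lemma growth_bound phi (t r0 : R) (q : nat) : entire phi -> 0 <= t ->
  (forall r, r0 < r -> ln (max_modulus r phi) <= t * r ^+ q) ->
  exists A, forall w, normc (phi w) <= expR (A + t * normc w ^+ q).
Proof.
move=> hphi t0 H.
have [K HK] := @bounded_disk R phi r0 (fun z _ => is_cd_cca (iffLR (C_derivableP _ _) (hphi z))).
exists `|K| => w.
have tw : 0 <= t * normc w ^+ q by rewrite mulr_ge0 // exprn_ge0 // normc_ge0.
have [wr|rw] := leP (normc w) r0.
  apply: le_trans (HK w wr) _; apply: le_trans (ler_norm K) _.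
  by apply: le_trans (expR_ge1Dx _); rewrite -lerBlDl; lra.
apply: le_trans (max_modulus_ge w hphi) _.
(* A nonpositive maximum modulus, where [ln] is 0 by convention, satisfies the bound trivially. *)
have [M0|M0] := ltP 0 (max_modulus (normc w) phi); last by rewrite (le_trans M0) // expR_ge0.
rewrite -[leLHS](lnK M0) ler_expR; apply: le_trans (H _ rw) _.
by rewrite lerDr.
Qed.

Lemma constant_bound phi (t : R) (q : nat) : constant_fun phi -> 0 <= t ->
  exists A, forall w, normc (phi w) <= expR (A + t * normc w ^+ q).
Proof.
move=> [c Hc] t0; exists (normc c) => w; rewrite Hc; apply: le_trans (expR_ge1Dx _).
have : 0 <= t * normc w ^+ q by rewrite mulr_ge0 // exprn_ge0 // normc_ge0.
lra.
Qed.

Lemma lt_real_between (y : \bar R) (x : R) : (y < x%:E)%E -> exists2 z : R, z < x & (y < z%:E)%E.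
Proof.
case: y => [y|//|_]; last by exists (x - 1); [rewrite ltrBlDr ltrDl|exact: ltNyr].
by rewrite lte_fin => yx; exists ((y + x) / 2); rewrite ?lte_fin; lra.
Qed.

(** With a real x strictly between the order and [q], eventually ln M <= r^x, and r^x <= e r^q once
    (q - x) ln r >= |ln e|. Constant [phi] is separated first, its order being set by convention
    rather than by the upper limit. *)
Lemma order_lt_bound phi (q : nat) (e : R) : entire phi -> (entire_order phi < q%:R%:E)%E -> 0 < e ->
  exists A, forall w, normc (phi w) <= expR (A + e * normc w ^+ q).
Proof.
move=> hphi + e0; have [cphi _|ncphi] := pselect (constant_fun phi).
  by apply: constant_bound => //; exact: ltW.
move=> /lt_real_between[x xq]; rewrite /entire_order; case: asboolP => // _ /limsup_lt[r0 H].
apply: (@growth_bound phi e (Num.max r0 (expR (1 + `|ln e| / (q%:R - x))))) => //; first exact: ltW.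
have qx : 0 < q%:R - x by rewrite subr_gt0.
move=> r; rewrite gt_max => /andP[/H h hr].
have p0 : 0 <= `|ln e| / (q%:R - x) by rewrite divr_ge0 // ltW.
have r1 : 1 < r by apply: lt_trans hr; rewrite expR_gt1; lra.
have rp : 0 < r by lra.
have lr : 1 + `|ln e| / (q%:R - x) < ln r by rewrite -(expRK (1 + _)) ltr_ln ?posrE ?expR_gt0.
have lr0 : 0 < ln r by rewrite ln_gt0.
have [M0|M0] := ltP 0 (ln (max_modulus r phi)); last first.
  by apply: le_trans M0 _; rewrite mulr_ge0 ?exprn_ge0 ?ltW.
rewrite -ler_ln ?posrE ?mulr_gt0 ?exprn_gt0 // lnM ?posrE ?exprn_gt0 // lnXn // -mulr_natl.
move: h; rewrite ltr_pdivrMr // => /ltW/le_trans; apply.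
have : `|ln e| <= (q%:R - x) * ln r by rewrite mulrC -ler_pdivrMr //; lra.
have := ler_norm (- ln e); rewrite normrN; lra.
Qed.

Lemma type_lt_bound phi (q : nat) (t : R) : entire phi -> entire_order phi = q%:R%:E -> 0 <= t ->
  (entire_type phi < t%:E)%E -> exists A, forall w, normc (phi w) <= expR (A + t * normc w ^+ q).
Proof.
move=> hphi oq t0; rewrite /entire_type oq /= => /limsup_lt[r0 H].
apply: (@growth_bound phi t (Num.max r0 0)) => // r; rewrite gt_max => /andP[/H h rp].
by move: h; rewrite powR_mulrn ?(ltW rp) // ltr_pdivrMr ?exprn_gt0 // => /ltW.
Qed.

Lemma constant_Q (c : R[i]) (s : R) : Q_space s (fun=> c).
Proof.
have d0 z : C_deriv (fun=> c) z = 0 by exact: is_cd_C_deriv (is_cd_cst c z).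
split; first by move=> z _; exact: is_cd_C_derivable (is_cd_cst c z).
apply: (@le_lt_trans _ _ 0%E); last exact: ltry.
apply: ge_ereal_sup => _ [a _ <-].
rewrite /disk_integral integral0_eq ?mule0 // => w _.
by rewrite d0 normc0 expr0n mul0r.
Qed.

End order_type.

Theorem theorem5 (R : realType) (phi : R[i] -> R[i]) (p alpha : R)
    (hphi : entire phi) (hp : 0 < p) (halpha : -1 < alpha) :
  [/\ superposition phi @` @dirichlet_space R `<=` bergman_space p alpha <->
        (entire_order phi < 2%:E)%E \/
        (entire_order phi = 2%:E /\ (entire_type phi < +oo)%E),
      forall s : R, 0 < s ->
        (superposition phi @` Q_space s `<=` bergman_space p alpha <->
          (entire_order phi < 1%:E)%E \/
          (entire_order phi = 1%:E /\ entire_type phi = 0%E))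
    & forall s : R, 0 <= s ->
        (superposition phi @` bergman_space p alpha `<=` Q_space s <->
          constant_fun phi)].
Proof.
split=> [|s s0|s s0].
- split=> [H|[eq2|[eq2 t2]] _ [f Df <-]].
  + have [A [B [B0 HB]]] := Dirichlet_necessary hphi hp (fun f Df => H _ (ex_intro2 _ _ f Df erefl)).
    (* The bound gives order at most 2; only in the case of equality is the type meaningful, and the
       same bound makes it at most B + 1. *)
    have := order_le (ltW B0) HB; rewrite le_eqVlt => /predU1P[eq2|]; last by left.
    right; split => //; apply: le_lt_trans (ltry (B + 1)).
    exact: type_le (ltW B0) ltr01 HB eq2.
  + have [A HA] := order_lt_bound hphi eq2 ltr01.
    exact: Dirichlet_sufficient hphi hp halpha ltr01 HA Df.
  have [t t0 tt] : exists2 t : R, 0 < t & (entire_type phi < t%:E)%E.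
    move: t2; case: (entire_type phi) => [t _|//|_]; last by exists 1; rewrite ?ltNyr.
    by exists (`|t| + 1); [rewrite ltr_wpDl|rewrite lte_fin (le_lt_trans (ler_norm t)) // ltrDl].
  have [A HA] := type_lt_bound hphi eq2 (ltW t0) tt.
  exact: Dirichlet_sufficient hphi hp halpha t0 HA Df.
- split=> [H|H _ [f Df <-]].
    have G := Q_necessary hphi hp s0 (fun f Df => H _ (ex_intro2 _ _ f Df erefl)).
    have [A HA] := G 1 ltr01.
    have := order_le (q := 1) ler01 HA; rewrite le_eqVlt => /predU1P[eq1|]; last by left.
    right; split => //; apply/eqP; rewrite eq_le; apply/andP; split; last exact: (type_ge0 (q := 1)).
    (* A bound with coefficient e/2 gives type at most e/2 + e/2, the second half absorbing the
       additive constant; [e] being arbitrary, the type is 0. *)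
    apply/lee_addgt0Pr => e e0; rewrite add0e.
    have e20 : 0 < e / 2 by rewrite divr_gt0.
    have [A' HA'] := G _ e20.
    rewrite [e in leRHS](splitr e).
    exact: (type_le (q := 1) _ (ltW e20) e20 HA' eq1).
  apply: (Q_sufficient hphi hp halpha (ltW s0) _ Df) => e e0.
  case: H => [eq1|[eq1 t1]]; first exact: (order_lt_bound (q := 1) hphi eq1 e0).
  by apply: (type_lt_bound (q := 1) hphi eq1 (ltW e0)); rewrite t1 lte_fin.
split=> [H|[c Hc] _ [f _ <-]].
  exact: constant_necessary hphi hp halpha s0 (fun f Df => H _ (ex_intro2 _ _ f Df erefl)).
have -> : superposition phi f = fun=> c by apply/funext => z; exact: Hc.
exact: constant_Q.
Qed.
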